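(* Let $n\geqslant 3$. Any action of $\mathrm{SAut}(F_n)$ on a set with fewer than $k(n)$ elements is trivial, where $k(3)=7$, $k(4)=8$, $k(5)=12$, $k(6)=14$, and for $n\geqslant 7$ \[ k(n)=\max_{r\leqslant \frac n2-3}\ \min\Big\{2^{\,n-r-p(n)},\ \binom nr\Big\}, \] where $r$ ranges over non-negative integers with $r \leqslant \frac n2-3$, and $p(n)$ equals $0$ when $n$ is odd and $1$ when $n$ is even.
   Context: $F_n$ is the free group of rank $n$. For $n\geqslant 3$, $\mathrm{SAut}(F_n)$ is the unique subgroup of index $2$ in $\mathrm{Aut}(F_n)$; it consists of the automorphisms whose induced action on the abelianisation $\mathbb{Z}^n$ of $F_n$ has determinant $1$. *)

(* Defs.v *)
From HB Require Import structures.
From mathcomp Require Import all_boot all_order all_algebra.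
From mathcomp Require Import boolp.

Set Implicit Arguments.
Unset Strict Implicit.
Unset Printing Implicit Defensive.

Import GRing.Theory.
Local Open Scope group_scope.

(* [(i, false)] is the generator [x_i] and [(i, true)] is its inverse. *)
Definition letter (n : nat) : Type := ('I_n * bool)%type.
HB.instance Definition _ n := Finite.on (letter n).

Definition letter_inv n (a : letter n) : letter n := (a.1, ~~ a.2).

Definition reduced n (w : seq (letter n)) : bool :=
  sorted (fun a b => b != letter_inv a) w.

(* The reduced form of [a :: w], for [w] reduced. *)
Definition red_cons n (a : letter n) (w : seq (letter n)) : seq (letter n) :=
  if w is b :: v then if b == letter_inv a then v else a :: w else [:: a].

(* The reduced form of [u ++ v], for [v] reduced. *)
Definition red_cat n (u v : seq (letter n)) : seq (letter n) :=
  foldr (@red_cons n) v u.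

Definition word_inv n (u : seq (letter n)) : seq (letter n) :=
  rev (map (@letter_inv n) u).

Definition freeGroup (n : nat) : Type := {w : seq (letter n) | reduced w}.
HB.instance Definition _ n := SubChoice.on (freeGroup n).

Section FreeGroup.
Variable n : nat.
Implicit Types (a b : letter n) (u v w : seq (letter n)) (x y z : freeGroup n).

Lemma letter_invK : involutive (@letter_inv n).
Proof. by case=> i b; rewrite /letter_inv /= negbK. Qed.

Lemma red_cons_reduced a w : reduced w -> reduced (red_cons a w).
Proof.
case: w => //= b v rv; case: ifP => [_|/negbT ab] /=; last by rewrite ab.
by apply: path_sorted rv.
Qed.

Lemma red_cat_reduced u w : reduced w -> reduced (red_cat u w).
Proof. by move=> rw; elim: u => //= a u; exact: red_cons_reduced. Qed.

Lemma red_cons_id a w : reduced (a :: w) -> red_cons a w = a :: w.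
Proof. by case: w => //= b v /andP[/negbTE ->]. Qed.

Lemma red_consK a w : reduced w ->
  red_cons (letter_inv a) (red_cons a w) = w.
Proof.
case: w => [|b v] rw /=; first by rewrite letter_invK eqxx.
case: eqP => [ba|ba] /=; last by rewrite letter_invK eqxx.
by rewrite -ba; exact: red_cons_id.
Qed.

Lemma red_consVK a w : reduced w ->
  red_cons a (red_cons (letter_inv a) w) = w.
Proof. by move=> /(red_consK (letter_inv a)); rewrite letter_invK. Qed.

Lemma red_cat0 u : reduced u -> red_cat u [::] = u.
Proof.
elim: u => //= a u IH ru; rewrite IH; last exact: path_sorted ru.
exact: red_cons_id.
Qed.

Lemma red_cat_cons a u w : reduced w ->
  red_cat (red_cons a u) w = red_cons a (red_cat u w).
Proof.
move=> rw; case: u => //= b v; case: eqP => //= ->.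
by rewrite red_consVK // red_cat_reduced.
Qed.

Lemma red_catA u v w : reduced w ->
  red_cat u (red_cat v w) = red_cat (red_cat u v) w.
Proof. by move=> rw; elim: u => //= a u ->; rewrite red_cat_cons. Qed.

Lemma word_invK : involutive (@word_inv n).
Proof. by move=> u; rewrite /word_inv map_rev revK (mapK letter_invK). Qed.

Lemma word_inv_reduced u : reduced u -> reduced (word_inv u).
Proof.
rewrite /reduced /word_inv rev_sorted sorted_map; apply: sub_sorted => a b /=.
by rewrite letter_invK eq_sym.
Qed.

Lemma red_catVK u w : reduced w -> red_cat (word_inv u) (red_cat u w) = w.
Proof.
move=> rw; elim: u => //= a u IH.
rewrite /word_inv /= rev_cons /red_cat foldr_rcons red_consK ?IH //.
exact: red_cat_reduced.
Qed.

Definition fg_one : freeGroup n := exist _ [::] isT.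
Definition fg_mul x y : freeGroup n :=
  exist _ (red_cat (val x) (val y)) (red_cat_reduced (val x) (valP y)).
Definition fg_inv x : freeGroup n :=
  exist _ (word_inv (val x)) (word_inv_reduced (valP x)).

Lemma fg_mulA : associative fg_mul.
Proof. by move=> x y z; apply: val_inj; rewrite /= red_catA ?(valP z). Qed.
Lemma fg_mul1 : left_id fg_one fg_mul.
Proof. by move=> x; apply: val_inj. Qed.
Lemma fg_mulr1 : right_id fg_one fg_mul.
Proof. by move=> x; apply: val_inj; rewrite /= red_cat0 ?(valP x). Qed.
Lemma fg_mulV : left_inverse fg_one fg_inv fg_mul.
Proof.
move=> x; apply: val_inj => /=.
by rewrite -{2}[val x]red_cat0 ?(valP x) // red_catVK.
Qed.
Lemma fg_mulrV : right_inverse fg_one fg_inv fg_mul.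
Proof.
move=> x; have -> : x = fg_inv (fg_inv x).
  by apply: val_inj; rewrite /= word_invK.
rewrite (_ : fg_inv (fg_inv (fg_inv x)) = fg_inv x) ?fg_mulV //.
  by apply: val_inj; rewrite /= word_invK.
Qed.

HB.instance Definition _ := isGroup.Build (freeGroup n)
  fg_mulA fg_mul1 fg_mulr1 fg_mulV fg_mulrV.

Definition fg_gen (i : 'I_n) : freeGroup n := exist _ [:: (i, false)] isT.

Definition fg_letter a : freeGroup n := exist _ [:: a] isT.

Lemma fg_letterE a : fg_letter a = if a.2 then (fg_gen a.1)^-1 else fg_gen a.1.
Proof. by case: a => i [] //; apply: val_inj. Qed.

Lemma fg_prod x : x = \prod_(a <- val x) fg_letter a.
Proof.
case: x => u ru; rewrite [val _]/=; elim: u ru => [|a u IH] ru.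
  by rewrite big_nil; apply: val_inj.
rewrite big_cons -(IH (path_sorted ru)).
by apply: val_inj; rewrite /= red_cons_id.
Qed.

(* [freeGroup n] is free on the [fg_gen i]. *)
Lemma fg_unique (G : groupType) (f g : freeGroup n -> G) :
    {morph f : x y / x * y} -> {morph g : x y / x * y} ->
  (forall i, f (fg_gen i) = g (fg_gen i)) -> f =1 g.
Proof.
have m1 (h : freeGroup n -> G) : {morph h : x y / x * y} -> h 1 = 1.
  by move=> hM; apply: (mulgI (h 1)); rewrite -hM !mulg1.
have mV (h : freeGroup n -> G) x : {morph h : x y / x * y} -> h x^-1 = (h x)^-1.
  by move=> hM; apply: (mulgI (h x)); rewrite -hM !mulgV m1.
move=> fM gM fg x; rewrite [x]fg_prod.
rewrite (big_morph f fM (m1 _ fM)) (big_morph g gM (m1 _ gM)).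
apply: eq_bigr => a _; rewrite fg_letterE.
by case: a.2; rewrite ?mV // fg.
Qed.

Lemma fg_extend (G : groupType) (h : 'I_n -> G) :
  exists2 f : freeGroup n -> G,
    {morph f : x y / x * y} & forall i, f (fg_gen i) = h i.
Proof.
pose l (a : letter n) := if a.2 then (h a.1)^-1 else h a.1.
have lV a : l (letter_inv a) = (l a)^-1.
  by case: a => i []; rewrite /l /= ?invgK.
exists (fun x => \prod_(a <- val x) l a); last first.
  by move=> i; rewrite big_seq1.
move=> x y /=; elim: (val x) => [|a u IH] /=; first by rewrite big_nil mul1g.
rewrite big_cons -mulgA -IH.
case: (red_cat u _) => [|b v] /=; first by rewrite big_seq1 big_nil mulg1.
case: eqP => [->|_]; last by rewrite big_cons.
by rewrite big_cons lV mulgA mulgV mul1g.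
Qed.

(* The abelianisation F_n -> Z^n, given by exponent sums; see
   [fg_ab_universal]. *)
Definition fg_ab x : 'rV[int]_n :=
  \row_i ((count_mem (i, false) (val x))%:Z - (count_mem (i, true) (val x))%:Z)%R.

Lemma fg_abM : {morph fg_ab : x y / x * y >-> (x + y)%R}.
Proof.
pose e (w : seq (letter n)) i : int :=
  ((count_mem (i, false) w)%:Z - (count_mem (i, true) w)%:Z)%R.
have eC a w i : e (red_cons a w) i = (e [:: a] i + e w i)%R.
  have eE b v : e (b :: v) i = (e [:: b] i + e v i)%R.
    by rewrite /e /= !PoszD !addr0 opprD addrACA.
  case: w => [|b v] /=; first by rewrite {3}/e /= subrr addr0.
  case: eqP => [->|_]; last by rewrite eE.
  rewrite (eE (letter_inv a) v) addrA.
  suff -> : (e [:: a] i + e [:: letter_inv a] i = 0)%R by rewrite add0r.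
  by case: a => j []; rewrite /e /letter_inv /= !xpair_eqE !andbT !andbF
    !addn0 /= ?subr0 ?sub0r ?addNr ?subrr.
move=> x y; apply/rowP=> i; rewrite !mxE /=; rewrite -!/(e _ i).
elim: (val x) => [|a u IH] /=; first by rewrite {2}/e /= subrr add0r.
rewrite eC IH addrA; congr (_ + _)%R.
by rewrite /e /= !PoszD !addr0 opprD addrACA.
Qed.

Lemma fg_ab_gen i : fg_ab (fg_gen i) = delta_mx 0%R i.
Proof.
apply/rowP=> j; rewrite !mxE /= !xpair_eqE andbT andbF /= !addn0 subr0.
by rewrite eq_sym; case: eqP.
Qed.

Lemma fg_ab_universal (A : zmodType) (f : freeGroup n -> A) :
    {morph f : x y / x * y >-> (x + y)%R} ->
  forall x, f x = (\sum_i f (fg_gen i) *~ fg_ab x 0%R i)%R.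
Proof.
move=> fM.
have f1 : f 1 = 0%R by apply: (addrI (f 1)); rewrite -fM mulg1 addr0.
have fV x : f x^-1 = (- f x)%R.
  by apply: (addrI (f x)); rewrite -fM mulgV f1 subrr.
pose g x := (\sum_i f (fg_gen i) *~ fg_ab x 0%R i)%R.
have gM : {morph g : x y / x * y >-> (x + y)%R}.
  move=> x y; rewrite /g -big_split; apply: eq_bigr => i _ /=.
  by rewrite fg_abM mxE mulrzDr.
have g1 : g 1 = 0%R by apply: (addrI (g 1)); rewrite -gM mulg1 addr0.
have gV x : g x^-1 = (- g x)%R.
  by apply: (addrI (g x)); rewrite -gM mulgV g1 subrr.
move=> x; rewrite -/(g x) [x]fg_prod (big_morph f fM f1) (big_morph g gM g1).
have fg i : f (fg_gen i) = g (fg_gen i).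
  rewrite /g (bigD1 i) //= big1 ?addr0 => [|j ji].
    by rewrite fg_ab_gen mxE !eqxx.
  by rewrite fg_ab_gen mxE (negbTE ji) andbF.
by apply: eq_bigr => a _; rewrite fg_letterE; case: a.2; rewrite ?fV ?gV fg.
Qed.

End FreeGroup.

Definition is_aut (G : groupType) (f : G -> G) : Prop :=
  {morph f : x y / x * y} /\ bijective f.

Definition groupAut (G : groupType) : Type := {f : G -> G | `[< is_aut f >]}.
HB.instance Definition _ G := SubChoice.on (groupAut G).

Definition aut_fun (G : groupType) (phi : groupAut G) : G -> G := val phi.
Coercion aut_fun : groupAut >-> Funclass.

Section GroupAut.
Variable G : groupType.
Implicit Types phi psi : groupAut G.

Lemma autM phi : {morph aut_fun phi : x y / x * y}.
Proof. by have /asboolP[] := valP phi. Qed.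

Lemma aut_bij phi : bijective (aut_fun phi).
Proof. by have /asboolP[] := valP phi. Qed.

Lemma aut_eq phi psi : aut_fun phi =1 aut_fun psi -> phi = psi.
Proof. by move=> e; apply: val_inj; apply: funext. Qed.

Definition mk_aut (f : G -> G) (fA : is_aut f) : groupAut G :=
  exist _ f (asboolT fA).

Lemma aut_one_subproof : is_aut (fun x : G => x).
Proof. by split=> //; exists id. Qed.
Definition aut_one : groupAut G := mk_aut aut_one_subproof.

Lemma aut_mul_subproof phi psi : is_aut (fun x => phi (psi x)).
Proof.
split=> [x y|]; first by rewrite !autM.
by apply: bij_comp; exact: aut_bij.
Qed.
Definition aut_mul phi psi : groupAut G := mk_aut (aut_mul_subproof phi psi).

Lemma aut_inv_subproof phi :
  exists psi : groupAut G,
    cancel (aut_fun phi) (aut_fun psi) /\ cancel (aut_fun psi) (aut_fun phi).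
Proof.
have [g fK gK] := aut_bij phi.
have gP : is_aut g.
  split=> [x y|]; last by exists (aut_fun phi).
  by apply: (can_inj fK); rewrite autM !gK.
by exists (mk_aut gP).
Qed.
Definition aut_inv phi : groupAut G := sval (cid (aut_inv_subproof phi)).

Lemma aut_mulA : associative aut_mul.
Proof. by move=> f g h; apply: aut_eq. Qed.
Lemma aut_mul1 : left_id aut_one aut_mul.
Proof. by move=> f; apply: aut_eq. Qed.
Lemma aut_mulr1 : right_id aut_one aut_mul.
Proof. by move=> f; apply: aut_eq. Qed.
Lemma aut_mulV : left_inverse aut_one aut_inv aut_mul.
Proof.
by move=> f; apply: aut_eq => x; have [fK _] := svalP (cid (aut_inv_subproof f));
  exact: fK.
Qed.
Lemma aut_mulrV : right_inverse aut_one aut_inv aut_mul.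
Proof.
by move=> f; apply: aut_eq => x; have [_ fK] := svalP (cid (aut_inv_subproof f));
  exact: fK.
Qed.

HB.instance Definition _ := isGroup.Build (groupAut G)
  aut_mulA aut_mul1 aut_mulr1 aut_mulV aut_mulrV.

End GroupAut.

Section SAut.
Variable n : nat.
Implicit Types phi psi : groupAut (freeGroup n).

(* The endomorphism of Z^n induced by [phi], acting on row vectors. *)
Definition ab_mx phi : 'M[int]_n := \matrix_(i < n) fg_ab (phi (fg_gen i)).

Lemma ab_mxE phi x : fg_ab (phi x) = (fg_ab x *m ab_mx phi)%R.
Proof.
have fM : {morph (fun x => fg_ab (phi x)) : x y / x * y >-> (x + y)%R}.
  by move=> y z /=; rewrite autM fg_abM.
rewrite (fg_ab_universal fM) mulmx_sum_row; apply: eq_bigr => i _.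
by rewrite rowK -scaler_int intz.
Qed.

Lemma ab_mx1 : ab_mx 1 = 1%:M%R.
Proof. by apply/row_matrixP=> i; rewrite rowK row1 -fg_ab_gen. Qed.

Lemma ab_mxM phi psi : ab_mx (phi * psi) = (ab_mx psi *m ab_mx phi)%R.
Proof. by apply/row_matrixP=> i; rewrite row_mul !rowK -ab_mxE. Qed.

Definition in_SAut : {pred groupAut (freeGroup n)} :=
  fun phi => (\det (ab_mx phi) == 1)%R.

Lemma in_SAut_closed : group_closed in_SAut.
Proof.
split=> [|phi psi]; first by rewrite unfold_in /in_SAut ab_mx1 det1.
rewrite !unfold_in /in_SAut => /eqP phi1 /eqP psi1.
rewrite ab_mxM det_mulmx phi1 mulr1; apply/eqP.
have := ab_mxM psi psi^-1; rewrite mulgV ab_mx1 => /(congr1 determinant).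
by rewrite det1 det_mulmx psi1 mulr1.
Qed.

Definition SAut : Type := {phi : groupAut (freeGroup n) | in_SAut phi}.
HB.instance Definition _ := SubChoice.on SAut.
HB.instance Definition _ :=
  SubChoice_isSubGroup.Build (groupAut (freeGroup n)) in_SAut SAut
    in_SAut_closed.

End SAut.

Record leftAction (G : groupType) (X : Type) := LeftAction {
  lact :> G -> X -> X;
  lact1 : forall x, lact 1 x = x;
  lactM : forall g h x, lact (g * h) x = lact g (lact h x)
}.

Local Close Scope group_scope.

Definition p_of (n : nat) : nat := if odd n then 0 else 1.

(* [2 * (r + 3) <= n] is [r <= n / 2 - 3]. The values for [n < 3] are junk. *)
Definition k_of (n : nat) : nat :=
  match n with
  | 3 => 7
  | 4 => 8
  | 5 => 12
  | 6 => 14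
  | _ => \max_(r < n | 2 * (r + 3) <= n) minn (2 ^ (n - r - p_of n)) 'C(n, r)
  end.

(* Main.v *)
Require Import Defs.
From HB Require Import structures.
From mathcomp Require Import all_boot all_order all_algebra all_fingroup all_solvable.
From mathcomp Require Import boolp.
From mathcomp Require Import zify ring lra.

Set Implicit Arguments.
Unset Strict Implicit.
Unset Printing Implicit Defensive.

Import GRing.Theory Num.Theory Order.POrderTheory.
Local Open Scope group_scope.

(** Write [E a b] for the transvection [a |-> a b] between letters with distinct
    indices, and [F U], for an even set [U] of indices, for the automorphism
    inverting the generators in [U]. Nielsen reduction shows that the [E a b]
    generate SAut(F_n), so it suffices to show that they act trivially.

    A set [J] occurs at [x] when the character [U |-> (-1)^|U :&: J|] of the group
    of sign changes appears in the span of the orbit of [x]. Signed permutations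
    transport occurring characters, and eigenfunctions of distinct characters are
    orthogonal, so a small [X] leaves room only for sets [J] such that [J] or its
    complement is small. The small ones have a small common support, and [F [set i; j]]
    fixes [x] whenever [i] and [j] lie in the complement [C x] of that support.

    Choose [x] with [C x] as small as possible. If some [E a b] with indices in
    [C x] moved [x], the involutions induced by the [E _ m] for a suitable [m] would
    again force too many characters; so these transvections fix [x]. If [C x] were
    not everything, the relations between transvections and sign changes would
    contradict its minimality. This settles n >= 5.

    For n = 4 the sign changes modulo [F setT], together with the double
    transpositions, form a group of order 16, too large to act faithfully on fewer
    than 8 points, and any kernel element kills a transvection. For n = 3 it is
    checked by computation that a 3-cycle of the basis and a transvection
    satisfying Gersten's relations in the symmetric group S_6 have the latter
    trivial. *)

(** * Transvections and signed permutations *)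

(** A set and its complement give the same character of the even sign changes, so there are
    [2 ^ n.-1] characters; counting the occurring ones by size gives the binomial bounds, with extra
    care for sets of half size. The powers of 2 have another origin: where the sign changes in a
    class [C] act trivially, inverting a letter of a transvection makes no difference, so the
    [E _ m] behave like elementary matrices over the field with two elements, and if one of them
    acts nontrivially there are at least [2 ^ #|C|.-1] points. The obstacle is that [C x] varies
    with [x]: transvections do not normalise the sign changes, and [E a b] may add or remove the
    indices of [a] and [b]. This is controlled because classes are large: any two share three
    indices, so one index untouched by the transvection serves as a common reference, and minimality
    leaves few possibilities for the new class. For [n >= 7] the counting needs [3 * r + 2 <= n]. A
    larger [r] is replaced by the largest value in that range, because [2 ^ (n - r - p_of n)] is by
    then smaller than the binomial coefficient there. *)

Lemma ord_notin n (U : {set 'I_n}) : #|U| < n -> exists k, k \notin U.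
Proof.
move=> hU; have : 0 < #|~: U| by rewrite cardsCs setCK card_ord subn_gt0.
by case/card_gt0P=> k; rewrite inE; exists k.
Qed.

Section Automorphisms.
Variable n : nat.
Implicit Types (a b c d : letter n) (U V : {set 'I_n}).
Implicit Types phi psi : groupAut (freeGroup n).

Lemma fg_letterV a : fg_letter (letter_inv a) = (fg_letter a)^-1.
Proof. exact: val_inj. Qed.

Definition fg_ext (h : 'I_n -> freeGroup n) : freeGroup n -> freeGroup n :=
  s2val (cid2 (fg_extend h)).

Lemma fg_extM h : {morph fg_ext h : x y / x * y}.
Proof. exact: (s2valP (cid2 (fg_extend h))). Qed.

Lemma fg_ext_gen h i : fg_ext h (fg_gen i) = h i.
Proof. exact: (s2valP' (cid2 (fg_extend h))). Qed.

Lemma endo1 (f : freeGroup n -> freeGroup n) : {morph f : x y / x * y} -> f 1 = 1.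
Proof. by move=> fM; apply: (mulgI (f 1)); rewrite -fM !mulg1. Qed.

Lemma endoV (f : freeGroup n -> freeGroup n) x :
  {morph f : x y / x * y} -> f x^-1 = (f x)^-1.
Proof. by move=> fM; apply: (mulgI (f x)); rewrite -fM !mulgV endo1. Qed.

Lemma endo_eq (f g : freeGroup n -> freeGroup n) :
    {morph f : x y / x * y} -> {morph g : x y / x * y} ->
    (forall i, exists s, f (fg_letter (i, s)) = g (fg_letter (i, s))) ->
  f =1 g.
Proof.
move=> fM gM fg; apply: fg_unique => // i; have [[] /=] := fg i.
  by rewrite fg_letterE /= !endoV // => /invg_inj.
by rewrite fg_letterE.
Qed.

Lemma aut_gen_eq phi psi :
  (forall i, exists s, phi (fg_letter (i, s)) = psi (fg_letter (i, s))) ->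
  phi = psi.
Proof. by move=> e; apply: aut_eq; apply: endo_eq e; exact: autM. Qed.

Lemma aut_letter_eq phi psi :
  (forall a, phi (fg_letter a) = psi (fg_letter a)) -> phi = psi.
Proof. by move=> e; apply: aut_gen_eq => i; exists false; exact: e. Qed.

(** The value is the identity when [f] is not an automorphism; [aut_ofE] recovers [f] from an
    inverse that need only be checked on letters. *)
Definition aut_of (f : freeGroup n -> freeGroup n) : groupAut (freeGroup n) :=
  insubd (1 : groupAut (freeGroup n)) f.

Lemma aut_ofE (f g : freeGroup n -> freeGroup n) :
    {morph f : x y / x * y} -> {morph g : x y / x * y} ->
    (forall a, f (g (fg_letter a)) = fg_letter a) ->
    (forall a, g (f (fg_letter a)) = fg_letter a) ->
  aut_fun (aut_of f) = f.
Proof.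
move=> fM gM fg gf; apply: insubdK; apply/asboolP; split=> //.
exists g => x; rewrite -[RHS]/(id x).
  apply: (@endo_eq (g \o f) id) => // [y z /=|i]; first by rewrite fM gM.
  by exists false; exact: gf.
apply: (@endo_eq (f \o g) id) => // [y z /=|i]; first by rewrite gM fM.
by exists false; exact: fg.
Qed.

Lemma letter_inv_neq a : (letter_inv a == a) = false.
Proof. by case: a => i []; rewrite /letter_inv /= xpair_eqE andbF. Qed.

Lemma eq_letter1 a b : a.1 == b.1 = (a == b) || (a == letter_inv b).
Proof.
by case: a b => i s [j t]; rewrite /letter_inv !xpair_eqE -andb_orr; case: s t => [] [];
  rewrite andbT.
Qed.

(* Gersten's generator: [a] maps to [a b], all letters other than [a],
   [letter_inv a] being fixed.  Thus [tv] covers both the right and the left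
   transvections. *)
Definition tv_endo a b : freeGroup n -> freeGroup n :=
  fg_ext (fun i => if i == a.1 then
     if a.2 then (fg_letter b)^-1 * fg_gen i else fg_gen i * fg_letter b
   else fg_gen i).

Lemma tv_endoM a b : {morph tv_endo a b : x y / x * y}.
Proof. exact: fg_extM. Qed.

Lemma tv_endoV a b : {morph tv_endo a b : x / x^-1}.
Proof. by move=> x; apply: endoV; exact: tv_endoM. Qed.

Definition tv a b := aut_of (tv_endo a b).

Lemma tv_endo_letter a b c : tv_endo a b (fg_letter c) =
  if c == a then fg_letter c * fg_letter b
  else if c == letter_inv a then (fg_letter b)^-1 * fg_letter c
  else fg_letter c.
Proof.
rewrite /tv_endo !(fg_letterE c) (fun_if (fg_ext _)) (endoV _ (@fg_extM _)).
rewrite fg_ext_gen; case: a c => i s [j t]; rewrite /letter_inv /= !xpair_eqE.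
case: eqP => [->|_] /=; last by case: t.
by case: s t => [] [] //=; rewrite ?invMg ?invgK.
Qed.

Lemma tv_letter a b c : a.1 != b.1 -> tv a b (fg_letter c) =
  if c == a then fg_letter c * fg_letter b
  else if c == letter_inv a then (fg_letter b)^-1 * fg_letter c
  else fg_letter c.
Proof.
move=> ab.
have K a' b' e : a'.1 != b'.1 ->
    tv_endo a' (letter_inv b') (tv_endo a' b' (fg_letter e)) = fg_letter e.
  rewrite eq_sym eq_letter1 negb_or => /andP[/negPf nba /negPf nbai].
  rewrite tv_endo_letter; case: eqP => [->|/eqP nea].
    by rewrite tv_endoM !tv_endo_letter eqxx nba nbai fg_letterV mulgVK.
  case: eqP => [->|/eqP nei].
    rewrite tv_endoM tv_endoV !tv_endo_letter nba nbai letter_inv_neq eqxx.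
    by rewrite [fg_letter (letter_inv b')]fg_letterV invgK mulKg.
  by rewrite tv_endo_letter (negPf nea) (negPf nei).
rewrite /tv (@aut_ofE _ (tv_endo a (letter_inv b))).
- exact: tv_endo_letter.
- exact: fg_extM.
- exact: fg_extM.
- by move=> e; have := K a (letter_inv b) e ab; rewrite letter_invK.
- by move=> e; rewrite K.
Qed.

Lemma tv_id a b c : a.1 != b.1 -> c.1 != a.1 -> tv a b (fg_letter c) = fg_letter c.
Proof.
move=> ab; rewrite tv_letter // eq_letter1 negb_or => /andP[/negPf -> /negPf ->].
by [].
Qed.

Lemma tv_src a b : a.1 != b.1 -> tv a b (fg_letter a) = fg_letter a * fg_letter b.
Proof. by move=> ab; rewrite tv_letter // eqxx. Qed.

Lemma tv_srcV a b : a.1 != b.1 ->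
  tv (letter_inv a) b (fg_letter a) = (fg_letter b)^-1 * fg_letter a.
Proof. by move=> ab; rewrite tv_letter // eq_sym letter_inv_neq letter_invK eqxx. Qed.

Lemma autV phi : {morph aut_fun phi : x / x^-1}.
Proof. by move=> x; apply: endoV; exact: autM. Qed.

Lemma aut_mulE phi psi x : aut_fun (phi * psi) x = phi (psi x).
Proof. by []. Qed.

Lemma aut_oneE (x : freeGroup n) : aut_fun (1 : groupAut (freeGroup n)) x = x.
Proof. by []. Qed.

(** An automorphism is determined by one letter of each index, with a sign chosen at will. So a
    relation between transvections needs one check per index involved and a uniform one
    elsewhere. *)
Lemma aut_eq_at (ls : seq (letter n)) phi psi :
    (forall a, a \in ls -> phi (fg_letter a) = psi (fg_letter a)) ->
    (forall a, all (fun b => a.1 != b.1) ls ->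
       phi (fg_letter a) = psi (fg_letter a)) ->
  phi = psi.
Proof.
move=> H1 H2; apply: aut_gen_eq => i.
have [/hasP[[j s] jl /eqP /= ij]|/hasPn ls_i] := boolP (has (fun b => i == b.1) ls).
  by exists s; apply: H1; rewrite ij.
by exists false; apply: H2; apply/allP.
Qed.

Let autE := (aut_mulE, aut_oneE, fg_letterV, autM, autV).

Lemma tvK a b : a.1 != b.1 -> tv a (letter_inv b) * tv a b = 1.
Proof.
move=> ab; have ba := ab; rewrite eq_sym in ba.
apply: (@aut_eq_at [:: a]) => [c|c /= /andP[ca _]].
  rewrite inE => /eqP ->; rewrite !autE tv_src // autM tv_src // tv_id //.
  by rewrite fg_letterV mulgVK.
by rewrite !autE !tv_id.
Qed.

Lemma tvV a b : a.1 != b.1 -> (tv a b)^-1 = tv a (letter_inv b).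
Proof. by move=> ab; rewrite -[RHS](mulgK (tv a b)) tvK // mul1g. Qed.

(** The letters [a] and [c] may be mutually inverse: one transvection then multiplies on the right
    and the other on the left. *)
Lemma tv_comm a b c d : a.1 != b.1 -> c.1 != d.1 -> a.1 != d.1 -> c.1 != b.1 ->
  a != c -> tv a b * tv c d = tv c d * tv a b.
Proof.
move=> ab cd ad cb ac.
have [ba [dc [da bc]]] : b.1 != a.1 /\ d.1 != c.1 /\ d.1 != a.1 /\ b.1 != c.1.
  by rewrite ![_.1 == a.1]eq_sym ![_.1 == c.1]eq_sym.
have [ac1|ac1] := eqVneq a.1 c.1.
  have {ac ac1} : a == letter_inv c by move/eqP: ac1; rewrite eq_letter1 (negPf ac).
  move=> /eqP ac; subst a; apply: (@aut_eq_at [:: c]) => [e|e /= /andP[ec _]].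
    rewrite inE => /eqP ->; rewrite !autE tv_src // tv_srcV // !autE.
    by rewrite tv_srcV // tv_src // !tv_id // mulgA.
  by rewrite !autE !tv_id.
have ca1 := ac1; rewrite eq_sym in ca1.
apply: (@aut_eq_at [:: a; c]) => [e|e /= /and3P[ea ec _]]; last first.
  by rewrite !autE !tv_id.
rewrite !inE => /orP[] /eqP ->.
  by rewrite !autE (tv_id cd ac1) !(tv_src ab) !autE (tv_id cd ac1) (tv_id cd bc).
by rewrite !autE (tv_id ab ca1) !(tv_src cd) !autE (tv_id ab ca1) (tv_id ab da).
Qed.

(** Gersten's commutator relation [[E_ab^-1, E_bc] = E_ac], cleared of inverses. *)
Lemma tv_rel a b c : a.1 != b.1 -> a.1 != c.1 -> b.1 != c.1 ->
  tv b c * tv a b = tv a b * tv a c * tv b c.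
Proof.
move=> ab ac bc; have [ba [ca cb]] : b.1 != a.1 /\ c.1 != a.1 /\ c.1 != b.1.
  by split; [|split]; rewrite eq_sym.
apply: (@aut_eq_at [:: a; b]) => [e|e /= /and3P[ea eb _]]; last first.
  by rewrite !autE !tv_id.
rewrite !inE => /orP[] /eqP ->.
  rewrite !autE (tv_id bc ab) !(tv_src ab) (tv_src ac) !autE (tv_src bc).
  by rewrite (tv_src ab) (tv_id bc ab) (tv_id ab ca) mulgA.
by rewrite !autE (tv_id ab ba) (tv_src bc) !autE !tv_id.
Qed.

Lemma tv_relV a b c : a.1 != b.1 -> a.1 != c.1 -> b.1 != c.1 ->
  tv (letter_inv b) c * tv a b =
  tv a (letter_inv c) * tv a b * tv (letter_inv b) c.
Proof.
move=> ab ac bc; have [ba [ca cb]] : b.1 != a.1 /\ c.1 != a.1 /\ c.1 != b.1.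
  by split; [|split]; rewrite eq_sym.
apply: (@aut_eq_at [:: a; b]) => [e|e /= /and3P[ea eb _]]; last first.
  by rewrite !autE !tv_id.
rewrite !inE => /orP[] /eqP ->.
  have bc' : (letter_inv b).1 != c.1 by [].
  rewrite !autE (tv_id bc' ab) !(tv_src ab) !autE (tv_srcV bc) (tv_id bc' ab).
  have ac' : a.1 != (letter_inv c).1 by [].
  by rewrite (tv_src ac') (tv_id ac' ba) fg_letterV mulgA.
by rewrite !autE (tv_id ab ba) (tv_srcV bc) !autE !tv_id.
Qed.

Definition letter_aut phi (f : letter n -> letter n) :=
  forall a, phi (fg_letter a) = fg_letter (f a).

Lemma fg_letter_inj : injective (@fg_letter n).
Proof. by move=> a b [->]. Qed.

Lemma letter_autV phi f : letter_aut phi f ->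
  {morph f : a / letter_inv a >-> letter_inv a}.
Proof.
by move=> H a; apply: fg_letter_inj; rewrite -H !fg_letterV -H autV.
Qed.

Lemma letter_aut_inj phi f : letter_aut phi f -> injective f.
Proof.
move=> H a b fab; apply: fg_letter_inj; apply: (bij_inj (aut_bij phi)).
by rewrite !H fab.
Qed.

Lemma letter_aut_eq1 phi f : letter_aut phi f ->
  forall a b, ((f a).1 == (f b).1) = (a.1 == b.1).
Proof.
move=> H a b; have fI := letter_aut_inj H.
by rewrite !eq_letter1 -(letter_autV H) !(inj_eq fI).
Qed.

Lemma letter_aut_conj phi f a b : letter_aut phi f -> a.1 != b.1 ->
  phi * tv a b = tv (f a) (f b) * phi.
Proof.
move=> H ab; apply: aut_letter_eq => c; rewrite !autE tv_letter // H.
rewrite tv_letter ?(letter_aut_eq1 H) // -(letter_autV H).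
rewrite !(inj_eq (letter_aut_inj H)).
by case: eqP => _; [|case: eqP => _]; rewrite ?autE ?H.
Qed.

Lemma letter_aut_comp phi psi f g : letter_aut phi f -> letter_aut psi g ->
  letter_aut (phi * psi) (f \o g).
Proof. by move=> Hf Hg a; rewrite autE Hg Hf. Qed.

Definition flip_letter U a : letter n := (a.1, a.2 (+) (a.1 \in U)).

Definition flip U := aut_of (fg_ext (fun i => fg_letter (i, i \in U))).

Lemma flip_letterE U : letter_aut (flip U) (flip_letter U).
Proof.
have E a : fg_ext (fun i => fg_letter (i, i \in U)) (fg_letter a)
           = fg_letter (flip_letter U a).
  rewrite fg_letterE (fun_if (fg_ext _)) (endoV _ (@fg_extM _)) fg_ext_gen.
  case: a => i [] /=; rewrite /flip_letter //=.
  by rewrite -fg_letterV.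
have K a : flip_letter U (flip_letter U a) = a.
  by case: a => i s; rewrite /flip_letter /= -addbA addbb addbF.
move=> a; rewrite /flip (@aut_ofE _ (fg_ext (fun i => fg_letter (i, i \in U)))) //;
  try exact: fg_extM.
  by move=> b; rewrite !E K.
by move=> b; rewrite !E K.
Qed.

Definition wl (u v a : letter n) : letter n :=
  if a == u then v else if a == letter_inv u then letter_inv v
  else if a == v then letter_inv u else if a == letter_inv v then u else a.

(** The quarter turn [u -> v -> u^-1], the lift of the factorisation of a rotation in [SL_2] into
    three elementary matrices. It replaces the transposition, which has determinant [-1]. *)
Definition wx (u v : letter n) : groupAut (freeGroup n) :=
  tv v (letter_inv u) * tv (letter_inv u) (letter_inv v) * tv (letter_inv v) u.

Lemma wxE u v : u.1 != v.1 -> letter_aut (wx u v) (wl u v).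
Proof.
move=> uv; have vu := uv; rewrite eq_sym in vu.
have Hu : wx u v (fg_letter u) = fg_letter v.
  rewrite /wx !autE (@tv_id (letter_inv v)) // tv_srcV // !autE invgK.
  rewrite tv_src // tv_id // fg_letterV.
  by rewrite -mulgA mulVg mulg1.
have Hv : wx u v (fg_letter v) = (fg_letter u)^-1.
  rewrite /wx !autE tv_srcV // !autE tv_srcV // (@tv_id (letter_inv u)) //.
  by rewrite fg_letterV invgK autM invMg mulgVK tv_id.
move=> a; rewrite /wl; case: eqP => [->|/eqP nu] //.
case: eqP => [->|/eqP nui]; first by rewrite fg_letterV autV Hu fg_letterV.
case: eqP => [->|/eqP nv]; first by rewrite fg_letterV Hv.
case: eqP => [->|/eqP nvi]; first by rewrite fg_letterV autV Hv invgK.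
have au : a.1 != u.1 by rewrite eq_letter1 negb_or nu.
have av : a.1 != v.1 by rewrite eq_letter1 negb_or nv.
by rewrite /wx !autE !tv_id.
Qed.

Lemma wl1 u v a : u.1 != v.1 -> (wl u v a).1 = tperm u.1 v.1 a.1.
Proof.
move=> uv; rewrite /wl; case: eqP => [->|/eqP nu]; first by rewrite tpermL.
case: eqP => [->|/eqP nui]; first by rewrite tpermL.
case: eqP => [->|/eqP nv]; first by rewrite tpermR.
case: eqP => [->|/eqP nvi]; first by rewrite tpermR.
rewrite tpermD //; rewrite eq_sym eq_letter1 negb_or.
  by rewrite nu.
by rewrite nv.
Qed.

Lemma wx2 u v : u.1 != v.1 -> wx u v * wx u v = flip [set u.1; v.1].
Proof.
move=> uv; have H := wxE uv; apply: aut_letter_eq => a.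
rewrite (letter_aut_comp H H) flip_letterE; congr fg_letter => /=.
have vu := uv; rewrite eq_sym in vu.
have [N1 N2] : (v == u) = false /\ (v == letter_inv u) = false.
  by move: vu; rewrite eq_letter1 negb_or => /andP[/negPf -> /negPf ->].
have wu : wl u v u = v by rewrite /wl eqxx.
have wv : wl u v v = letter_inv u by rewrite /wl N1 N2 eqxx.
have wV := letter_autV H; have fV := letter_autV (flip_letterE [set u.1; v.1]).
have fu : flip_letter [set u.1; v.1] u = letter_inv u.
  by rewrite /flip_letter !inE eqxx addbT.
have fv : flip_letter [set u.1; v.1] v = letter_inv v.
  by rewrite /flip_letter !inE eqxx orbT addbT.
have [/eqP|au] := eqVneq a.1 u.1.
  rewrite eq_letter1 => /orP[] /eqP ->; first by rewrite wu wv fu.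
  by rewrite !wV fV wu wv fu.
have [/eqP|av] := eqVneq a.1 v.1.
  rewrite eq_letter1 => /orP[] /eqP ->; first by rewrite wv wV wu fv.
  by rewrite !wV fV wv wV wu fv.
have -> : flip_letter [set u.1; v.1] a = a.
  by case: a au av => i s /= au av; rewrite /flip_letter !inE (negPf au) (negPf av) addbF.
suff E : wl u v a = a by rewrite !E.
move: au av; rewrite /wl !eq_letter1 !negb_or.
by move=> /andP[/negPf -> /negPf ->] /andP[/negPf -> /negPf ->].
Qed.

Lemma flipM U V : flip U * flip V = flip ((U :\: V) :|: (V :\: U)).
Proof.
apply: aut_letter_eq => a.
rewrite (letter_aut_comp (flip_letterE U) (flip_letterE V)) flip_letterE.
congr fg_letter; rewrite /= /flip_letter !inE -addbA; congr (_, _ (+) _).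
by case: (a.1 \in U); case: (a.1 \in V).
Qed.

Lemma flip0 : flip set0 = 1.
Proof.
apply: aut_letter_eq => a; rewrite flip_letterE; congr fg_letter.
by case: a => i s; rewrite /flip_letter inE addbF.
Qed.

Lemma flip_tv U a b : a.1 != b.1 ->
  flip U * tv a b = tv (flip_letter U a) (flip_letter U b) * flip U.
Proof. exact: (letter_aut_conj (flip_letterE U)). Qed.

Lemma wx_flip u v U : u.1 != v.1 ->
  wx u v * flip U = flip (tperm u.1 v.1 @: U) * wx u v.
Proof.
move=> uv; have H := wxE uv; apply: aut_letter_eq => a.
rewrite (letter_aut_comp H (flip_letterE U)) (letter_aut_comp (flip_letterE _) H).
congr fg_letter => /=; rewrite {2}/flip_letter wl1 // mem_imset; last exact: perm_inj.
have -> : flip_letter U a = if a.1 \in U then letter_inv a else a.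
  by case: a => i s; rewrite /flip_letter /letter_inv /=; case: (i \in U); rewrite ?addbT ?addbF.
case: (a.1 \in U); rewrite -?wl1 // ?addbF; last by case: (wl u v a).
by rewrite (letter_autV H) /letter_inv addbT wl1.
Qed.

Definition D phi : int := \det (ab_mx phi).

Lemma detM phi psi : D (phi * psi) = (D phi * D psi)%R.
Proof. by rewrite /D ab_mxM det_mulmx mulrC. Qed.

Lemma det_neq0 phi : D phi != 0%R.
Proof.
apply/eqP => D0; have := detM phi phi^-1; rewrite D0 mul0r mulgV /D ab_mx1 det1.
by [].
Qed.

(** A third index [k] makes the transvection a commutator, and determinants commute. *)
Lemma det_tv a b : 2 < n -> a.1 != b.1 -> D (tv a b) = 1%R.
Proof.
move=> hn ab; have [k ka kb] : exists2 k : 'I_n, a.1 != k & k != b.1.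
  have [|k] := @ord_notin _ [set a.1; b.1]; first by rewrite cards2 ab.
  by rewrite !inE negb_or => /andP[ka kb]; exists k; rewrite // eq_sym.
have := congr1 D (@tv_rel a (k, false) b ka ab kb); rewrite !detM.
rewrite [LHS]mulrC -mulrA => /(mulfI (det_neq0 _)).
by rewrite -{1}[D (tv (k, false) b)]mul1r => /(mulIf (det_neq0 _)).
Qed.

Lemma det_flip U : D (flip U) = ((-1) ^+ #|U|)%R.
Proof.
have -> : D (flip U) = (\det (diag_mx (\row_i (-1) ^+ (i \in U)) : 'M[int]_n))%R.
  congr (\det _)%R; apply/row_matrixP => i; rewrite rowK row_diag_mx mxE.
  have := flip_letterE U (i, false); rewrite fg_letterE /= => ->.
  rewrite fg_letterE /flip_letter /=; case: (i \in U); last by rewrite fg_ab_gen scale1r.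
  apply: (addrI (fg_ab (fg_gen i))).
  by rewrite -fg_abM mulgV fg_ab_gen scaleN1r subrr; apply/rowP => j; rewrite !mxE.
rewrite det_diag (eq_bigr (fun i => if i \in U then -1 else 1)%R); last first.
  by move=> i _; rewrite mxE; case: (i \in U).
by rewrite -big_mkcond /= prodr_const.
Qed.

End Automorphisms.

(** * Nielsen reduction *)

Section CommonPrefix.
Variable T : eqType.
Implicit Types s t u : seq T.

Fixpoint lcp s t : nat :=
  match s, t with
  | a :: s', b :: t' => if a == b then (lcp s' t').+1 else 0
  | _, _ => 0
  end.

Lemma leq_lcp k s t :
  (k <= lcp s t) = [&& k <= size s, k <= size t & take k s == take k t].
Proof.
elim: s t k => [|a s IH] [|b t] [|k] //=; first by rewrite andbF.
rewrite eqseq_cons; case: (a == b) => /=; last by rewrite !andbF.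
by rewrite !ltnS IH.
Qed.

Lemma lcpC s t : lcp s t = lcp t s.
Proof.
by elim: s t => [|a s IH] [|b t] //=; rewrite eq_sym IH.
Qed.

Lemma lcp_sizel s t : lcp s t <= size s.
Proof. by have := leqnn (lcp s t); rewrite leq_lcp => /and3P[]. Qed.

Lemma lcp_take s t : take (lcp s t) s = take (lcp s t) t.
Proof. by have := leqnn (lcp s t); rewrite leq_lcp => /and3P[_ _ /eqP]. Qed.

(** Prefix lengths are ultrametric: the least of the three pairwise values is attained twice. *)
Lemma lcp_ultra s t u : lcp s t < lcp t u -> lcp s u = lcp s t.
Proof.
move=> lt; have E k : k <= lcp t u -> (k <= lcp s u) = (k <= lcp s t).
  rewrite !leq_lcp => /and3P[-> -> /eqP ->].
  by [].
apply/eqP; rewrite eqn_leq; apply/andP; split; last by rewrite E // ltnW.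
rewrite leqNgt; apply/negP => lt'.
by have := E _ lt; rewrite lt' ltnn.
Qed.

End CommonPrefix.

Section Nielsen.
Variable n : nat.
Implicit Types (a b c v : letter n) (u w : seq (letter n)) (x y : freeGroup n).
Implicit Types phi psi : groupAut (freeGroup n).

Lemma red_cat_id u w : reduced (u ++ w) -> red_cat u w = u ++ w.
Proof.
elim: u => //= a u IH ru; rewrite IH; last exact: path_sorted ru.
exact: red_cons_id.
Qed.

Lemma size_red_cons a w : size (red_cons a w) <= (size w).+1.
Proof. by case: w => //= b w; case: ifP => _ //=; lia. Qed.

Lemma red_cat_size u w :
  size u + size w <= size (red_cat u w) -> red_cat u w = u ++ w.
Proof.
elim: u => //= a u IH; rewrite addSn => h.
have E : red_cat u w = u ++ w.
  by apply: IH; rewrite -ltnS; apply: leq_trans h (size_red_cons _ _).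
rewrite E in h *; case: (u ++ w) (size_cat u w) h => //= b t.
by case: ifP => //= _ <-; lia.
Qed.

Lemma word_inv_cat u w : word_inv (u ++ w) = word_inv w ++ word_inv u.
Proof. by rewrite /word_inv map_cat rev_cat. Qed.

Lemma size_word_inv u : size (word_inv u) = size u.
Proof. by rewrite /word_inv size_rev size_map. Qed.

Definition len x := size (val x).

Lemma lenV x : len x^-1 = len x.
Proof. exact: size_word_inv. Qed.

(** Cancellation in [u^-1 w] removes the common prefix of [u] and [w], once from each factor, and
    nothing more. *)
Lemma size_red_catV u w : reduced u -> reduced w ->
  size (red_cat (word_inv u) w) + (lcp u w).*2 = size u + size w.
Proof.
elim: u w => [|a u IH] [|b w] // ru rw.
- by rewrite addn0.
- by rewrite red_cat0 ?word_inv_reduced // size_word_inv.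
have -> : word_inv (a :: u) = rcons (word_inv u) (letter_inv a).
  by rewrite /word_inv /= rev_cons.
rewrite /= ; case: (eqVneq a b) => [<-|ab].
  rewrite /red_cat foldr_rcons /= letter_invK eqxx.
  by have := IH w (path_sorted ru) (path_sorted rw); rewrite /red_cat /=; lia.
rewrite red_cat_id ?size_cat ?size_rcons ?size_word_inv ?addn0 //.
rewrite /reduced cat_rcons sorted_cat_cons /= letter_invK eq_sym ab.
apply/andP; split=> //; have := word_inv_reduced ru.
by rewrite /word_inv /= rev_cons.
Qed.

(** The Gromov product of [x] and [y], based at the identity, in the Cayley tree of the free
    group. *)
Definition glcp x y := lcp (val x) (val y).

Lemma glcpC x y : glcp x y = glcp y x.
Proof. exact: lcpC. Qed.

Lemma glcp_ultra x y z : glcp x y < glcp y z -> glcp x z = glcp x y.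
Proof. exact: lcp_ultra. Qed.

Lemma len_mulV x y : len (x^-1 * y) + (glcp x y).*2 = len x + len y.
Proof. exact: size_red_catV (valP x) (valP y). Qed.

(** Otherwise letters of [x] in mirror positions would be inverse to each other up to the middle: in
    odd length the middle letter would be its own inverse, in even length the two middle letters
    would cancel. *)
Lemma lcp_inv x : x != 1 -> (glcp x x^-1).*2 < len x.
Proof.
move=> x1; have rx := valP x; rewrite ltnNge /len /glcp; apply/negP => le.
have s0 : 0 < size (val x).
  by rewrite lt0n size_eq0; apply: contra x1 => /eqP h; apply/eqP; exact: val_inj.
have [a _] : exists a : letter n, true by case: (val x) s0 => // a; exists a.
pose k := lcp (val x) (val x^-1); pose h := (size (val x))./2.
have E i : i < k -> nth a (val x) i = letter_inv (nth a (val x) (size (val x) - i.+1)).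
  move=> ik; have := lcp_sizel (val x) (val x^-1); rewrite -/k => ks.
  have := congr1 (fun s => nth a s i) (lcp_take (val x) (val x^-1)).
  have isz : i < size (val x) by apply: leq_trans ik ks.
  rewrite -/k !nth_take // => ->; rewrite /= /word_inv nth_rev size_map //.
  by rewrite (nth_map a) // ltn_subrL.
rewrite -/k in le; clearbody k.
have := odd_double_half (size (val x)); rewrite -/h; clearbody h.
case: (odd _) => sz.
  have /E : h < k by lia.
  rewrite (_ : size (val x) - h.+1 = h); last by lia.
  by move/esym/eqP; rewrite letter_inv_neq.
move: rx => /(sortedP a) /(_ h.-1).
have -> : h.-1.+1 = h by lia.
have {E}-> : nth a (val x) h.-1 = letter_inv (nth a (val x) h).
  rewrite E; last by lia.
  by congr (letter_inv (nth _ _ _)); lia.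
rewrite letter_invK eqxx => H.
have : h < size (val x) by lia.
by move/H.
Qed.

Lemma lcp_mulV x y : len (x^-1 * y) = len x + len y - (glcp x y).*2.
Proof. by rewrite -len_mulV addnK. Qed.

(* The Gromov product identity on the geodesic triangle [1], [x], [x y]. *)
Lemma lcp_mul x y : glcp x (x * y) + glcp x^-1 y = len x.
Proof.
have := len_mulV x (x * y); have := len_mulV x^-1 y.
have -> : len (x^-1^-1 * y) = len (x * y) by rewrite invgK.
by rewrite mulKg lenV; lia.
Qed.

Section Reduced.
Variable phi : groupAut (freeGroup n).
Let X a := phi (fg_letter a).
Let C a b := glcp (X a) (X b).

Hypothesis N1 : forall a b, a.1 != b.1 -> (C a b).*2 <= len (X b).
Hypothesis N2 : forall a b c, a != b -> c != letter_inv b ->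
  ~~ (((C a b).*2 == len (X b)) && ((C (letter_inv b) c).*2 == len (X b))).

Lemma nielsen_X1 a : X a != 1.
Proof.
apply/eqP => Xa; have : fg_letter a = 1.
  by apply: (bij_inj (aut_bij phi)); rewrite -/(X a) Xa (endo1 (@autM _ phi)).
by move/(congr1 val).
Qed.

Lemma nielsen_XV a : X (letter_inv a) = (X a)^-1.
Proof. by rewrite /X fg_letterV autV. Qed.

Lemma nielsen_half a b : a != b -> (C a b).*2 <= len (X b).
Proof.
move=> ab; have [/eqP|/N1 //] := eqVneq a.1 b.1.
rewrite eq_letter1 (negPf ab) => /eqP ->.
by rewrite /C glcpC nielsen_XV ltnW // lcp_inv // nielsen_X1.
Qed.

Lemma nielsen_gap a b c : a != b -> c != letter_inv b ->
  C a b + C (letter_inv b) c < len (X b).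
Proof.
move=> ab cb; have := N2 ab cb; have := nielsen_half ab.
have bc : letter_inv b != c by rewrite eq_sym.
have : (C (letter_inv b) c).*2 <= len (X b).
  rewrite /C glcpC -/(C _ _); have := nielsen_half cb.
  by rewrite nielsen_XV lenV.
move=> h2 h1; rewrite negb_and => /orP[] /eqP; lia.
Qed.

Lemma len_reduced v w (r : reduced (v :: w)) :
  let y := phi (exist _ (v :: w) r) in
  (forall c, c != v -> glcp (X c) y = C c v) /\
  (forall c, c != v -> C c v + size (v :: w) <= len y).
Proof.
elim: w v r => [|v' w IH] v r y.
  have -> : y = X v by rewrite /y /X; congr (aut_fun phi _); apply: val_inj.
  split=> // c cv; have := nielsen_half cv; have := nielsen_X1 v.
  rewrite -(inj_eq val_inj) -size_eq0 /len /=.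
  by case: (size _) => //= k _; lia.
have r' : reduced (v' :: w) := path_sorted r.
have vv' : v' != letter_inv v by have /andP[] := r.
have vv'' : letter_inv v != v' by rewrite eq_sym.
have [IH1 IH2] := IH _ r'.
have Ey : y = X v * phi (exist _ (v' :: w) r').
  rewrite /X -autM /y; congr (aut_fun phi _); apply: val_inj => /=.
  by rewrite (negPf vv').
have G := lcp_mul (X v) (phi (exist _ (v' :: w) r')).
rewrite -Ey -nielsen_XV IH1 // in G.
split=> c cv; have gap := nielsen_gap cv vv'.
  by apply: glcp_ultra; rewrite -/(C c v); lia.
have := lcp_mulV (X v)^-1 (phi (exist _ (v' :: w) r')).
have -> : len ((X v)^-1^-1 * phi (exist _ (v' :: w) r')) = len y.
  by rewrite invgK -Ey.
rewrite lenV -nielsen_XV IH1 // => ->.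
have := IH2 _ vv''; rewrite /=; lia.
Qed.

(** A preimage of the letter [a] is no longer than its image by [len_reduced], hence is itself a
    letter. *)
Lemma nielsen_reduced_letter a : exists b, X b = fg_letter a.
Proof.
have [psi [K1 K2]] := aut_inv_subproof phi.
have E := K2 (fg_letter a); case: (psi (fg_letter a)) E => [[|v w] r] E.
  have : (1 : freeGroup n) = fg_letter a.
    by rewrite -E -[LHS](endo1 (@autM _ phi)); congr (aut_fun phi _); apply: val_inj.
  by move/(congr1 val).
have [_ H] := len_reduced r; have := H (letter_inv v).
rewrite letter_inv_neq E => /(_ isT).
case: w r E H => [|v' w] r E H; last by rewrite /len /=; lia.
by exists v; rewrite -E /X; congr (aut_fun phi _); apply: val_inj.
Qed.

End Reduced.

(** A word read as a numeral in base [#|{: letter n}|]. On words of equal length this is the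
    lexicographic order, made into a termination measure. *)
Fixpoint code u : nat :=
  if u is a :: v then muln (enum_rank a) (expn #|{: letter n}| (size v)) + code v else 0.

Lemma code_lt u : code u < expn #|{: letter n}| (size u).
Proof.
elim: u => //= a u IH; have := ltn_ord (enum_rank a); rewrite expnS.
move: (expn _ _) IH => K IH ra; apply: leq_trans (_ : (enum_rank a).+1 * K <= _).
  by rewrite mulSn addnC ltn_add2r.
by rewrite leq_mul2r ra orbT.
Qed.

Lemma code_inj u w : size u = size w -> code u = code w -> u = w.
Proof.
elim: u w => [|a u IH] [|b w] //= [sz]; rewrite sz => E.
have := code_lt u; have := code_lt w; rewrite sz => lw lu.
have K0 : 0 < expn #|{: letter n}| (size w) by apply: leq_trans lw.
have ab : enum_rank a = enum_rank b :> nat.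
  have := congr1 (divn^~ (expn #|{: letter n}| (size w))) E.
  by rewrite /= !divnMDl // (divn_small lu) (divn_small lw) !addn0.
have -> : a = b by apply: enum_rank_inj; apply: val_inj.
congr (_ :: _); apply: IH => //; move: E; rewrite ab; exact: addnI.
Qed.

Lemma code_cat u w : code (u ++ w) = code u * expn #|{: letter n}| (size w) + code w.
Proof.
by elim: u => //= a u ->; rewrite size_cat expnD mulnA mulnDl addnA.
Qed.

Lemma code_cat_lt p q w : code p < code q -> code (p ++ w) < code (q ++ w).
Proof.
move=> pq; rewrite !code_cat ltn_add2r ltn_pmul2r //.
by apply: leq_trans (code_lt w).
Qed.

(** Nielsen's tie-break among automorphisms of equal total length: only the initial half counts,
    rounded up so that it contains any prefix of length at most half. *)
Definition half_code x := code (take (uphalf (len x)) (val x)).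

(** Here [x = p q^-1] and [z = q c'], so the product [p c'] trades the prefix [q] for the smaller
    [p]. Since [q] fills at most half of [z], the initial half of the inverse lies within [c'^-1]
    and does not change. *)
Lemma half_code_mul x z (h := glcp x^-1 z) :
    h.*2 = len x -> h.*2 <= len z ->
    code (take h (val x)) < code (take h (val z)) ->
  [/\ len (x * z) = len z, half_code (x * z) < half_code z
    & half_code (x * z)^-1 = half_code z^-1].
Proof.
move=> hx hz; have := lcp_take (val x^-1) (val z); rewrite -/(glcp _ _) -/h.
have xs : len (x * z) = len z.
  have := lcp_mulV x^-1 z; rewrite lenV -/h hx addKn => <-.
  by rewrite invgK.
set p := take h (val x); set q := take h (val z).
pose r := drop h (val x); pose c' := drop h (val z).
have xpr : val x = p ++ r by rewrite cat_take_drop.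
have zqc : val z = q ++ c' by rewrite cat_take_drop.
have sp : size p = h by rewrite size_takel // -/(len x); lia.
have sr : size r = h by rewrite size_drop -/(len x); lia.
have sq : size q = h by rewrite size_takel // -/(len z); lia.
have sc : size c' = len z - h by rewrite size_drop.
have -> : val x^-1 = word_inv r ++ word_inv p by rewrite -word_inv_cat -xpr.
rewrite take_size_cat ?size_word_inv // => rq pq.
have rE : r = word_inv q by rewrite -rq word_invK.
have vE : val (x * z) = p ++ c'.
  have E : val (x * z) = red_cat p c'.
    rewrite -[LHS]/(red_cat (val x) (val z)) xpr zqc /red_cat foldr_cat.
    rewrite -!/(red_cat _ _) rE; congr red_cat.
    have rc : reduced c'.
      by have := valP z; rewrite -/(val z) zqc => /cat_sorted2[].
    by rewrite -red_cat_id ?red_catVK // -zqc (valP z).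
  rewrite E red_cat_size // -E -/(len _) xs sp sc.
  by lia.
have uh : uphalf (len z) <= len z - h by rewrite uphalf_half; have := odd_double_half (len z); lia.
have uh' : h <= uphalf (len z) by rewrite uphalf_half; have := odd_double_half (len z); lia.
have viE : val (x * z)^-1 = word_inv c' ++ word_inv p.
  by rewrite -[LHS]/(word_inv (val (x * z))) vE word_inv_cat.
have zi : val z^-1 = word_inv c' ++ word_inv q.
  by rewrite -[LHS]/(word_inv (val z)) zqc word_inv_cat.
split=> //.
  rewrite /half_code xs vE zqc !take_cat sp sq (leq_gtF uh').
  exact: code_cat_lt.
by rewrite /half_code !lenV xs viE zi !takel_cat // size_word_inv sc.
Qed.

Lemma sum_step (F : freeGroup n -> nat) phi a b : a.1 != b.1 ->
  \sum_c F (aut_fun (phi * tv a b)%g (fg_letter c)) +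
    (F (phi (fg_letter a)) + F (phi (fg_letter a))^-1%g)
  = \sum_c F (phi (fg_letter c)) +
    (F (phi (fg_letter a) * phi (fg_letter b))%g
     + F (phi (fg_letter a) * phi (fg_letter b))^-1%g).
Proof.
move=> ab; have aa : letter_inv a != a by rewrite letter_inv_neq.
rewrite (bigD1 a) // (bigD1 (letter_inv a)) //=.
rewrite [in RHS](bigD1 a) // [in RHS](bigD1 (letter_inv a)) //=.
rewrite !aut_mulE fg_letterV !autV tv_src // autM.
rewrite (eq_bigr (fun c => F (phi (fg_letter c)))); last first.
  move=> c /andP[ca cai]; rewrite aut_mulE tv_id //.
  by rewrite eq_letter1 negb_or ca.
by lia.
Qed.

Definition nielsen1 phi := forall a b, a.1 != b.1 ->
  (glcp (phi (fg_letter a)) (phi (fg_letter b))).*2 <= len (phi (fg_letter b)).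

Definition nielsen2 phi := forall a b c, a != b -> c != letter_inv b ->
  ~~ (((glcp (phi (fg_letter a)) (phi (fg_letter b))).*2 == len (phi (fg_letter b)))
   && ((glcp (phi (fg_letter (letter_inv b))) (phi (fg_letter c))).*2
       == len (phi (fg_letter b)))).

Definition total_len phi := \sum_c len (phi (fg_letter c)).
Definition total_code phi := \sum_c half_code (phi (fg_letter c)).

Lemma nielsen1_step phi : nielsen1 phi \/
  exists a b, a.1 != b.1 /\ total_len (phi * tv a b) < total_len phi.
Proof.
have [?|] := pselect (nielsen1 phi); first by left.
move=> /existsNP[a] /existsNP[b] /not_implyP[ab] /negP; rewrite -ltnNge => lt.
right; exists (letter_inv a), b; split=> //.
have := @sum_step len phi (letter_inv a) b ab.
rewrite !lenV fg_letterV autV lenV -!/(total_len _).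
have := lcp_mulV (phi (fg_letter a)) (phi (fg_letter b)).
have := lcp_sizel (val (phi (fg_letter a))) (val (phi (fg_letter b))).
rewrite -/(len _) -/(glcp _ _); move: lt.
set l1 := len _; set l2 := len (_ * _); set l3 := len _; set g := glcp _ _.
by lia.
Qed.

(** A factor cancelled half from each side is [X b = p q^-1], with [p] a prefix of [X a] and [q] a
    prefix of [X c]; [lcp_inv] gives [p != q]. If [p] is smaller, [c] is replaced by [b c].
    Otherwise [b] is inverted and [a], [c] are exchanged. *)
Lemma nielsen2_step phi : nielsen1 phi -> nielsen2 phi \/
  exists a b, [/\ a.1 != b.1, total_len (phi * tv a b) = total_len phi
                & total_code (phi * tv a b) < total_code phi].
Proof.
move=> N1; have [?|] := pselect (nielsen2 phi); first by left.
move=> /existsNP[a] /existsNP[b] /existsNP[c] /not_implyP[ab] /not_implyP[cb].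
move=> /negP; rewrite negbK => /andP[/eqP Cab /eqP Cbc]; right.
pose X a := phi (fg_letter a).
have XV d : X (letter_inv d) = (X d)^-1 by rewrite /X fg_letterV autV.
rewrite -!/(X _) in Cab Cbc.
pose h := glcp (X a) (X b).
have bc : letter_inv b != c by rewrite eq_sym.
have hE : glcp (X (letter_inv b)) (X c) = h by rewrite /h; lia.
have pne : take h (val (X b)) != take h (val (X (letter_inv b))).
  apply/eqP => pq; have := lcp_inv (nielsen_X1 phi b); rewrite -/(X b) -XV.
  suff : h <= glcp (X b) (X (letter_inv b)) by rewrite /h; lia.
  rewrite /glcp leq_lcp pq eqxx andbT -!/(len _) XV lenV andbb.
  by rewrite /h; lia.
have wlog_ (a' b' c' : letter n) : a' != b' -> c' != letter_inv b' ->
    glcp (X a') (X b') = h -> glcp (X (letter_inv b')) (X c') = h ->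
    h.*2 = len (X b') ->
    code (take h (val (X b'))) < code (take h (val (X (letter_inv b')))) ->
    exists a b, [/\ a.1 != b.1, total_len (phi * tv a b) = total_len phi
                & total_code (phi * tv a b) < total_code phi].
  move=> ab' cb' h1 h2 h3 lt.
  have tq : take h (val (X (letter_inv b'))) = take h (val (X c')).
    by rewrite -h2 /glcp lcp_take.
  have cb1 : c'.1 != b'.1.
    rewrite eq_letter1 negb_or cb' andbT; apply/eqP => cE.
    by move: lt; rewrite tq cE ltnn.
  have hc : h.*2 <= len (X c').
    by rewrite -h2; apply: N1; rewrite /= eq_sym.
  rewrite tq in lt.
  have := @half_code_mul (X b') (X c'); rewrite -XV h2 => /(_ h3 hc lt) [e1 e2 e3].
  (* The transvection [c'^-1 |-> c'^-1 b'^-1] is [c' |-> b' c']. *)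
  exists (letter_inv c'), (letter_inv b').
  have S (F : freeGroup n -> nat) := @sum_step F phi (letter_inv c') (letter_inv b') cb1.
  have E1 : X (letter_inv c') * X (letter_inv b') = (X b' * X c')^-1.
    by rewrite !XV -invMg.
  split=> //.
    by have := S len; rewrite -!/(X _) E1 !lenV XV lenV e1 -!/(total_len _); lia.
  have arith p q r s t : p + (r + s) = q + (r + t) -> t < s -> p < q by lia.
  have := S half_code; rewrite -!/(X _) E1 e3 invgK XV invgK => E.
  exact: arith E e2.
have [lt|lt|eq] := ltngtP (code (take h (val (X b)))) (code (take h (val (X (letter_inv b))))).
- by apply: (wlog_ a b c).
- apply: (wlog_ c (letter_inv b) a); rewrite ?letter_invK //.
  + by rewrite glcpC.
  + by rewrite glcpC.
  + by rewrite XV lenV.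
- by case/eqP: pne; apply: code_inj eq; rewrite !size_takel // -!/(len _) ?XV ?lenV; lia.
Qed.

Inductive tv_span : groupAut (freeGroup n) -> Prop :=
| tv_span1 : tv_span 1
| tv_span_tv a b : a.1 != b.1 -> tv_span (tv a b)
| tv_spanM phi psi : tv_span phi -> tv_span psi -> tv_span (phi * psi)
| tv_spanV phi : tv_span phi -> tv_span phi^-1.

Lemma tv_span_wx (u v : letter n) : u.1 != v.1 -> tv_span (wx u v).
Proof.
move=> uv; have vu : v.1 != u.1 by rewrite eq_sym.
by apply: tv_spanM; [apply: tv_spanM|]; apply: tv_span_tv.
Qed.

(** Each quarter turn puts one more index in place, as when sorting by transpositions; once every
    index is in place, a sign change remains. *)
Lemma letter_aut_span phi f : letter_aut phi f ->
  exists s U, tv_span s /\ phi = s * flip U.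
Proof.
have [m] := ubnP #|[pred i | (f (i, false)).1 != i]|.
elim: m phi f => // m IH phi f; rewrite ltnS => hm H.
have [/pred0P h0|/pred0Pn[i /= fi]] := boolP (pred0b [pred i | (f (i, false)).1 != i]).
  exists 1, [set i | (f (i, false)).2]; split; first exact: tv_span1.
  rewrite mul1g; apply: aut_gen_eq => i; exists false.
  rewrite H flip_letterE; congr fg_letter; rewrite /flip_letter inE /=.
  by have /negbFE/eqP := h0 i; case: (f (i, false)) => j s /= ->.
pose u : letter n := f (i, false); pose v : letter n := (i, false).
have uv : u.1 != v.1 by [].
have [||s [U [sU E]]] := IH (wx u v * phi) (wl u v \o f).
- apply: leq_trans hm; apply: proper_card; apply/properP; split.
    apply/subsetP => k; rewrite !inE /= wl1 // => hk; apply: contraNneq hk => fk.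
    rewrite fk tpermD //; last by apply: contraNneq fi => /= ->; rewrite fk.
    apply: contraNneq fi => uk; have : (f (k, false)).1 == (f (i, false)).1.
      by rewrite fk -uk.
    by rewrite (letter_aut_eq1 H) => /= /eqP <-; rewrite fk.
  exists i; rewrite inE //= wl1 // negbK -/u.
  by rewrite tpermL.
- by apply: letter_aut_comp H; exact: wxE.
exists ((wx u v)^-1 * s), U; split; last by rewrite -mulgA -E mulKg.
by apply: tv_spanM => //; apply: tv_spanV; exact: tv_span_wx.
Qed.

Lemma flip_span (U : {set 'I_n}) : ~~ odd #|U| -> tv_span (flip U).
Proof.
have [m] := ubnP #|U|; elim: m U => // m IH U; rewrite ltnS => hm oU.
have [->|[i iU]] := set_0Vmem U; first by rewrite flip0; exact: tv_span1.
have : 0 < #|U :\ i| by move: oU; rewrite (cardsD1 i U) iU; case: #|_|.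
case/card_gt0P => j; rewrite !inE => /andP[ji jU].
pose u : letter n := (i, false); pose v : letter n := (j, false).
have uv : u.1 != v.1 by rewrite eq_sym.
have sub : [set i; j] \subset U by apply/subsetP => k; rewrite !inE => /orP[] /eqP ->.
have -> : flip U = flip [set i; j] * flip (U :\: [set i; j]).
  rewrite flipM; congr flip; apply/setP => k; rewrite !inE.
  have := subsetP sub k; rewrite !inE; case: ((k == i) || (k == j)) => /=.
    by move=> /(_ isT) ->.
  by case: (k \in U).
have c2 : #|[set i; j]| = 2 by rewrite cards2 eq_sym ji.
have cD := cardsID [set i; j] U; rewrite (setIidPr sub) c2 in cD.
apply: tv_spanM; first by rewrite -(@wx2 n u v uv); apply: tv_spanM; exact: tv_span_wx.
apply: IH; first by apply: leq_trans hm; lia.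
by move: oU; rewrite -cD oddD.
Qed.

Lemma nielsen phi : exists s U, tv_span s /\ phi = s * flip U.
Proof.
have [m1] := ubnP (total_len phi); elim: m1 phi => // m1 IH1 phi.
have [m2] := ubnP (total_code phi); elim: m2 phi => // m2 IH2 phi h2 h1.
(* The reducing transvection stands on the right of [phi]. Its inverse is carried to the left of
   [flip U] by conjugation, which only changes the signs of its letters. *)
have conclude a b : a.1 != b.1 ->
    (exists s U, tv_span s /\ phi * tv a b = s * flip U) ->
    exists s U, tv_span s /\ phi = s * flip U.
  move=> ab [s [U [sU E]]].
  have ab' : (flip_letter U a).1 != (letter_inv (flip_letter U b)).1 by [].
  exists (s * tv (flip_letter U a) (letter_inv (flip_letter U b))), U; split.
    by apply: tv_spanM => //; exact: tv_span_tv.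
  rewrite -[LHS](mulgK (tv a b)) E -!mulgA tvV // flip_tv //.
  congr (_ * (tv _ _ * _)).
  by case: b {ab E ab'} => j t; rewrite /letter_inv /flip_letter /= addNb.
have [N1|[a [b [ab lt]]]] := nielsen1_step phi; last first.
  by apply: (conclude a b) => //; apply: IH1; lia.
have [N2|[a [b [ab e lt]]]] := nielsen2_step N1; last first.
  by apply: (conclude a b) => //; apply: IH2; lia.
have /choice[f fE] := nielsen_reduced_letter N1 N2.
have H : letter_aut phi^-1 f.
  by move=> a; rewrite -fE -aut_mulE mulVg.
have fI := letter_aut_inj H.
apply: (@letter_aut_span phi (invF fI)) => a.
by rewrite -[a in LHS](f_invF fI) fE.
Qed.

(* [D phi] is the sign of the residual diagonal factor, since transvections have
   determinant [1]. *)
Lemma SAut_span phi : 2 < n -> in_SAut phi -> tv_span phi.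
Proof.
move=> hn /eqP phi1; have [s [U [sS E]]] := nielsen phi.
have s1 : D s = 1%R.
  elim: sS => [|a b ab|p q _ IHp _ IHq|p _ IHp]; first by rewrite /D ab_mx1 det1.
  - exact: det_tv.
  - by rewrite detM IHp IHq mulr1.
  - have := detM p p^-1; rewrite mulgV IHp mul1r => <-.
    by rewrite /D ab_mx1 det1.
rewrite E; apply: tv_spanM => //; apply: flip_span.
have : D phi = 1%R := phi1.
by rewrite E detM s1 mul1r det_flip -signr_odd; case: odd.
Qed.

End Nielsen.

(** * Actions of SAut(F_n) *)

Section SAutElements.
Variable n : nat.
Hypothesis hn : 2 < n.
Implicit Types (a b c d u v : letter n) (U V : {set 'I_n}).

(** Automorphisms of determinant other than 1 are sent to the identity; hence the evenness
    conditions on [U] in the lemmas about [sflip]. *)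
Definition to_SAut (phi : groupAut (freeGroup n)) : SAut n :=
  insubd (1 : SAut n) phi.

Lemma to_SAutE phi : D phi = 1%R -> val (to_SAut phi) = phi.
Proof. by move=> h; apply: insubdK; apply/eqP. Qed.

Lemma SAut_valM (g h : SAut n) : val (g * h) = val g * val h.
Proof. by []. Qed.

Definition stv a b := to_SAut (tv a b).
Definition sflip U := to_SAut (flip U).
Definition swx u v := to_SAut (wx u v).

Lemma stvE a b : a.1 != b.1 -> val (stv a b) = tv a b.
Proof. by move=> ab; apply: to_SAutE; exact: det_tv. Qed.

Lemma sflipE U : ~~ odd #|U| -> val (sflip U) = flip U.
Proof. by move=> oU; apply: to_SAutE; rewrite det_flip -signr_odd (negPf oU). Qed.

Lemma swxE u v : u.1 != v.1 -> val (swx u v) = wx u v.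
Proof.
move=> uv; have vu : v.1 != u.1 by rewrite eq_sym.
by apply: to_SAutE; rewrite /wx !detM !det_tv.
Qed.

Section Action.
Variables (X : Type) (act : leftAction (SAut n) X).
Implicit Types x y : X.

(* The opaque proofs keep unification away from the arithmetic of [SAut n]. *)
Fact aE_subproof : {f | f = fun a b => act (stv a b)}. Proof. by eexists. Qed.
Fact aF_subproof : {f | f = fun U => act (sflip U)}. Proof. by eexists. Qed.
Fact aW_subproof : {f | f = fun u v => act (swx u v)}. Proof. by eexists. Qed.
Definition aE := sval aE_subproof.
Definition aF := sval aF_subproof.
Definition aW := sval aW_subproof.

Lemma aEE a b : aE a b = act (stv a b). Proof. by rewrite /aE (svalP aE_subproof). Qed.
Lemma aFE U : aF U = act (sflip U). Proof. by rewrite /aF (svalP aF_subproof). Qed.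
Lemma aWE u v : aW u v = act (swx u v). Proof. by rewrite /aW (svalP aW_subproof). Qed.

Lemma act_eq2 (g1 g2 h1 h2 : SAut n) x :
  val g1 * val g2 = val h1 * val h2 -> act g1 (act g2 x) = act h1 (act h2 x).
Proof.
by move=> e; rewrite -!lactM; congr (act _ x); apply: val_inj; exact: e.
Qed.

Lemma aE_comm a b c d x : a.1 != b.1 -> c.1 != d.1 -> a.1 != d.1 -> c.1 != b.1 ->
  a != c -> aE a b (aE c d x) = aE c d (aE a b x).
Proof.
by move=> ab cd ad cb ac; rewrite !(aEE, aFE, aWE);
  apply: act_eq2; rewrite (stvE ab) (stvE cd); exact: tv_comm.
Qed.

Lemma aEK a b x : a.1 != b.1 -> aE a (letter_inv b) (aE a b x) = x.
Proof.
move=> ab; rewrite -[RHS](lact1 act) -[1 in RHS]mulg1 lactM.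
have ab' : a.1 != (letter_inv b).1 by [].
rewrite !(aEE, aFE, aWE); apply: act_eq2; rewrite (stvE ab) (stvE ab') (tvK ab); exact/esym/mulg1.
Qed.

Lemma aEVK a b x : a.1 != b.1 -> aE a b (aE a (letter_inv b) x) = x.
Proof. by move=> ab; rewrite -{1}[b]letter_invK aEK. Qed.

Lemma act_eq32 (g1 g2 h1 h2 h3 : SAut n) x :
  val g1 * val g2 = val h1 * val h2 * val h3 ->
  act g1 (act g2 x) = act h1 (act h2 (act h3 x)).
Proof. by move=> e; rewrite -(lactM act h1); apply: act_eq2. Qed.

Lemma aE_rel a b c x : a.1 != b.1 -> a.1 != c.1 -> b.1 != c.1 ->
  aE b c (aE a b x) = aE a b (aE a c (aE b c x)).
Proof.
by move=> ab ac bc; rewrite !(aEE, aFE, aWE);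
  apply: act_eq32; rewrite (stvE ab) (stvE ac) (stvE bc); exact: tv_rel.
Qed.

Lemma aE_relV a b c x : a.1 != b.1 -> a.1 != c.1 -> b.1 != c.1 ->
  aE (letter_inv b) c (aE a b x) =
  aE a (letter_inv c) (aE a b (aE (letter_inv b) c x)).
Proof.
move=> ab ac bc; have bc' : (letter_inv b).1 != c.1 by [].
have ac' : a.1 != (letter_inv c).1 by [].
by rewrite !(aEE, aFE, aWE);
  apply: act_eq32; rewrite (stvE ab) (stvE ac') (stvE bc'); exact: tv_relV.
Qed.

Lemma aF_E U a b x : ~~ odd #|U| -> a.1 != b.1 ->
  aF U (aE a b x) = aE (flip_letter U a) (flip_letter U b) (aF U x).
Proof.
move=> oU ab; have ab' : (flip_letter U a).1 != (flip_letter U b).1 by [].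
by rewrite !(aEE, aFE, aWE);
  apply: act_eq2; rewrite (stvE ab) (stvE ab') (sflipE oU); exact: flip_tv.
Qed.

Lemma aFM U V x : ~~ odd #|U| -> ~~ odd #|V| ->
  aF U (aF V x) = aF ((U :\: V) :|: (V :\: U)) x.
Proof.
move=> oU oV; rewrite -[RHS](lact1 act).
suff oUV : ~~ odd #|(U :\: V) :|: (V :\: U)|.
  rewrite !(aEE, aFE, aWE); apply: act_eq2; rewrite (sflipE oU) (sflipE oV) (sflipE oUV) flipM.
  exact/esym/mul1g.
rewrite cardsU (_ : (U :\: V) :&: (V :\: U) = set0); last first.
  by apply/setP => i; rewrite !inE; case: (i \in U); case: (i \in V).
rewrite cards0 subn0 oddD; have := cardsID V U; have := cardsID U V.
rewrite setIC => h1 h2; move: oU oV; rewrite -h1 -h2 !oddD.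
by case: (odd #|U :&: V|); case: (odd #|U :\: V|); case: (odd #|V :\: U|).
Qed.

Lemma aF0 x : aF set0 x = x.
Proof.
rewrite aFE -[RHS](lact1 act); congr (act _ x); apply: val_inj.
by rewrite sflipE ?cards0 // flip0.
Qed.

Lemma aFK U : ~~ odd #|U| -> involutive (aF U).
Proof. by move=> oU x; rewrite aFM // setDv setU0 aF0. Qed.

Lemma aF_comm U V x : ~~ odd #|U| -> ~~ odd #|V| -> aF U (aF V x) = aF V (aF U x).
Proof. by move=> oU oV; rewrite (aFM _ oU oV) (aFM _ oV oU) setUC. Qed.

Lemma aW_E u v a b x : u.1 != v.1 -> a.1 != b.1 ->
  aW u v (aE a b x) = aE (wl u v a) (wl u v b) (aW u v x).
Proof.
move=> uv ab; have H := wxE uv; have := ab; rewrite -(letter_aut_eq1 H) => ab'.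
by rewrite !(aEE, aFE, aWE);
  apply: act_eq2; rewrite (stvE ab) (stvE ab') (swxE uv); exact: letter_aut_conj.
Qed.

Lemma odd_tperm i j U : odd #|tperm i j @: U| = odd #|U|.
Proof. by rewrite card_imset //; exact: perm_inj. Qed.

Lemma aW_F u v U x : u.1 != v.1 -> ~~ odd #|U| ->
  aW u v (aF U x) = aF (tperm u.1 v.1 @: U) (aW u v x).
Proof.
move=> uv oU; have oU' : ~~ odd #|tperm u.1 v.1 @: U| by rewrite odd_tperm.
by rewrite !(aEE, aFE, aWE);
  apply: act_eq2; rewrite (swxE uv) (sflipE oU) (sflipE oU'); exact: wx_flip.
Qed.

Lemma aW_def u v x : u.1 != v.1 -> aW u v x =
  aE v (letter_inv u) (aE (letter_inv u) (letter_inv v) (aE (letter_inv v) u x)).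
Proof.
move=> uv; have vu : v.1 != u.1 by rewrite eq_sym.
have u'v' : (letter_inv u).1 != (letter_inv v).1 by [].
have vu' : v.1 != (letter_inv u).1 by [].
have v'u : (letter_inv v).1 != u.1 by [].
rewrite -[LHS](lact1 act); rewrite !(aEE, aFE, aWE); apply: act_eq32.
by rewrite (stvE u'v') (stvE vu') (stvE v'u) (swxE uv); exact: mul1g.
Qed.

Lemma odd_set2 (i j : 'I_n) : i != j -> ~~ odd #|[set i; j]|.
Proof. by move=> ij; rewrite cards2 ij. Qed.

Lemma aW2 u v x : u.1 != v.1 -> aW u v (aW u v x) = aF [set u.1; v.1] x.
Proof.
move=> uv; rewrite -[RHS](lact1 act); rewrite !(aEE, aFE, aWE); apply: act_eq2.
by rewrite (swxE uv) (sflipE (odd_set2 uv)) (wx2 uv); exact/esym/mul1g.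
Qed.

Lemma act_inj g : injective (act g).
Proof. by move=> x y /(congr1 (act g^-1)); rewrite -!lactM mulVg !lact1. Qed.

Lemma aE_inj a b : injective (aE a b).
Proof. rewrite aEE; exact: act_inj. Qed.

Lemma aF_inj U : injective (aF U).
Proof. rewrite aFE; exact: act_inj. Qed.

Lemma aW_inj u v : injective (aW u v).
Proof. rewrite aWE; exact: act_inj. Qed.

Lemma act_trivial : (forall a b x, a.1 != b.1 -> aE a b x = x) ->
  forall g x, act g x = x.
Proof.
move=> H g x; have := SAut_span hn (valP g); rewrite -/(val g) => sg.
suff [h hg hx] : exists2 h : SAut n, val h = val g & forall x, act h x = x.
  by have -> : g = h by apply: val_inj.
elim: sg => [|a b ab|p q _ [g1 e1 H1] _ [g2 e2 H2]|p _ [g1 e1 H1]].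
- by exists 1 => // y; rewrite lact1.
- by exists (stv a b) => [|y]; [rewrite stvE|rewrite -aEE; exact: H].
- by exists (g1 * g2) => [|y]; rewrite ?SAut_valM ?e1 ?e2 // lactM H2 H1.
- exists g1^-1 => [|y]; first by rewrite -e1; apply/esym/mulg1_eq; rewrite -SAut_valM mulgV.
  by apply: (@act_inj g1); rewrite -lactM mulgV lact1 H1.
Qed.

End Action.
End SAutElements.

(** * Occurring characters *)

Section Orthogonality.
Local Open Scope ring_scope.
Variables (X : finType) (O : {set X}).

(** The Gram matrix is diagonal with nonzero sums of squares as entries, hence invertible, while its
    rank is at most [#|O|]. *)
Lemma orthogonal_card (I : finType) (F : I -> X -> rat) :
    (forall i, exists2 x, x \in O & F i x != 0) ->
    (forall i j, i != j -> \sum_(x in O) F i x * F j x = 0) ->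
  (#|I| <= #|O|)%N.
Proof.
move=> F0 Fij.
pose M : 'M[rat]_(#|I|, #|O|) := \matrix_(i, k) F (enum_val i) (enum_val k).
have MM i j : (M *m M^T) i j = \sum_(x in O) F (enum_val i) x * F (enum_val j) x.
  rewrite mxE (reindex_omap enum_val (fun x => (insub (index x (enum O)) : option 'I_#|O|))) /=.
    apply: eq_big => k; last by rewrite !mxE.
    rewrite enum_valP /=; apply/esym/eqP.
    rewrite insubT => [|h]; first by rewrite cardE index_mem mem_enum enum_valP.
    congr Some; apply: val_inj => /=.
    by rewrite index_uniq ?enum_uniq // -cardE.
  move=> x xO; rewrite insubT => [|h]; first by rewrite cardE index_mem mem_enum.
  by rewrite /= (enum_val_nth x) /= nth_index // mem_enum.
have dd : M *m M^T = diag_mx (\row_i (M *m M^T) i i).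
  apply/matrixP => i j; rewrite [RHS]mxE [in RHS]mxE.
  case: (eqVneq i j) => [->|ij] //=; rewrite MM mulr0n Fij //.
  by rewrite (inj_eq enum_val_inj).
have u : M *m M^T \in unitmx.
  rewrite unitmxE dd det_diag unitfE; apply/prodf_neq0 => i _; rewrite mxE MM.
  rewrite psumr_neq0 => [|x _]; last by rewrite -expr2 sqr_ge0.
  have [x xO Fx] := F0 (enum_val i); apply/hasP; exists x.
    by rewrite mem_index_enum.
  by rewrite xO /= -expr2 exprn_even_gt0.
have := mxrankM_maxl M M^T; rewrite (mxrank_unit u) => h.
exact: leq_trans h (rank_leq_col _).
Qed.

Variables (T : eqType) (t : T -> X -> X).

(* Projecting [f0] by [1 + (-1)^b t k], for a suitable sign, keeps it nonzero at [x]. *)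
Lemma eigen_extend (K K0 : seq T) (s0 : T -> bool) (f0 : X -> rat) (x : X) :
    (forall k y, k \in K0 ++ K -> y \in O -> t k y \in O) ->
    (forall k y, k \in K0 ++ K -> y \in O -> t k (t k y) = y) ->
    (forall k l y, k \in K0 ++ K -> l \in K0 ++ K -> y \in O ->
       t k (t l y) = t l (t k y)) ->
    x \in O -> f0 x != 0 ->
    (forall k y, k \in K0 -> y \in O -> f0 (t k y) = (-1) ^+ s0 k * f0 y) ->
  exists (f : X -> rat) (s : T -> bool), [/\ f x != 0,
    forall k y, k \in K0 ++ K -> y \in O -> f (t k y) = (-1) ^+ s k * f y
    & {in K0, s =1 s0}].
Proof.
elim: K K0 s0 f0 => [|k K IH] K0 s0 f0 tO tt tC xO f0x f0E.
  by exists f0, s0; split=> // k y; rewrite cats0; apply: f0E.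
have memE l : (l \in rcons K0 k ++ K) = (l \in K0 ++ k :: K).
  by rewrite cat_rcons.
have [kK0|kK0] := boolP (k \in K0).
  have memE' l : (l \in K0 ++ k :: K) = (l \in K0 ++ K).
    by rewrite !mem_cat inE; case: eqP => [->|] //; rewrite kK0.
  have [||||||f [s [H1 H2 H3]]] := IH K0 s0 f0 => //.
  - by move=> l y; rewrite -memE'; apply: tO.
  - by move=> l y; rewrite -memE'; apply: tt.
  - by move=> l l' y; rewrite -!memE'; apply: tC.
  by exists f, s; split=> // l y; rewrite memE'; apply: H2.
have kin : k \in K0 ++ k :: K by rewrite mem_cat mem_head orbT.
have [b fb] : exists b : bool, f0 x + (-1) ^+ b * f0 (t k x) != 0.
  have [e|] := eqVneq (f0 x + f0 (t k x)) 0; last first.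
    by exists false; rewrite expr0 mul1r.
  exists true; rewrite expr1 mulN1r; apply: contra_neq f0x => e'.
  have : f0 x *+ 2 = 0 by rewrite mulr2n -[X in _ + X]addr0 -e'; move: e; lra.
  by move/eqP; rewrite mulrn_eq0 /= => /eqP.
have [||||||f [s [H1 H2 H3]]] := IH (rcons K0 k)
    (fun l => if l == k then b else s0 l)
    (fun y => f0 y + (-1) ^+ b * f0 (t k y)) => //.
- by move=> l y; rewrite memE; apply: tO.
- by move=> l y; rewrite memE; apply: tt.
- by move=> l l' y; rewrite !memE; apply: tC.
- move=> l y; rewrite mem_rcons inE => /orP[/eqP ->|lK0] yO.
    rewrite eqxx tt // mulrDr mulrA -signr_addb addbb mul1r.
    by rewrite addrC.
  have lin : l \in K0 ++ k :: K by rewrite mem_cat lK0.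
  have -> : (l == k) = false by apply: contraNF kK0 => /eqP <-.
  rewrite (tC k l) // (f0E l y) // (f0E l (t k y)) ?tO //.
  by rewrite mulrDr mulrCA.
exists f, s; split=> // [l y|l lK0]; first by rewrite -memE; apply: H2.
rewrite H3; last by rewrite mem_rcons inE lK0 orbT.
by case: eqP => // lk; rewrite -lk lK0 in kK0.
Qed.

End Orthogonality.

Local Close Scope ring_scope.

(** * Symmetric differences and parity *)

Section SymmetricDifference.
Variable T : finType.
Implicit Types U V J : {set T}.

Definition symd U V : {set T} := (U :\: V) :|: (V :\: U).

Lemma in_symd U V i : (i \in symd U V) = (i \in U) (+) (i \in V).
Proof. by rewrite !inE; case: (i \in U); case: (i \in V). Qed.

Lemma symdC U V : symd U V = symd V U.
Proof. exact: setUC. Qed.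

Lemma symdK U V : symd (symd U V) V = U.
Proof. by apply/setP => i; rewrite !in_symd -addbA addbb addbF. Qed.

Lemma symdI U V J : symd U V :&: J = symd (U :&: J) (V :&: J).
Proof.
by apply/setP => i; rewrite inE !in_symd !inE; case: (i \in J); rewrite ?andbT ?andbF.
Qed.

Lemma symd_eq0 U V : (symd U V == set0) = (U == V).
Proof.
apply/eqP/eqP => [/setP h|->]; apply/setP => i; last by rewrite in_symd inE addbb.
by have := h i; rewrite in_symd inE; case: (i \in U); case: (i \in V).
Qed.

Lemma symd_eqT U V : (symd U V == setT) = (U == ~: V).
Proof.
apply/eqP/eqP => [/setP h|->]; apply/setP => i; last first.
  by rewrite in_symd !inE; case: (i \in V).
by have := h i; rewrite in_symd !inE; case: (i \in U); case: (i \in V).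
Qed.

Lemma card_symd U V : #|symd U V| + (#|U :&: V|).*2 = #|U| + #|V|.
Proof.
rewrite cardsU (_ : (U :\: V) :&: (V :\: U) = set0); last first.
  by apply/setP => i; rewrite !inE; case: (i \in U); case: (i \in V).
rewrite cards0 subn0; have := cardsID V U; have := cardsID U V.
rewrite setIC; lia.
Qed.

Lemma odd_symd U V : odd #|symd U V| = odd #|U| (+) odd #|V|.
Proof. by rewrite -oddD -card_symd oddD odd_double addbF. Qed.

Lemma odd_symdI U V J : odd #|symd U V :&: J| = odd #|U :&: J| (+) odd #|V :&: J|.
Proof. by rewrite symdI odd_symd. Qed.

Lemma odd_pairI (i j : T) J : i != j ->
  odd #|[set i; j] :&: J| = (i \in J) (+) (j \in J).
Proof.
move=> ij; have -> : [set i; j] = symd [set i] [set j].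
  apply/setP => k; rewrite in_symd !inE; case: eqP => // ->.
  by rewrite (negPf ij).
have one k : odd #|[set k] :&: J| = (k \in J).
  have [kJ|kJ] := boolP (k \in J); first by rewrite (setIidPl _) ?sub1set // cards1.
  by rewrite (_ : _ :&: _ = set0) ?cards0 //; apply/eqP; rewrite setI_eq0 disjoints1.
by rewrite odd_symdI !one.
Qed.

Lemma even_set_ind (P : {set T} -> Prop) :
    P set0 -> (forall i j U, i != j -> ~~ odd #|U| -> P U -> P (symd [set i; j] U)) ->
  forall U, ~~ odd #|U| -> P U.
Proof.
move=> P0 PS U; have [m] := ubnP #|U|; elim: m U => // m IH U; rewrite ltnS => hm oU.
have [->//|[i iU]] := set_0Vmem U.
have : 0 < #|U :\ i| by move: oU; rewrite (cardsD1 i U) iU; case: #|_|.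
case/card_gt0P => j; rewrite !inE => /andP[ji jU].
have ij : i != j by rewrite eq_sym.
have E : symd [set i; j] (symd [set i; j] U) = U by rewrite symdC [symd _ U]symdC symdK.
have oV : ~~ odd #|symd [set i; j] U| by rewrite odd_symd cards2 ij.
rewrite -E; apply: PS => //; apply: IH => //.
have := card_symd [set i; j] U; rewrite (setIidPl _); last first.
  by apply/subsetP => k; rewrite !inE => /orP[] /eqP ->.
rewrite cards2 ij; lia.
Qed.

End SymmetricDifference.

Section Characters.
Variable n : nat.
Hypothesis hn : 2 < n.
Variables (X : finType) (act : leftAction (SAut n) X).
Implicit Types (a b c d u v : letter n) (U V J : {set 'I_n}) (x y : X).
Notation F := (aF act).
Notation W := (aW act).

Lemma FM U V x : ~~ odd #|U| -> ~~ odd #|V| -> F U (F V x) = F (symd U V) x.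
Proof. by move=> oU oV; rewrite (aFM act x oU oV). Qed.

(* The character [U |-> (-1)^|U :&: J|] of the group of even sign changes
   occurs in the span of the orbit of [x]. *)
Definition occ x J := exists f : X -> rat, f x != 0%R /\
  forall U y, ~~ odd #|U| -> f (F U y) = ((-1) ^+ odd #|U :&: J| * f y)%R.

Lemma occ0 x : occ x set0.
Proof.
exists (fun=> 1%R); split=> [|U y _]; first by rewrite oner_eq0.
by rewrite setI0 cards0 mul1r.
Qed.

(** Nonvanishing at the point [x] survives pointwise products, which is why [occ] is attached to a
    point: the sets occurring there form a group. *)
Lemma occ_symd x J J' : occ x J -> occ x J' -> occ x (symd J J').
Proof.
move=> [f [f0 fE]] [g [g0 gE]]; exists (fun y => f y * g y)%R; split.
  by rewrite mulf_neq0.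
move=> U y oU; rewrite fE // gE // mulrACA -signr_addb; congr (_ ^+ nat_of_bool _ * _)%R.
by rewrite [U :&: symd _ _]setIC symdI odd_symd ![_ :&: U]setIC.
Qed.

(** An even set meets [J] and its complement with the same parity, so both name the same
    character. *)
Lemma occC x J : occ x J -> occ x (~: J).
Proof.
move=> [f [f0 fE]]; exists f; split=> // U y oU; rewrite fE //.
suff -> : odd #|U :&: ~: J| = odd #|U :&: J| by [].
by move: oU; rewrite -(cardsID J U) setDE oddD; case: odd; case: odd.
Qed.

Lemma occF x J U : ~~ odd #|U| -> occ x J -> occ (F U x) J.
Proof.
move=> oU [f [f0 fE]]; exists f; split=> //.
by rewrite fE // mulf_neq0 // signr_eq0.
Qed.

Lemma imset_tpermK (i j : 'I_n) U : tperm i j @: (tperm i j @: U) = U.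
Proof.
rewrite -imset_comp -[RHS]imset_id; apply: eq_imset => k /=; exact: tpermK.
Qed.

Lemma occW x J u v : u.1 != v.1 -> occ x J -> occ (W u v x) (tperm u.1 v.1 @: J).
Proof.
move=> uv [f [f0 fE]]; pose g : SAut n := swx u v.
exists (fun y => f (act g^-1 y)); split.
  by rewrite aWE -lactM mulVg lact1.
move=> U y oU; have oU' : ~~ odd #|tperm u.1 v.1 @: U| by rewrite odd_tperm.
have -> : act g^-1 (F U y) = F (tperm u.1 v.1 @: U) (act g^-1 y).
  apply: (@act_inj _ _ act g); rewrite -lactM mulgV lact1 -aWE.
  by rewrite aW_F // imset_tpermK aWE -lactM mulgV lact1.
rewrite fE //; congr (_ ^+ nat_of_bool (odd _) * _)%R.
rewrite -(card_imset _ (@perm_inj _ (tperm u.1 v.1))) imsetI;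
  last by move=> ? ? _ _; exact: perm_inj.
by rewrite imset_tpermK.
Qed.

(** The indicator of [x] minus that of [F U x] is negated by [F U]. Extended to a joint
    eigenfunction, it yields a character of the even sets that is [-1] on [U]. *)
Lemma occ_sep x U : ~~ odd #|U| -> F U x != x -> exists J, occ x J /\ odd #|U :&: J|.
Proof.
move=> oU Ux.
pose f0 y : rat := ((y == x)%:R - (y == F U x)%:R)%R.
have [||||||f [s [H1 H2 H3]]] := @eigen_extend X setT {set 'I_n} (fun V => F V)
   (enum [pred V : {set 'I_n} | ~~ odd #|V|]) [:: U] (fun=> true) f0 x.
- by move=> *; rewrite inE.
- move=> V y; rewrite inE mem_enum => oV _; apply: aFK => //.
  by case/orP: oV => // /eqP ->.
- move=> V V' y; rewrite !inE !mem_enum => oV oV' _; apply: aF_comm.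
  + by case/orP: oV => // /eqP ->.
  + by case/orP: oV' => // /eqP ->.
- by rewrite inE.
- by rewrite /f0 eqxx [x == F U x]eq_sym (negPf Ux) subr0 oner_eq0.
- move=> V y; rewrite inE => /eqP -> _; rewrite /f0 /= expr1 mulN1r opprB.
  by rewrite (inj_eq (can_inj (aFK act oU))) (can2_eq (aFK act oU) (aFK act oU)).
have {}H2 V y : ~~ odd #|V| -> f (F V y) = ((-1) ^+ s V * f y)%R.
  by move=> oV; apply: H2; rewrite ?inE // mem_enum inE oV orbT.
have signI (b c : bool) : ((-1) ^+ b * f x = (-1) ^+ c * f x)%R -> b = c.
  by move/(mulIf H1)/eqP; case: b c => [] [].
have sM V V' : ~~ odd #|V| -> ~~ odd #|V'| -> s (symd V V') = s V (+) s V'.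
  move=> oV oV'; apply: signI; rewrite -H2; last first.
    by rewrite odd_symd (negPf oV) (negPf oV').
  by rewrite -FM // !H2 // mulrA -signr_addb.
have s0 : s set0 = false.
  by apply: signI; rewrite -H2 ?cards0 // aF0 // mul1r.
have [i0 _] : exists i0 : 'I_n, true by exists (Ordinal (ltn_trans (isT : 0 < 2) hn)).
(* Of the two complementary sets naming the character [s], this is the one avoiding [i0]. *)
pose J := [set k | (k != i0) && s [set i0; k]].
have sJ V : ~~ odd #|V| -> s V = odd #|V :&: J|.
  move: V; apply: even_set_ind; first by rewrite set0I cards0.
  move=> i j V ij oV IH; have oij : ~~ odd #|[set i; j]| by rewrite odd_set2.
  rewrite sM // odd_symdI IH odd_pairI //; congr (_ (+) _).
  rewrite !inE; have [e|i_i0] /= := eqVneq i i0.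
    by rewrite -e [j == i]eq_sym ij.
  have [-> /=|j_i0 /=] := eqVneq j i0; first by rewrite addbF setUC.
  have -> : [set i; j] = symd [set i0; i] [set i0; j].
    apply/setP => k; rewrite in_symd !inE; have [->|] := eqVneq k i0 => /=.
      by rewrite eq_sym (negPf i_i0) eq_sym (negPf j_i0).
    have [->|//] := eqVneq k i; by rewrite (negPf ij).
  by rewrite sM // odd_set2 // eq_sym.
exists J; split; last by rewrite -sJ // H3 ?inE.
by exists f; split=> // V y oV; rewrite H2 // sJ.
Qed.

Lemma occ_pair x J (i j : 'I_n) : occ x J -> i \in J -> j \notin J ->
  F [set i; j] x != x.
Proof.
move=> [f [f0 fE]] iJ jJ; have ij : i != j by apply: contraNneq jJ => <-.
apply/eqP => e; have := fE [set i; j] x (odd_set2 ij).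
rewrite e odd_pairI // iJ (negPf jJ) /= mulN1r => /eqP.
by rewrite -subr_eq0 opprK -mulr2n mulrn_eq0 (negPf f0).
Qed.

Lemma occ_card (Js : {set {set 'I_n}}) :
    (forall J, J \in Js -> exists x, occ x J) ->
    (forall J J', J \in Js -> J' \in Js -> J != J' -> J != ~: J') ->
  #|Js| <= #|X|.
Proof.
move=> H HC; rewrite -(card_sig (mem Js)) -[#|X|]cardsT.
have /choice[f fP] : forall J : {J | J \in Js}, exists f : X -> rat,
    (exists x, f x != 0%R) /\ forall U y, ~~ odd #|U| ->
      f (F U y) = ((-1) ^+ odd #|U :&: val J| * f y)%R.
  by move=> [J /= /H[x [f [f0 fE]]]]; exists f; split=> //; exists x.
apply: (@orthogonal_card _ _ _ f) => [J|J J' JJ'].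
  by have [[x fx] _] := fP J; exists x; rewrite ?inE.
have nJ : val J != val J' by rewrite (inj_eq val_inj).
have nJC := HC _ _ (valP J) (valP J') nJ.
have [i iS] : exists i, i \in symd (val J) (val J') by apply/set0Pn; rewrite symd_eq0.
have [j jS] : exists j, j \notin symd (val J) (val J').
  by apply/existsP; rewrite -negb_forall; apply: contra nJC => /forallP h;
    rewrite -symd_eqT; apply/eqP/setP => k; rewrite h inE.
have ij : i != j by apply: contraNneq jS => <-.
have oij := odd_set2 ij; have [_ EJ] := fP J; have [_ EJ'] := fP J'.
(* The two characters differ on [[set i; j]], so reindexing the sum by this sign change reverses its
   sign. *)
set S := (\sum_(x in _) _)%R; suff : S = (- S)%R.
  by move/eqP; rewrite -subr_eq0 opprK -mulr2n mulrn_eq0 /= => /eqP.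
rewrite {1}/S (reindex_inj (can_inj (aFK act oij))) -sumrN.
apply: eq_big => x; first by rewrite !inE.
move=> _; rewrite EJ // EJ' // mulrACA -signr_addb !odd_pairI //.
move: iS jS; rewrite !in_symd.
by case: (i \in _); case: (i \in _); case: (j \in _); case: (j \in _); rewrite //= mulN1r.
Qed.

Lemma swap_ind (P : {set 'I_n} -> Prop) :
    (forall i j (S : {set 'I_n}), i != j -> P S -> P (tperm i j @: S)) ->
  forall S S' : {set 'I_n}, #|S| = #|S'| -> P S -> P S'.
Proof.
move=> PS S S'; have [m] := ubnP #|S :\: S'|; elim: m S => // m IH S.
rewrite ltnS => hm cS pS.
have cD : #|S :\: S'| = #|S' :\: S|.
  by have := cardsID S S'; have := cardsID S' S; rewrite setIC; lia.
have [D0|[i]] := set_0Vmem (S :\: S').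
  suff -> : S' = S by [].
  apply/eqP; rewrite eqEsubset -!setD_eq0 D0 eqxx andbT -cards_eq0 -cD.
  by rewrite D0 cards0.
move=> iD; have : 0 < #|S' :\: S| by rewrite -cD; apply/card_gt0P; exists i.
case/card_gt0P => j; move: iD; rewrite !inE => /andP[iS' iS] /andP[jS jS'].
have ij : i != j by apply: contraNneq jS => <-.
apply: (IH (tperm i j @: S)).
- apply: leq_trans hm; apply: proper_card; apply/properP; split; last first.
    exists i; rewrite !inE ?iS' ?iS //= -[i in i \in _](tpermR i j).
    by rewrite mem_imset ?(negPf jS) //; exact: perm_inj.
  apply/subsetP => k; rewrite !inE -{2}[k](tpermK i j) mem_imset; last exact: perm_inj.
  by case: tpermP => [->|->|_ _]; rewrite ?(negPf jS) ?andbF ?jS'.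
- by rewrite card_imset //; exact: perm_inj.
- exact: PS.
Qed.

Lemma occ_size x J J' : occ x J -> #|J| = #|J'| -> exists y, occ y J'.
Proof.
move=> xJ cJ; pose P S := exists y, occ y S.
apply: (@swap_ind P _ J J') => //; last by exists x.
move=> i j S ij [y yS]; exists (W (i, false) (j, false) y).
exact: (@occW _ _ (i, false) (j, false)).
Qed.

End Characters.

(** * Large classes of indices *)

Section LinearAction.
Variable n : nat.
Hypothesis hn : 2 < n.
Variables (X : finType) (act : leftAction (SAut n) X).
Implicit Types (a b c d u v : letter n) (U V J : {set 'I_n}) (x y : X).
Notation E := (aE act).
Notation F := (aF act).
Notation W := (aW act).

Lemma flip_letter_out U a : a.1 \notin U -> flip_letter U a = a.
Proof. by case: a => i s /= /negPf iU; rewrite /flip_letter iU addbF. Qed.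

Lemma flip_letter_in U a : a.1 \in U -> flip_letter U a = letter_inv a.
Proof. by case: a => i s /= iU; rewrite /flip_letter iU addbT. Qed.

Lemma ex_third (C : {set 'I_n}) (i j : 'I_n) : 2 < #|C| ->
  exists k, [/\ k \in C, k != i & k != j].
Proof.
move=> hC; have : 0 < #|C :\: [set i; j]|.
  rewrite lt0n; apply: contraTneq hC; rewrite -(cardsID [set i; j] C) => ->.
  rewrite addn0 -leqNgt; apply: leq_trans (subset_leq_card (subsetIr _ _)) _.
  by rewrite cards2; case: eqP.
case/card_gt0P => k; rewrite !inE negb_or => /andP[/andP[ki kj] kC].
by exists k.
Qed.

(** Flipping one index of a transvection together with a third index of [C] inverts one letter only;
    as such flips fix [O], signs of letters are irrelevant there. The [E _ m] thus act as commuting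
    involutions. If one of them is nontrivial, the remaining transvections move its character to all
    the others, one for each subset of [C :\ m]. *)
Lemma linear_trivial (C : {set 'I_n}) (O : {set X}) : 2 < #|C| ->
    (forall a b y, a.1 != b.1 -> a.1 \in C -> b.1 \in C -> y \in O -> E a b y \in O) ->
    (forall i j y, i != j -> i \in C -> j \in C -> y \in O -> F [set i; j] y = y) ->
    #|O| < 2 ^ #|C|.-1 ->
  forall a b y, a.1 != b.1 -> a.1 \in C -> b.1 \in C -> y \in O -> E a b y = y.
Proof.
move=> hC EO FO.
have sgl a b y : a.1 != b.1 -> a.1 \in C -> b.1 \in C -> y \in O ->
    E (letter_inv a) b y = E a b y.
  move=> ab aC bC yO; have [k [kC ka kb]] := ex_third a.1 b.1 hC.
  have ak : a.1 != k by rewrite eq_sym.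
  have := aF_E hn act y (odd_set2 ak) ab.
  rewrite flip_letter_in ?inE ?eqxx // flip_letter_out; last first.
    by rewrite !inE negb_or eq_sym ab eq_sym.
  by rewrite (FO _ _ y) // FO ?EO.
have sgr a b y : a.1 != b.1 -> a.1 \in C -> b.1 \in C -> y \in O ->
    E a (letter_inv b) y = E a b y.
  move=> ab aC bC yO; have [k [kC ka kb]] := ex_third a.1 b.1 hC.
  have bk : b.1 != k by rewrite eq_sym.
  have := aF_E hn act y (odd_set2 bk) ab.
  rewrite flip_letter_out; last by rewrite !inE negb_or ab eq_sym.
  rewrite flip_letter_in ?inE ?eqxx //.
  by rewrite (FO _ _ y) // FO ?EO.
pose t m i y := E (i, false) (m, false) y.
have Et a b y : a.1 != b.1 -> a.1 \in C -> b.1 \in C -> y \in O -> E a b y = t b.1 a.1 y.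
  case: a b => i s [m r] /= im iC mC yO; rewrite /t.
  have -> : E (i, s) (m, r) y = E (i, false) (m, r) y.
    by case: s => //; apply: (@sgl (i, false)).
  by case: r => //; apply: (@sgr (i, false) (m, false)).
move=> cO a b y ab aC bC yO; rewrite Et //; apply/eqP; apply: contraLR cO => ty.
rewrite -leqNgt; set m := b.1 in ab bC ty.
set K := C :\ m.
have KP i : (i \in K) = (i != m) && (i \in C) by rewrite !inE.
have tO i z : i \in K -> z \in O -> t m i z \in O.
  by rewrite KP => /andP[im iC] zO; apply: EO.
have tt i z : i \in K -> z \in O -> t m i (t m i z) = z.
  rewrite KP => /andP[im iC] zO; rewrite {2}/t -sgr //.
  exact: (@aEVK _ hn _ act (i, false) (m, false)).
have tC i l z : i \in K -> l \in K -> t m i (t m l z) = t m l (t m i z).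
  rewrite !KP => /andP[im iC] /andP[lm lC]; have [->//|il] := eqVneq i l.
  by apply: aE_comm => //; rewrite xpair_eqE negb_and il.
have aK : a.1 \in K by rewrite KP ab aC.
pose occO J := exists f : X -> rat, (exists2 z, z \in O & f z != 0%R) /\
  forall i z, i \in K -> z \in O -> f (t m i z) = ((-1) ^+ (i \in J) * f z)%R.
have [J [occJ aJ JK]] : exists J, [/\ occO J, a.1 \in J & J \subset K].
  have [||||||f [s [H1 H2 H3]]] := @eigen_extend X O 'I_n (t m)
     (enum K) [:: a.1] (fun=> true) (fun z => (z == y)%:R - (z == t m a.1 y)%:R)%R y => //.
  - by move=> i z; rewrite inE mem_enum => /orP[/eqP ->|iK] zO; apply: tO.
  - by move=> i z; rewrite inE mem_enum => /orP[/eqP ->|iK] zO; apply: tt.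
  - by move=> i l z; rewrite !inE !mem_enum => /orP[/eqP ->|iK] /orP[/eqP ->|lK] zO; apply: tC.
  - by rewrite eqxx [y == t _ _ _]eq_sym (negPf ty) subr0 oner_eq0.
  - move=> i z; rewrite inE => /eqP -> zO; rewrite expr1 mulN1r opprB.
    have inj : injective (t m a.1) by exact: aE_inj.
    have -> : (t m a.1 z == y) = (z == t m a.1 y).
      by rewrite -{1}[y](tt _ _ aK yO) (inj_eq inj).
    by rewrite (inj_eq inj).
  exists [set i in K | s i]; split.
  - exists f; split; first by exists y.
    move=> i z iK zO; rewrite H2 ?mem_cat ?mem_enum ?iK ?orbT //.
    by rewrite in_set iK.
  - by rewrite in_set aK H3 ?mem_seq1.
  - by apply/subsetP => i; rewrite in_set => /andP[].
have occ_step J1 k l : occO J1 -> k \in J1 -> J1 \subset K -> l \in K -> l != k ->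
    occO (symd J1 [set l]).
  move=> [f [[z0 z0O fz] fE]] kJ /subsetP JK1 lK lk.
  have /andP[km kC] : (k != m) && (k \in C) by rewrite -KP JK1.
  have /andP[lm lC] : (l != m) && (l \in C) by rewrite -KP.
  have kl : k != l by rewrite eq_sym.
  (* Conjugation by [t l k] turns [t m l] into the product of [t m l] and [t m k], so the sign at
     [l] is multiplied by the sign at [k], which is [-1]; the other signs stay. *)
  exists (fun z => f (t l k z)); split.
    exists (t l k z0); first exact: EO.
    suff -> : t l k (t l k z0) = z0 by [].
    rewrite {2}/t -sgr //; exact: (@aEVK _ hn _ act (k, false) (l, false)).
  move=> i z iK zO; have zO' : t l k z \in O by exact: EO.
  have /andP[im iC] : (i != m) && (i \in C) by rewrite -KP.
  rewrite in_symd inE; have [->|il] := eqVneq i l.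
    have R : t m l (t l k z) = t m k (t l k (t m l z)).
      have ml : m != l by rewrite eq_sym.
      have mk : m != k by rewrite eq_sym.
      rewrite /t (@aE_rel _ hn _ act (k, false) (l, false) (m, false)) //.
      have zO1 : E (l, false) (m, false) z \in O by exact: EO.
      rewrite -(sgl (k, false)) ?EO // -[in RHS](sgl (k, false) (l, false)) //.
      by apply: aE_comm; rewrite // xpair_eqE eqxx.
    have kK := JK1 _ kJ; have zO1 : t m l z \in O by exact: EO.
    have -> : t l k (t m l z) = t m k (t m l (t l k z)) by rewrite R tt //; apply: EO.
    rewrite fE // ?tO // kJ (fE l) // mulrA -signr_addb.
    by rewrite addbC.
  rewrite addbF -fE // /t; congr f; have [e|ki] := eqVneq k i; last first.
    by apply: aE_comm => //; rewrite xpair_eqE negb_and ki.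
  rewrite -e; have zO2 : E (k, false) (m, false) z \in O by apply: EO.
  rewrite -(sgl (k, false) (l, false)) // -[in RHS](sgl (k, false) (l, false)) //.
  by apply: aE_comm => //; rewrite xpair_eqE eqxx.
have occ_grow J1 k J2 : occO J1 -> k \in J1 -> k \in J2 -> J1 \subset K ->
    J2 \subset K -> occO J2.
  have [r] := ubnP #|symd J1 J2|; elim: r J1 => // r IH J1; rewrite ltnS => hr o1 k1 k2 s1 s2.
  have [/eqP|[l]] := set_0Vmem (symd J1 J2); first by rewrite symd_eq0 => /eqP <-.
  move=> lS; have lk : l != k by apply: contraTneq lS => ->; rewrite in_symd k1 k2.
  have lK : l \in K.
    by move: lS; rewrite in_symd; have [/(subsetP s1)|_ /(subsetP s2)] := boolP (l \in J1).
  apply: (IH (symd J1 [set l])) => //.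
  - apply: leq_trans hr; apply: proper_card; apply/properP; split; last first.
      by exists l => //; rewrite !in_symd inE eqxx addbAC -in_symd lS.
    apply/subsetP => i; rewrite !in_symd inE; have [->|_] := eqVneq i l.
      by rewrite addbAC -in_symd lS.
    by rewrite addbF.
  - exact: (occ_step _ k).
  - by rewrite in_symd inE k1 eq_sym (negPf lk).
  - apply/subsetP => i; rewrite in_symd inE; have [->|_] := eqVneq i l; first by [].
    by rewrite addbF => /(subsetP s1).
have occ_all J2 : J2 \subset K -> occO J2.
  move=> s2; have [->|[l l2]] := set_0Vmem J2.
    exists (fun=> 1%R); split; first by exists y; rewrite ?oner_eq0.
    by move=> i z _ _; rewrite inE mul1r.
  have lK := subsetP s2 _ l2.
  (* Each use of [occ_grow] needs an element common to both sets; [[set a.1; l]] links [J] to a set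
     that may avoid [a.1]. *)
  apply: (occ_grow [set a.1; l] l) => //; rewrite ?inE ?eqxx ?orbT //.
    by apply: (occ_grow J a.1) => //; rewrite ?inE ?eqxx // subUset !sub1set aK.
  by rewrite subUset !sub1set aK.
have cK : #|K| = #|C|.-1 by rewrite (cardsD1 m C) bC.
rewrite -cK -card_powerset -(card_sig (mem (powerset K))).
have /choice[f fP] : forall J1 : {J1 | J1 \in powerset K}, exists f : X -> rat,
    (exists2 z, z \in O & f z != 0%R) /\
    forall i z, i \in K -> z \in O -> f (t m i z) = ((-1) ^+ (i \in val J1) * f z)%R.
  by move=> [J1 /= J1K]; apply: occ_all; rewrite powersetE in J1K.
apply: (@orthogonal_card _ _ _ f) => [J1|J1 J2 J12]; first by have [] := fP J1.
have [i iS] : exists i, i \in symd (val J1) (val J2).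
  by apply/set0Pn; rewrite symd_eq0 (inj_eq val_inj).
have iK : i \in K.
  move: iS; rewrite in_symd; have := valP J1; have := valP J2; rewrite !powersetE.
  by move=> /subsetP s2 /subsetP s1; have [/s1|_ /s2] := boolP (i \in val J1).
have [_ E1] := fP J1; have [_ E2] := fP J2.
set S := (\sum_(x in _) _)%R; suff : S = (- S)%R.
  by move/eqP; rewrite -subr_eq0 opprK -mulr2n mulrn_eq0 /= => /eqP.
rewrite {1}/S (reindex_inj (@aE_inj _ _ act (i, false) (m, false))) -sumrN.
apply: eq_big => z.
  apply/idP/idP => [zO|zO]; last by apply: tO.
  have /andP[im iC] : (i != m) && (i \in C) by rewrite -KP.
  rewrite -[z](@aEK _ hn _ act (i, false) (m, false)) //.
  by apply: EO.
move=> tzO; have zO : z \in O.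
  have /andP[im iC] : (i != m) && (i \in C) by rewrite -KP.
  rewrite -[z](@aEK _ hn _ act (i, false) (m, false)) //.
  by apply: EO.
rewrite -[E _ _ z]/(t m i z) E1 // E2 // mulrACA -signr_addb -in_symd iS /=.
by rewrite mulN1r.
Qed.

End LinearAction.

Section LargeClasses.
Variable n : nat.
Hypothesis hn : 2 < n.
Variables (X : finType) (act : leftAction (SAut n) X).
Implicit Types (a b c d u v : letter n) (U V J : {set 'I_n}) (x y : X).
Notation E := (aE act).
Notation F := (aF act).
Notation W := (aW act).

(* [C x] is a class of the equivalence relation [F [set i; j] x = x]. *)
Variables (C : X -> {set 'I_n}) (c0 : nat).
Hypothesis CP : forall x i j, i != j -> i \in C x ->
  (j \in C x) = (F [set i; j] x == x).
Hypothesis C_ge : forall x, c0 <= #|C x|.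
Hypothesis c0_large : n + 3 <= c0.*2.
Hypothesis c0_gt3 : 3 < c0.

Lemma class_fix x i j : i != j -> i \in C x -> j \in C x -> F [set i; j] x = x.
Proof. by move=> ij iC; rewrite (CP ij iC) => /eqP. Qed.

(** Three common indices leave one outside the two indices of a transvection; it is the base point
    through which [class_eq] compares two classes. *)
Lemma large_sets_meet (A B : {set 'I_n}) : c0 <= #|A| -> c0 <= #|B| -> 2 < #|A :&: B|.
Proof.
have arith p q r : c0 <= p -> c0 <= q -> r <= p -> p + q - r <= n -> 2 < r by lia.
move=> hA hB; apply: (arith #|A| #|B|) => //; first by rewrite subset_leq_card ?subsetIl.
by rewrite -cardsU -[X in _ <= X]card_ord max_card.
Qed.

Lemma class_eq x y (s : 'I_n -> 'I_n) k0 k :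
    k0 \in C y -> s k0 \in C x -> injective s ->
    (k0 != k -> (F [set k0; k] y == y) = (F [set s k0; s k] x == x)) ->
  (k \in C y) = (s k \in C x).
Proof.
move=> k0y k0x sI H; have [<-|kk] := eqVneq k0 k; first by rewrite k0y k0x.
by rewrite (CP kk k0y) H // (@CP x (s k0)) // (inj_eq sI).
Qed.

Lemma class_E x a b k : a.1 != b.1 -> k != a.1 -> k != b.1 ->
  (k \in C (E a b x)) = (k \in C x).
Proof.
move=> ab ka kb; have := large_sets_meet (C_ge (E a b x)) (C_ge x).
case/(ex_third a.1 b.1) => k0 [/setIP[k0y k0x] k0a k0b].
apply: (@class_eq x _ id k0) => // kk.
have oF := odd_set2 kk.
have := aF_E hn act x oF ab; rewrite !flip_letter_out ?inE ?negb_or; last 2 first.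
- by rewrite eq_sym k0b eq_sym.
- by rewrite eq_sym k0a eq_sym.
by move=> ->; rewrite (inj_eq (@aE_inj _ _ act a b)).
Qed.

Lemma tperm_set2 (i j k l : 'I_n) :
  tperm i j @: [set k; l] = [set tperm i j k; tperm i j l].
Proof. by rewrite imsetU !imset_set1. Qed.

Lemma class_W x u v : u.1 != v.1 -> C (W u v x) = tperm u.1 v.1 @: C x.
Proof.
move=> uv; have h : c0 <= #|tperm u.1 v.1 @: C x|.
  by rewrite card_imset //; exact: perm_inj.
have := large_sets_meet (C_ge (W u v x)) h.
case/(ex_third u.1 v.1) => k0 [/setIP[k0y k0x] _ _].
apply/setP => k; rewrite -[k in RHS](tpermK u.1 v.1) mem_imset; last exact: perm_inj.
apply: (@class_eq x _ (tperm u.1 v.1) k0) => //.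
- by move: k0x; rewrite -{1}[k0](tpermK u.1 v.1) mem_imset //; exact: perm_inj.
- exact: perm_inj.
move=> kk; have kk' : tperm u.1 v.1 k0 != tperm u.1 v.1 k by rewrite (inj_eq perm_inj).
rewrite -(inj_eq (@aW_inj _ _ act u v) (F _ x)) (aW_F hn act x uv (odd_set2 kk')).
by rewrite tperm_set2 !tpermK.
Qed.

Lemma class_F x U : ~~ odd #|U| -> C (F U x) = C x.
Proof.
move=> oU; have := large_sets_meet (C_ge (F U x)) (C_ge x).
move=> h; have [k0] : exists k0, k0 \in C (F U x) :&: C x by apply/card_gt0P; apply: leq_trans h.
case/setIP=> k0y k0x; apply/setP => k.
apply: (@class_eq x _ id k0) => // kk.
by rewrite (aF_comm act x (odd_set2 kk) oU) (inj_eq (@aF_inj _ _ act U)).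
Qed.

(** * Descent: a minimal class [M :\ i] inside a set [M] with one more index *)

Section Minimal.
Variable m : nat.
Hypothesis C_min : forall x, m <= #|C x|.
Hypothesis c0m : c0 <= m.
Hypothesis m_fix : forall y a b, #|C y| = m -> a.1 != b.1 -> a.1 \in C y ->
  b.1 \in C y -> E a b y = y.

Variable M : {set 'I_n}.
Hypothesis cM : #|M| = m.+1.

Lemma ex_fourth (i j k : 'I_n) : exists l, [/\ l \in M, l != i, l != j & l != k].
Proof.
have : 2 < #|M :\ i|.
  have := cardsD1 i M; rewrite cM; move: #|_| => p; case: (i \in M); lia.
by case/(ex_third j k) => l [/setD1P[li lM] lj lk]; exists l.
Qed.

(** Losing both [i] and [j] would leave [m - 1] indices, below the minimum. *)
Lemma class_cases y (i j : 'I_n) : i != j -> i \in M -> j \in M ->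
    (forall k, k != i -> k != j -> (k \in C y) = (k \in M)) ->
  [\/ C y = M, C y = M :\ i | C y = M :\ j].
Proof.
move=> ij iM jM H; have [iy|iy] := boolP (i \in C y); have [jy|jy] := boolP (j \in C y).
- apply: Or31; apply/setP => k; have [->|ki] := eqVneq k i; first by rewrite iy iM.
  by have [->|kj] := eqVneq k j; rewrite ?jy ?jM // H.
- apply: Or33; apply/setP => k; rewrite !inE.
  have [->|kj] := eqVneq k j; first by rewrite (negPf jy).
  by have [->|ki] := eqVneq k i; rewrite ?iy ?iM // H.
- apply: Or32; apply/setP => k; rewrite !inE.
  have [->|ki] := eqVneq k i; first by rewrite (negPf iy).
  by have [->|kj] := eqVneq k j; rewrite ?jy ?jM // H.
have s : C y \subset M :\ i :\ j.
  apply/subsetP => k ky; rewrite !inE.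
  have kj : k != j by apply: contraNneq jy => <-.
  have ki : k != i by apply: contraNneq iy => <-.
  by rewrite kj ki -H.
have := leq_trans (C_min y) (subset_leq_card s).
have := cardsD1 i M; have := cardsD1 j (M :\ i); rewrite !inE iM jM eq_sym ij cM.
by move=> -> [->]; rewrite add1n ltnn.
Qed.

Lemma setD1_inj (i j : 'I_n) : i \in M -> M :\ i = M :\ j -> i = j.
Proof. by move=> iM /setP/(_ i); rewrite !inE eqxx iM andbT; case: eqP. Qed.

Lemma setD1_neq (i : 'I_n) : i \in M -> M :\ i <> M.
Proof. by move=> iM /setP/(_ i); rewrite !inE eqxx iM. Qed.

Lemma card_setD1 (i : 'I_n) : i \in M -> #|M :\ i| = m.
Proof. by move=> iM; have := cardsD1 i M; rewrite iM cM add1n => -[]. Qed.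

Lemma tperm_setD1 (i j k : 'I_n) : i != k -> j != k -> i \in M -> j \in M ->
  tperm i j @: (M :\ k) = M :\ k.
Proof.
move=> ik jk iM jM; apply/setP => l.
rewrite -{1}[l](tpermK i j) mem_imset; last exact: perm_inj.
by rewrite !inE; case: tpermP => [->|->|_ _] //; rewrite ?ik ?jk ?iM ?jM.
Qed.

Lemma tperm_setM (i j : 'I_n) : i \in M -> j \in M -> tperm i j @: M = M.
Proof.
move=> iM jM; apply/setP => l.
rewrite -{1}[l](tpermK i j) mem_imset; last exact: perm_inj.
by case: tpermP => [->|->|_ _] //; rewrite ?iM ?jM.
Qed.

Lemma wl_u u v : wl u v u = v. Proof. by rewrite /wl eqxx. Qed.

Lemma wl_out u v a : a.1 != u.1 -> a.1 != v.1 -> wl u v a = a.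
Proof.
rewrite !eq_letter1 !negb_or /wl.
by move=> /andP[/negPf -> /negPf ->] /andP[/negPf -> /negPf ->].
Qed.

Section Point.
Variables (i : 'I_n) (y : X).
Hypothesis iM : i \in M.
Hypothesis Cy : C y = M :\ i.

Lemma point_fix a b : a.1 != b.1 -> a.1 \in M -> b.1 \in M -> a.1 != i -> b.1 != i ->
  E a b y = y.
Proof.
move=> ab aM bM ai bi; apply: m_fix => //; rewrite Cy ?card_setD1 //.
  by rewrite !inE ai.
by rewrite !inE bi.
Qed.

Lemma point_W u v : u.1 != v.1 -> u.1 \in M -> v.1 \in M -> u.1 != i -> v.1 != i ->
  W u v y = y.
Proof.
move=> uv uM vM ui vi; have vu : v.1 != u.1 by rewrite eq_sym.
rewrite (aW_def hn act y uv) (@point_fix (letter_inv v) u) //.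
rewrite (@point_fix (letter_inv u) (letter_inv v)) //.
exact: point_fix.
Qed.

Lemma point_flip l : l \in M -> l != i -> F [set i; l] y <> y.
Proof.
move=> lM li Fy; have lC : l \in C y by rewrite Cy !inE li.
have := CP li lC; rewrite setUC Fy eqxx Cy !inE eqxx.
by [].
Qed.

Lemma class_point k : k != i -> (k \in C y) = (k \in M).
Proof. by move=> ki; rewrite Cy !inE ki. Qed.

Lemma class_in b a : a.1 = i -> b.1 != i -> b.1 \in M ->
  [\/ C (E b a y) = M, C (E b a y) = M :\ i | C (E b a y) = M :\ b.1].
Proof.
move=> ai bi bM; apply: class_cases => //; first by rewrite eq_sym.
by move=> k ki kb; rewrite class_E ?ai // class_point.
Qed.

Lemma class_out b a : a.1 = i -> b.1 != i -> b.1 \in M ->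
  [\/ C (E a b y) = M, C (E a b y) = M :\ i | C (E a b y) = M :\ b.1].
Proof.
move=> ai bi bM; apply: class_cases => //; first by rewrite eq_sym.
by move=> k ki kb; rewrite class_E ?ai ?class_point // eq_sym.
Qed.

End Point.

(** With class [M :\ b.1], the point [E b a y] would be fixed by [E d a] for a third index, and so
    would [y]. The quarter turn from [d] to [b] fixes [y], so [E b a] would fix [y] as well, and the
    class could not have changed. *)
Lemma in_not_class_b i y a b : i \in M -> C y = M :\ i -> a.1 = i -> b.1 != i ->
  b.1 \in M -> C (E b a y) <> M :\ b.1.
Proof.
move=> iM Cy ai bi bM Cp; have [l [lM li lb _]] := ex_fourth i b.1 b.1.
pose d : letter n := (l, false); have da : d.1 != a.1 by rewrite ai.
have ba : b.1 != a.1 by rewrite ai.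
have db : d != b by apply: contraNneq lb => <-.
have : E d a (E b a y) = E b a y.
  by apply: (point_fix bM Cp) => //; rewrite ?ai // eq_sym.
rewrite aE_comm // => /(@aE_inj _ _ act) dy.
have Wy : W d b y = y by apply: (point_W iM Cy).
have : E b a y = y.
  have H := aW_E hn act y (u := d) (v := b) lb da.
  by rewrite wl_u wl_out ?ai // 1?eq_sym // dy Wy in H; rewrite -H.
by move=> e; rewrite e Cy in Cp; case/eqP: bi; apply/esym; apply: setD1_inj Cp.
Qed.

(** If [E b a] moved [y], both [E b a y] and [E d a y] would have class [M]. Their common translate
    [s] then has class [M] or [M :\ i]: the first makes [F [set i; k]] fix [y], and in the second
    [E b d] fixes [s], so that [aE_rel] cancels down to [E b a y = y]. *)
Lemma in_fix i y a b : i \in M -> C y = M :\ i -> a.1 = i -> b.1 != i ->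
  b.1 \in M -> E b a y = y.
Proof.
move=> iM Cy ai bi bM.
(* Exchanging two letters of [M :\ i] preserves the type of [E b a y]. *)
have swap_type a' b' d : a'.1 = i -> b'.1 != i -> b'.1 \in M -> d.1 != i ->
    d.1 \in M -> b'.1 != d.1 -> E d a' y = W b' d (E b' a' y).
  move=> a'i b'i b'M di dM b'd.
  rewrite (aW_E hn act y) ?a'i // wl_u wl_out ?a'i 1?eq_sym // 1?eq_sym //.
  by rewrite (point_W iM Cy).
have rel a' b' d : a'.1 = i -> b'.1 != i -> b'.1 \in M -> d.1 != i -> d.1 \in M ->
    b'.1 != d.1 -> E b' d (E b' a' (E d a' y)) = E d a' y.
  move=> a'i b'i b'M di dM b'd; have da' : d.1 != a'.1 by rewrite a'i.
  have ba' : b'.1 != a'.1 by rewrite a'i.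
  rewrite -(aE_rel hn act y b'd ba' da').
  by rewrite (point_fix iM Cy).
have comm a' b' d z : a'.1 = i -> b'.1 != i -> d.1 != i -> b'.1 != d.1 ->
    E b' a' (E d a' z) = E d a' (E b' a' z).
  move=> a'i b'i di b'd; apply: aE_comm; rewrite ?a'i //.
  by apply: contraNneq b'd => ->.
have typed a' b' : a'.1 = i -> b'.1 != i -> b'.1 \in M ->
    E b' a' y = y \/ C (E b' a' y) = M.
  move=> a'i b'i b'M; have [Cp|Cp|Cp] := class_in iM Cy a'i b'i b'M.
  - by right.
  - left; have [l [lM li lb _]] := ex_fourth i b'.1 b'.1.
    pose d : letter n := (l, false); have bd : b'.1 != d.1 by rewrite eq_sym.
    have Cd : C (E d a' y) = M :\ i.
      by rewrite (swap_type _ b') // class_W // Cp tperm_setD1.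
    have := rel a' b' d a'i b'i b'M li lM bd.
    rewrite -{2}(point_fix iM Cd bd) // => /(@aE_inj _ _ act).
    by rewrite comm // => /(@aE_inj _ _ act).
  - by case: (in_not_class_b iM Cy a'i b'i b'M Cp).
have [//|Cb] := typed a b ai bi bM.
exfalso; have [l [lM li lb _]] := ex_fourth i b.1 b.1.
pose d : letter n := (l, false); have bd : b.1 != d.1 by rewrite eq_sym.
have [k [kM ki kb kl]] := ex_fourth i b.1 l.
have ik : i != k by rewrite eq_sym.
have oF := odd_set2 ik.
have Fik a' b' z : a'.1 = i -> b'.1 != i -> b'.1 != k ->
    F [set i; k] (E b' a' z) = E b' (letter_inv a') (F [set i; k] z).
  move=> a'i b'i b'k; rewrite (aF_E hn act z oF) ?a'i // flip_letter_out; last first.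
    by rewrite !inE negb_or b'i.
  by rewrite flip_letter_in // !inE a'i eqxx.
have Fsym z : C z = M -> F [set i; k] z = z.
  by move=> Cz; apply: class_fix; rewrite ?Cz.
have yb : E b a y <> y by move=> e; rewrite e Cy in Cb; exact: setD1_neq Cb.
have Cd : C (E d a y) = M.
  by rewrite (swap_type a b) // class_W // Cb tperm_setM.
pose s := E d a (E b a y).
have sE : s = E b a (E d a y) by rewrite -comm.
have da : d.1 != a.1 by rewrite ai.
have ba : b.1 != a.1 by rewrite ai.
have Cs : C s = M \/ C s = M :\ i.
  have H1 : [\/ C s = M, C s = M :\ i | C s = M :\ d.1].
    apply: class_cases => //; first by rewrite eq_sym.
    by move=> j ji jd; rewrite class_E ?ai // Cb.
  have H2 : [\/ C s = M, C s = M :\ i | C s = M :\ b.1].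
    rewrite sE; apply: class_cases => //; first by rewrite eq_sym.
    by move=> j ji jd; rewrite class_E ?ai // Cd.
  case: H1 => [|| H1]; [by left|by right|].
  case: H2 => [|| H2]; [by left|by right|].
  by case/eqP: lb; apply: (setD1_inj lM); rewrite -H1 -H2.
case: Cs => Cs.
  (* [F [set i; k]] inverts [a] and fixes the points of class [M]. Applied to [s] it shows that
     [E d a] squared fixes [y]; applied to [E d a y] it then gives [F [set i; k] y = y]. *)
  have e1 := Fsym _ Cs; rewrite /s Fik // 1?eq_sym // Fsym // in e1.
  have e2 : E d a (E d a y) = y.
    apply: (@aE_inj _ _ act b a); rewrite !(comm a b d) //.
    by rewrite -[RHS](aEVK hn act _ da) e1.
  have e3 := Fsym _ Cd; rewrite Fik // 1?eq_sym // in e3.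
  have e4 : E d (letter_inv a) y = E d a y by rewrite -{1}e2 aEK.
  apply: (point_flip Cy kM ki).
  by apply: (@aE_inj _ _ act d (letter_inv a)); rewrite e3 e4.
have e1 : E b d s = s.
  by apply: (point_fix iM Cs).
have := rel a b d ai bi bM li lM bd; rewrite -sE e1 sE comm //.
by move=> /(@aE_inj _ _ act).
Qed.

(** By [in_fix], multiplying letters of [M :\ i] by the outside letter fixes [y]. If multiplying the
    outside letter by one of them also did, a quarter turn and its square [F [set i; b.1]] would fix
    [y]. So those transvections move [y], and they lead to class [M], where sign changes within [M]
    act trivially; the signs in two such translates then contradict [point_flip]. *)
Lemma minimal_absurd i y : i \in M -> C y <> M :\ i.
Proof.
move=> iM Cy.
have in_fix' := fun a b => @in_fix i y a b iM Cy.
have out_neq a b : a.1 = i -> b.1 != i -> b.1 \in M -> E a b y <> y.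
  move=> ai bi bM Eab; pose u := letter_inv a; pose v := letter_inv b.
  have uv : u.1 != v.1 by rewrite /= ai eq_sym.
  have Wy : W u v y = y.
    rewrite (aW_def hn act y uv) in_fix' //= ?ai //.
    by rewrite /u /v !letter_invK Eab in_fix'.
  apply: (point_flip Cy bM bi); rewrite -[in LHS]ai.
  by rewrite -(aW2 hn act y uv) !Wy.
have swap_type a b c : a.1 = i -> b.1 != i -> b.1 \in M -> c.1 != i ->
    c.1 \in M -> b.1 != c.1 -> E a c y = W b c (E a b y).
  move=> ai bi bM ci c_M bc; have ab : a.1 != b.1 by rewrite ai eq_sym.
  rewrite (aW_E hn act y) // wl_u wl_out ?ai 1?eq_sym // 1?eq_sym //.
  by rewrite (point_W iM Cy).
have typed a b : a.1 = i -> b.1 != i -> b.1 \in M -> C (E a b y) = M.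
  move=> ai bi bM; have ab : a.1 != b.1 by rewrite ai eq_sym.
  have [l [lM li lb _]] := ex_fourth i b.1 b.1.
  pose c : letter n := (l, false); have bc : b.1 != c.1 by rewrite eq_sym.
  have ac : a.1 != c.1 by rewrite ai eq_sym.
  have [//|Cp|Cp] := class_out iM Cy ai bi bM.
    have Cc : C (E a c y) = M :\ i.
      by rewrite (swap_type _ b) // class_W // Cp tperm_setD1.
    have cb : c.1 != b.1 by rewrite eq_sym.
    have := aE_rel hn act y ac ab cb.
    rewrite (point_fix iM Cc cb) // (point_fix iM Cy cb) // => /(@aE_inj _ _ act)/esym.
    by move=> /out_neq; case.
  have : E (letter_inv a) c (E a b y) = E a b y.
    by apply: (point_fix bM Cp) => //=; rewrite ?ai // eq_sym.
  rewrite aE_comm //; last by rewrite letter_inv_neq.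
  by move=> /(@aE_inj _ _ act)/out_neq; case.
pose a : letter n := (i, false).
have [j [jM ji _ _]] := ex_fourth i i i.
have [k [kM ki kj _]] := ex_fourth i j j.
have [l [lM li lj lk]] := ex_fourth i j k.
pose b : letter n := (j, false); pose c : letter n := (k, false).
have ab : a.1 != b.1 by rewrite eq_sym.
have ac : a.1 != c.1 by rewrite eq_sym.
have bc : b.1 != c.1 by rewrite eq_sym.
have il : i != l by rewrite eq_sym.
have jl : j != l by rewrite eq_sym.
have kl : k != l by rewrite eq_sym.
pose zb := E a b y; pose zc := E a c y; pose q := E b c zb.
have Czb : C zb = M by exact: typed.
have Czc : C zc = M by exact: typed.
have qE : q = E a b zc.
  rewrite /q /zb (aE_rel hn act y ab ac bc) (point_fix iM Cy) //.
have flipM z s t : C z = M -> s != t -> s \in M -> t \in M -> F [set s; t] z = z.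
  by move=> Cz st sM tM; apply: class_fix; rewrite ?Cz.
have flipE s t a' b' z : s != t -> a'.1 != b'.1 ->
    F [set s; t] (E a' b' z) =
    E (flip_letter [set s; t] a') (flip_letter [set s; t] b') (F [set s; t] z).
  by move=> st ab'; apply: aF_E => //; exact: odd_set2.
have zc_flip : zc = E (letter_inv a) c (F [set i; l] y).
  rewrite -[LHS](flipM _ i l Czc) // flipE // flip_letter_in ?inE ?eqxx //.
  by rewrite flip_letter_out // !inE negb_or ki.
have Cq : C q = M \/ C q = M :\ j.
  have H1 : [\/ C q = M, C q = M :\ j | C q = M :\ k].
    apply: class_cases => //.
    by move=> s sj sk; rewrite class_E // Czb.
  have H2 : [\/ C q = M, C q = M :\ i | C q = M :\ j].
    rewrite qE; apply: class_cases => //.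
    by move=> s si sj; rewrite class_E // Czc.
  case: H1 => [||H1]; [by left|by right|].
  case: H2 => [|H2|]; [by left| |by right].
  by case/eqP: ki; apply: (setD1_inj kM); rewrite -H1 -H2.
(* If [q] has class [M :\ j], transvections avoiding [j] fix it, whence
   [E (letter_inv a) (letter_inv c)] fixes [zc]. By [zc_flip] this identifies [zc] with [F
   [set i; l] y], whose class is [M :\ i] and not [M]. *)
case: Cq => Cq; last first.
  have fixc c' : c'.1 = k -> E (letter_inv a) c' zc = zc.
    move=> c'k; apply: (@aE_inj _ _ act a b); rewrite -qE aE_comm ?c'k //.
      by rewrite -qE; apply: (point_fix jM Cq) => //; rewrite ?c'k.
    by rewrite eq_sym letter_inv_neq.
  have := fixc (letter_inv c) erefl; rewrite {1}zc_flip aEK // => e.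
  by move: Czc; rewrite -e class_F ?odd_set2 // Cy; exact: setD1_neq.
(* Now [zb] and [q] both have class [M], so a transvection carrying one to the other may have the
   signs of its letters changed freely. *)
have e1 : E (letter_inv b) c zb = q.
  rewrite -[RHS](flipM _ j l Cq) // /q flipE // (flipM zb) //.
  by rewrite flip_letter_in ?inE ?eqxx // flip_letter_out // !inE negb_or kj.
have e2 : E a (letter_inv c) zb = q.
  rewrite -e1 /zb (aE_relV hn act y ab ac bc).
  by rewrite (point_fix iM Cy (bc : (letter_inv b).1 != c.1)).
have e3 : E a c zb = q.
  rewrite -[RHS](flipM _ k l Cq) // -e2 flipE // (flipM zb) //.
  rewrite flip_letter_out; last by rewrite !inE negb_or il eq_sym ki.
  by rewrite flip_letter_in ?inE ?eqxx // letter_invK.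
have e4 : E (letter_inv a) c zb = q.
  rewrite -[RHS](flipM _ i l Cq) // -e3 flipE // (flipM zb) //.
  by rewrite flip_letter_in ?inE ?eqxx // flip_letter_out // !inE negb_or ki.
have e5 : E (letter_inv a) c y = zc.
  apply: (@aE_inj _ _ act a b); rewrite -qE -e4 /zb aE_comm //.
  by rewrite eq_sym letter_inv_neq.
apply: (point_flip Cy lM li); apply: (@aE_inj _ _ act (letter_inv a) c).
by rewrite e5 -zc_flip.
Qed.

End Minimal.

Hypothesis X_small : #|X| < 2 ^ c0.
Hypothesis X_small' : #|X| < 2 ^ n.-1.

Lemma large_classes_trivial g x : act g x = x.
Proof.
have [x0 _] : exists x0 : X, true by exists x.
have [z _ z_min] := arg_minnP (fun z => #|C z|) (isT : xpredT x0).
have {z_min} C_min y : #|C z| <= #|C y| by exact: z_min.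
have cz := C_ge z.
have fixed y : #|C y| = #|C z| -> #|[set t | C t == C y]| < 2 ^ #|C y|.-1 ->
    forall a b, a.1 != b.1 -> a.1 \in C y -> b.1 \in C y -> E a b y = y.
  move=> yz small a b ab aC bC.
  have h2 : 2 < #|C y| by rewrite yz; apply: leq_trans cz; exact: ltnW.
  apply: (linear_trivial hn h2 (O := [set t | C t == C y])) => //; last by rewrite inE.
    (* Only the membership of [a'.1] and [b'.1], both in [C y], can change. The new class is
       therefore contained in [C y], and equal to it by minimality. *)
    move=> a' b' t ab' aC' bC'; rewrite !inE => /eqP tC.
    rewrite eqEcard yz C_min andbT; apply/subsetP => k.
    have [->//|ka] := eqVneq k a'.1; have [->//|kb] := eqVneq k b'.1.
    by rewrite class_E // tC.
  move=> i j t ij iC jC; rewrite inE => /eqP tC; apply: class_fix; rewrite ?tC //.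
have [CT|[i]] := set_0Vmem (~: C z).
  have CT' : C z = setT by rewrite -[C z]setCK CT setC0.
  apply: (act_trivial hn) => a b t ab.
  have tT : C t = setT.
    by apply/eqP; rewrite eqEcard subsetT /= -CT' C_min.
  apply: fixed; rewrite ?tT ?CT' ?inE //.
  by rewrite cardsT card_ord; apply: leq_ltn_trans X_small'; rewrite max_card.
rewrite inE => iz.
have m_fix y a b : #|C y| = #|C z| -> a.1 != b.1 -> a.1 \in C y -> b.1 \in C y ->
    E a b y = y.
  move=> yz; apply: fixed => //.
  have [j jy] : exists j, j \in C y.
    by apply/card_gt0P; rewrite yz; apply: leq_trans cz; lia.
  have [k ky] : exists k, k \notin C y.
    apply: ord_notin; rewrite yz -[n in X in _ < X]card_ord -cardsT.
    by apply: proper_card; apply/properP; split; [exact: subsetT|exists i].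
  have jk : j != k by apply: contraNneq ky => <-.
  (* A quarter turn exchanging [j] and [k] carries [O] to points of a different class, so [O] is at
     most half of [X]: this gains the factor 2 between [2 ^ c0] and [2 ^ c0.-1]. *)
  pose O := [set t | C t == C y]; pose u : letter n := (j, false); pose v : letter n := (k, false).
  have dis : [disjoint O & W u v @: O].
    rewrite -setI_eq0; apply/eqP/setP => t; rewrite !inE; apply/negP => /andP[/eqP Ct].
    case/imsetP => t'; rewrite inE => /eqP Ct' e; move: Ct; rewrite e class_W // Ct' /=.
    move/setP/(_ k); rewrite (negPf ky) -{1}[k](tpermL j k) mem_imset ?jy //.
    exact: perm_inj.
  have h : #|O| + #|O| < 2 ^ c0.
    rewrite -{2}(card_imset (mem O) (@aW_inj _ _ act u v)).
    move: dis; rewrite -leq_card_setU => /eqP <-.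
    exact: leq_ltn_trans (max_card _) X_small.
  rewrite yz; apply: (@leq_trans (expn 2 c0.-1)); last by rewrite leq_exp2l //; lia.
  have c0E : c0 = c0.-1.+1 by lia.
  by rewrite c0E expnS mul2n addnn ltn_double in h.
have cM : #|i |: C z| = #|C z|.+1 by rewrite cardsU1 iz.
have iM : i \in i |: C z by rewrite setU11.
exfalso; apply: (@minimal_absurd _ C_min cz m_fix _ cM i z iM).
by rewrite setU1K.
Qed.

End LargeClasses.

Local Close Scope group_scope.
Local Open Scope nat_scope.

(** * Rank at least 5 *)

Section LightCharacters.
Variable n : nat.
Hypothesis hn : 2 < n.
Variables (X : finType) (act : leftAction (SAut n) X).
Implicit Types (a b c d u v : letter n) (U V J : {set 'I_n}) (x y : X).
Notation E := (aE act).
Notation F := (aF act).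
Notation W := (aW act).
Notation occ := (occ act).

Definition light x w : {set {set 'I_n}} := [set J | `[< occ x J >] & #|J| <= w].
Definition supp x w : {set 'I_n} := \bigcup_(J in light x w) J.

Lemma lightP x w J : reflect (occ x J /\ #|J| <= w) (J \in light x w).
Proof. by rewrite inE; apply: (iffP andP) => -[/asboolP]. Qed.

Lemma suppP x w i :
  reflect (exists J, [/\ occ x J, #|J| <= w & i \in J]) (i \in supp x w).
Proof.
apply: (iffP bigcupP) => [[J /lightP[xJ wJ] iJ]|[J [xJ wJ iJ]]]; first by exists J.
by exists J => //; apply/lightP.
Qed.

Lemma supp_class x w :
    (forall J, occ x J -> #|J| <= w \/ #|~: J| <= w) ->
  forall i j, i != j -> i \notin supp x w ->
  (j \notin supp x w) = (F [set i; j] x == x).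
Proof.
move=> H i j ij /suppP xi; apply/idP/idP => [/suppP xj|].
  apply: contraT => /(occ_sep hn (odd_set2 ij)) [J [xJ oJ]].
  have [wJ|wJ] := H J xJ; move: oJ; rewrite odd_pairI //.
    have [iJ|_] := boolP (i \in J); first by case: xi; exists J.
    by have [jJ|//] := boolP (j \in J); case: xj; exists J.
  have xJC := occC xJ.
  have [|iJ] := boolP (i \in J); last by case: xi; exists (~: J); rewrite inE iJ.
  have [//|jJ] := boolP (j \in J); case: xj; exists (~: J); rewrite inE jJ.
  by split.
apply: contraTN => /suppP[J [xJ wJ jJ]]; rewrite setUC.
by apply: (occ_pair xJ jJ); apply/negP => iJ; case: xi; exists J.
Qed.

(* Each element of the support lies in exactly half of the members of the
   group of light sets, and the empty set is one of them. *)
Lemma supp_card x w :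
    (forall J J', J \in light x w -> J' \in light x w -> #|symd J J'| <= w) ->
  #|supp x w| <= w.*2.-1.
Proof.
move=> H; set L := light x w; set S := supp x w.
have [->//|[i0 i0S]] := set_0Vmem S; first by rewrite cards0.
have LM J J' : J \in L -> J' \in L -> symd J J' \in L.
  move=> JL J'L; apply/lightP; split; last exact: H.
  by apply: occ_symd; [case/lightP: JL|case/lightP: J'L].
have L0 : set0 \in L by apply/lightP; rewrite cards0; split=> //; exact: occ0.
have half i : i \in S -> #|L| = (#|[set J in L | i \in J]|).*2.
  case/bigcupP => J0 J0L iJ0; rewrite -(cardsID [set J : {set 'I_n} | i \in J] L) -addnn.
  rewrite [L :&: _](_ : _ = [set J in L | i \in J]); last by apply/setP => J; rewrite !inE.
  have sI : injective (fun J => symd J J0) .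
    exact: (can_inj (g := fun J => symd J J0) (fun J => symdK J J0)).
  congr (_ + _); rewrite -[RHS](card_imset _ sI).
  apply: eq_card => J; rewrite [in LHS]inE; apply/andP/imsetP => [[iJ JL]|[J1]].
    exists (symd J J0); last by rewrite symdK.
    rewrite inE LM //= in_symd iJ0 addbT; by rewrite inE in iJ.
  by case/setIdP => J1L iJ1 ->; rewrite LM // in_set in_symd iJ1 iJ0.
have count : \sum_(J in L) #|J| = \sum_(i in S) #|[set J in L | i \in J]|.
  rewrite (eq_bigr (fun J : {set 'I_n} => \sum_(i in S) (i \in J))); last first.
    move=> J JL; rewrite -sum1_card big_mkcond [RHS]big_mkcond /=; apply: eq_bigr => i _.
    have [iJ|iJ] := boolP (i \in J); last by rewrite if_same.
    by rewrite (_ : i \in S) //; apply/bigcupP; exists J.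
  rewrite exchange_big; apply: eq_bigr => i iS.
  rewrite -sum1_card big_mkcond [RHS]big_mkcond; apply: eq_bigr => J _.
  by rewrite in_set; case: (J \in L); case: (i \in J).
have c2 : #|S| * #|L| = (\sum_(J in L) #|J|).*2.
  rewrite count -muln2 big_distrl -sum_nat_const; apply: eq_bigr => i iS.
  by rewrite /= (half i iS) muln2.
have c3 : \sum_(J in L) #|J| <= w * #|L :\ set0|.
  rewrite (big_setD1 set0) //= cards0 add0n mulnC -sum_nat_const.
  by apply: leq_sum => J; case/setD1P => _ /lightP[].
have := cardsD1 set0 L; rewrite L0.
have w0 : 0 < w.
  have /suppP[J [_ wJ iJ]] := i0S; apply: leq_trans wJ.
  by apply/card_gt0P; exists i0.
move: c2 c3; set A := #|L|; set B := #|L :\ set0|; set s := #|S|; set T := \sum_(J in L) _.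
move=> c2 c3 AB; rewrite leqNgt; apply/negP => sw.
have : w.*2 * A <= s * A by rewrite leq_mul2r; apply/orP; right; lia.
rewrite c2 AB; move: c3; nia.
Qed.

Lemma light_F x w U : ~~ odd #|U| -> light (F U x) w = light x w.
Proof.
move=> oU; apply/setP => J; apply/lightP/lightP => -[xJ wJ]; split=> //.
  by rewrite -[x](aFK act oU); exact: occF.
exact: occF.
Qed.

Lemma supp_F x w U : ~~ odd #|U| -> supp (F U x) w = supp x w.
Proof. by move=> oU; rewrite /supp light_F. Qed.

Lemma occW_iff x J u v : u.1 != v.1 -> occ (W u v x) (tperm u.1 v.1 @: J) <-> occ x J.
Proof.
move=> uv; split=> [H|]; last exact: occW.
have := occW hn uv H; rewrite imset_tpermK (aW2 hn) // => H'.
by rewrite -[x](aFK act (odd_set2 uv)); apply: occF => //; exact: odd_set2.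
Qed.

Lemma supp_W x w u v : u.1 != v.1 -> supp (W u v x) w = tperm u.1 v.1 @: supp x w.
Proof.
move=> uv; apply/setP => i; rewrite -{2}[i](tpermK u.1 v.1) mem_imset; last exact: perm_inj.
apply/suppP/suppP => -[J [xJ wJ iJ]]; exists (tperm u.1 v.1 @: J).
  rewrite card_imset ?mem_imset //; try exact: perm_inj.
  by split=> //; apply/(occW_iff _ _ uv); rewrite imset_tpermK.
rewrite card_imset; last exact: perm_inj.
split=> //; first exact/occW_iff.
by rewrite -[i](tpermK u.1 v.1) mem_imset //; exact: perm_inj.
Qed.

(** Each fibre of [inv] over [Z] contains some [y] together with the distinct point [F U y]. *)
Lemma double_card (T : finType) (inv : X -> T) (Z : {set T}) :
    (forall x U, ~~ odd #|U| -> inv (F U x) = inv x) ->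
    (forall z, z \in Z -> exists y U, [/\ ~~ odd #|U|, F U y != y & inv y = z]) ->
  (#|Z|).*2 <= #|X|.
Proof.
move=> HF HZ; have [x0 _|X0] := pickP (@predT X); last first.
  suff -> : Z = set0 by rewrite cards0.
  by apply/setP => z; rewrite inE; apply/negP => /HZ[y _]; have := X0 y.
have /choice[f fP] : forall z : T, exists yU : X * X,
    z \in Z -> [/\ yU.1 != yU.2, inv yU.1 = z & inv yU.2 = z].
  move=> z; have [zZ|zZ] := boolP (z \in Z); last first.
    by exists (x0, x0).
  have [y [U [oU Uy e]]] := HZ z zZ; exists (F U y, y) => _ /=.
  by rewrite HF.
pose h (p : T * bool) := if p.2 then (f p.1).1 else (f p.1).2.
have hI : {in setX Z [set: bool] &, injective h}.
  move=> [z1 b1] [z2 b2]; rewrite !inE !andbT /= => Z1 Z2.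
  have [n1 e1 e1'] := fP z1 Z1; have [n2 e2 e2'] := fP z2 Z2.
  move=> e; have z12 : z1 = z2.
    have := congr1 inv e; rewrite /h /=.
    by case: (b1); case: (b2); rewrite ?e1 ?e1' ?e2 ?e2'.
  move: e; rewrite /h /= z12; case: (b1); case: (b2) => // e.
    by rewrite e eqxx in n2.
  by rewrite -e eqxx in n2.
have -> : #|Z|.*2 = #|setX Z [set: bool]| by rewrite cardsX cardsT card_bool muln2.
by rewrite -(card_in_imset hI) max_card.
Qed.

Lemma double_supp x w : w < n -> supp x w != set0 ->
  ('C(n, #|supp x w|)).*2 <= #|X|.
Proof.
move=> wn S0; set k := #|_|; pose Z := [set S : {set 'I_n} | #|S| == k].
have cZ : #|Z| = 'C(n, k).
  rewrite -[in RHS](card_ord n) -cardsT -cards_draws.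
  by apply: eq_card => S; rewrite !inE subsetT.
rewrite -cZ; apply: (@double_card _ (supp^~ w)) => [y U oU|S].
  exact: supp_F.
rewrite inE => /eqP cS; have {}S0 : S != set0.
  by rewrite -card_gt0 cS card_gt0.
have [y yS] : exists y, supp y w = S.
  pose P S := exists y, supp y w = S.
  apply: (@swap_ind _ hn P _ (supp x w) S) => //; last by exists x.
  move=> i j S' ij [y <-]; exists (W (i, false) (j, false) y).
  exact: (@supp_W _ _ (i, false) (j, false)).
have /set0Pn[i] := S0; rewrite -yS => /suppP[J [yJ wJ iJ]].
have [j jJ] := ord_notin (leq_ltn_trans wJ wn).
have ij : i != j by apply: contraNneq jJ => <-.
exists y, [set i; j]; split=> //; first exact: odd_set2.
exact: (occ_pair yJ).
Qed.

(** Twice the bound of [occ_card], at the price that each point carries at most one member of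
    [Js]. *)
Lemma double_occ (Js : {set {set 'I_n}}) :
    (forall J, J \in Js -> exists x, occ x J) ->
    (forall J, J \in Js -> J != set0 /\ J != setT) ->
    (forall x J J', J \in Js -> J' \in Js -> occ x J -> occ x J' -> J = J') ->
  (#|Js|).*2 <= #|X|.
Proof.
move=> HJ J0 HU; pose inv x := [set J in Js | `[< occ x J >]].
have <- : #|[set [set J] | J in Js]| = #|Js| by apply: card_imset; exact: set1_inj.
apply: (@double_card _ inv) => [x U oU|z].
  apply/setP => J; rewrite !inE; congr (_ && _); apply: asbool_equiv_eq.
  by split=> [H|]; [rewrite -[x](aFK act oU)|]; exact: occF.
case/imsetP => J JJs ->; have [y yJ] := HJ J JJs; have [Jn0 JnT] := J0 J JJs.
have /set0Pn[i iJ] := Jn0.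
have [j jJ] : exists j, j \notin J.
  by apply/existsP; rewrite -negb_forall; apply: contra JnT => /forallP h;
    apply/eqP/setP => k; rewrite h inE.
have ij : i != j by apply: contraNneq jJ => <-.
exists y, [set i; j]; split; [exact: odd_set2|exact: (occ_pair yJ)|].
apply/setP => J'; rewrite !inE; apply/andP/eqP => [[J'Js /asboolP yJ']|->].
  exact: (HU y).
by split=> //; apply/asboolP.
Qed.

(** The first two inequalities on [s] are [c0_large] and [c0_gt3] for [c0 = n - s]. *)
Lemma light_trivial w s :
    (forall x J, occ x J -> #|J| <= w \/ #|~: J| <= w) ->
    (forall x, #|supp x w| <= s) ->
    s.*2 + 3 <= n -> s + 4 <= n -> #|X| < 2 ^ (n - s) -> #|X| < 2 ^ n.-1 ->
  forall g x, act g x = x.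
Proof.
move=> H1 H2 s1 s2 X1 X2 g x.
apply: (@large_classes_trivial _ hn _ act (fun x => ~: supp x w) (n - s)) => //; try lia.
- move=> y i j ij; rewrite !inE; apply: supp_class => //.
  exact: H1.
- by move=> y; rewrite cardsCs setCK card_ord leq_sub2l.
Qed.

Lemma card_size_sets k : #|[set S : {set 'I_n} | #|S| == k]| = 'C(n, k).
Proof.
rewrite -[in RHS](card_ord n) -cardsT -cards_draws.
by apply: eq_card => S; rewrite !inE subsetT.
Qed.

Lemma card_size_sets_avoiding (i : 'I_n) k :
  #|[set S : {set 'I_n} | (i \notin S) && (#|S| == k)]| = 'C(n.-1, k).
Proof.
have -> : n.-1 = #|~: [set i]| by rewrite cardsCs setCK card_ord cards1 subn1.
rewrite -cards_draws; apply: eq_card => S; rewrite !inE.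
by rewrite subsetC sub1set inE.
Qed.

Lemma occ_size_card x J : occ x J -> (#|J|).*2 != n -> 'C(n, #|J|) <= #|X|.
Proof.
move=> xJ Jn; rewrite -card_size_sets; apply: (@occ_card _ _ act) => [J'|J1 J2].
  by rewrite inE => /eqP e; apply: (occ_size hn xJ).
rewrite !inE => /eqP e1 /eqP e2 _; apply: contraNneq Jn => e.
have := congr1 (fun S : {set 'I_n} => #|S|) e.
rewrite /= [#|~: J2|]cardsCs setCK card_ord e1 e2 => h.
have h' : #|J| <= n by rewrite -e2 -[n in _ <= n]card_ord max_card.
have arith p : p = n - p -> p <= n -> p.*2 = n by lia.
exact/eqP/arith.
Qed.

(** Sets avoiding a fixed index include no complementary pair, so this also covers sets of half
    size. *)
Lemma occ_half_card x J : occ x J -> 'C(n.-1, #|J|) <= #|X|.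
Proof.
have i0 : 'I_n by exact: (Ordinal (ltn_trans (isT : 0 < 2) hn)).
move=> xJ; rewrite -(card_size_sets_avoiding i0).
apply: (@occ_card _ _ act) => [J'|J1 J2].
  by rewrite inE => /andP[_ /eqP e]; apply: (occ_size hn xJ).
rewrite !inE => /andP[h1 _] /andP[h2 _] _; apply: contraNneq h1 => ->.
by rewrite inE.
Qed.

Lemma bin_incr k : k.*2 < n -> 'C(n, k) <= 'C(n, k.+1).
Proof.
move=> h; rewrite -(leq_pmul2l (ltn0Sn k)) mul_bin_left leq_mul2r.
by apply/orP; right; lia.
Qed.

Lemma bin_half_mono k l : k <= l -> l.*2 <= n.+1 -> 'C(n, k) <= 'C(n, l).
Proof.
elim: l => [|l IH]; first by rewrite leqn0 => /eqP ->.
rewrite leq_eqVlt => /orP[/eqP -> //|kl] h.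
by apply: leq_trans (IH _ _) (bin_incr _); lia.
Qed.

Lemma bin_mono k l : k <= l -> l <= n - k -> 'C(n, k) <= 'C(n, l).
Proof.
move=> kl lk; have [h|h] := leqP l.*2 n.+1; first exact: bin_half_mono.
rewrite -[X in _ <= X]bin_sub; last by lia.
by apply: bin_half_mono; lia.
Qed.

(** Fewer than [C(n, r)] points exclude occurring sets of size between [r] and [n - r]. The
    condition [3 * r + 2 <= n] says that [C(n, r + 1)] is at least twice [C(n, r)], which pays for
    the factor 2 lost on sets of half size. *)
Lemma few_points_trivial r : 4 < n -> 0 < r -> 3 * r + 2 <= n ->
    #|X| < 'C(n, r) -> #|X| < 2 ^ (n - r) ->
  forall g x, act g x = x.
Proof.
move=> n4 r0 rn X1 X2.
have half k : k.*2 = n -> ('C(n, r) <= 'C(n.-1, k)).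
  move=> kn; have h1 : 'C(n, k) = ('C(n.-1, k)).*2.
    have e1 : n = n.-1.+1 by lia.
    have e2 : k = k.-1.+1 by lia.
    rewrite {1}e1 {1}e2 binS -addnn -e2; congr (_ + _).
    rewrite -(@bin_sub n.-1 k.-1); last by lia.
    by congr 'C(_, _); lia.
  have h2 : ('C(n, r)).*2 <= 'C(n, r.+1).
    rewrite -(leq_pmul2l (ltn0Sn r)) mul_bin_left -muln2 mulnCA mulnC leq_mul2r.
    by apply/orP; right; lia.
  have h3 : 'C(n, r.+1) <= 'C(n, k) by apply: bin_half_mono; lia.
  by rewrite -leq_double -h1; apply: leq_trans h3.
have H1 x J : occ x J -> #|J| <= r.-1 \/ #|~: J| <= r.-1.
  move=> xJ; have [|hJ] := leqP #|J| r.-1; [by left|right].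
  rewrite leqNgt; apply/negP => hJ'; move: X1; rewrite ltnNge => /negP; apply.
  have cJ : #|~: J| = n - #|J| by rewrite cardsCs setCK card_ord.
  have [Jn|Jn] := eqVneq (#|J|).*2 n.
    by apply: leq_trans (half _ Jn) (occ_half_card xJ).
  by apply: leq_trans (occ_size_card xJ Jn); apply: bin_mono; lia.
have H2 x : #|supp x r.-1| <= r.-1.
  have c : #|supp x r.-1| <= (r.-1).*2.-1.
    apply: supp_card => J J' /lightP[xJ wJ] /lightP[xJ' wJ'].
    have := card_symd J J'; have [//|] := H1 _ _ (occ_symd xJ xJ').
    by rewrite cardsCs setCK card_ord; lia.
  have [->|S0] := eqVneq (supp x r.-1) set0; first by rewrite cards0.
  have wn : r.-1 < n by lia.
  have D := double_supp wn S0; rewrite leqNgt; apply/negP => lt.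
  have : 'C(n, r) <= 'C(n, #|supp x r.-1|).
    have arith p : r.-1 < p -> p <= r.-1.*2.-1 -> r <= p /\ p <= n - r by lia.
    by have [] := arith _ lt c; exact: bin_mono.
  move: D X1; lia.
move=> g x; apply: (@light_trivial r.-1 r.-1) => //; try lia.
- by apply: leq_trans X2 _; rewrite leq_exp2l //; lia.
- by apply: leq_trans X2 _; rewrite leq_exp2l //; lia.
Qed.

End LightCharacters.

Lemma card_setC_ord n (J : {set 'I_n}) : #|~: J| = n - #|J|.
Proof. by rewrite cardsCs setCK card_ord. Qed.

Lemma card_set_ord n (J : {set 'I_n}) : #|J| <= n.
Proof. by rewrite -[n in _ <= n]card_ord max_card. Qed.

Lemma all_occ_card n (X : finType) (act : leftAction (SAut n) X) : 2 < n ->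
  (forall J, exists x, occ act x J) -> 2 ^ n.-1 <= #|X|.
Proof.
move=> hn H; have i0 : 'I_n by exact: (Ordinal (ltn_trans (isT : 0 < 2) hn)).
have <- : #|~: [set i0]| = n.-1 by rewrite card_setC_ord cards1 subn1.
rewrite -card_powerset; apply: (@occ_card _ _ act) => [J _|J J']; first exact: H.
rewrite !powersetE => /subsetP s1 /subsetP s2 _; apply/eqP => e.
have : i0 \in J by rewrite e inE; apply/negP => /s2; rewrite !inE eqxx.
by move=> /s1; rewrite !inE eqxx.
Qed.

Lemma trivial5 (X : finType) (act : leftAction (SAut 5) X) : #|X| < 12 ->
  forall g x, act g x = x.
Proof.
move=> hX; have hn : 2 < 5 by [].
have [[x [J [xJ J2]]]|no2] := pselect (exists x J, occ act x J /\ #|J| = 2).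
  (* If sizes 1 and 2 both occurred, somewhere in [X], then all 16 characters would. *)
  exfalso; have no14 y J' : occ act y J' -> #|J'| <> 1 /\ #|J'| <> 4.
    suff no1 K : occ act y K -> #|K| <> 1.
      move=> yJ'; split=> [|J4]; first exact: no1.
      by apply: (no1 _ (occC yJ')); rewrite card_setC_ord J4.
    move=> yK K1; suff : 16 <= #|X| by rewrite leqNgt (leq_trans hX).
    apply: (@all_occ_card 5 _ act hn) => L; have := card_set_ord L.
    have Cc t (S S' : {set 'I_5}) : occ act t S -> #|~: S| = #|S'| -> exists z, occ act z S'.
      by move=> tS; apply: occ_size => //; exact: (occC tS).
    case E : #|L| => [|[|[|[|[|[|//]]]]]] _.
    - by apply: (occ_size hn (occ0 act x)); rewrite cards0 E.
    - by apply: (occ_size hn yK); rewrite K1 E.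
    - by apply: (occ_size hn xJ); rewrite J2 E.
    - by apply: (Cc _ _ _ xJ); rewrite card_setC_ord J2 E.
    - by apply: (Cc _ _ _ yK); rewrite card_setC_ord K1 E.
    - by apply: (Cc _ _ _ (occ0 act x)); rewrite card_setC_ord cards0 E.
  have sup : #|supp act x 2| <= 3.
    apply: (@supp_card _ hn _ act x 2) => K L /lightP[xK wK] /lightP[xL wL].
    have [h1 _] := no14 _ _ xK; have [h2 _] := no14 _ _ xL.
    have [_ h3] := no14 _ _ (occ_symd xK xL); have := card_symd K L.
    by move: h1 h2 h3 wK wL; lia.
  have Js : J \subset supp act x 2.
    by apply/subsetP => i iJ; apply/suppP; exists J; rewrite J2.
  have := subset_leq_card Js; rewrite J2 => sup'.
  have S0 : supp act x 2 != set0 by rewrite -card_gt0; apply: ltn_trans sup'.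
  (* The support has size 2 or 3, and either gives 20 points. *)
  have : ('C(5, #|supp act x 2|)).*2 <= #|X| by apply: double_supp S0.
  move: sup sup'; case: #|supp act x 2| => [|[|[|[|//]]]] // _ _ h.
    by have := leq_ltn_trans h hX.
  by have := leq_ltn_trans h hX.
have sizes y J : occ act y J -> #|J| <> 2 /\ #|J| <> 3.
  move=> yJ; split=> Jk; apply: no2; first by exists y, J.
  by exists y, (~: J); rewrite card_setC_ord Jk; split=> //; exact: occC.
apply: (@light_trivial _ hn _ act 1 1) => //.
- move=> y J yJ; have [h2 h3] := sizes _ _ yJ; have := card_set_ord J.
  by rewrite card_setC_ord; lia.
- move=> y; apply: (@supp_card _ hn _ act y 1) => K L /lightP[yK wK] /lightP[yL wL].
  have [h _] := sizes _ _ (occ_symd yK yL); have := card_symd K L; lia.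
- exact: leq_trans hX _.
- exact: leq_trans hX _.
Qed.

Lemma trivial6 (X : finType) (act : leftAction (SAut 6) X) : #|X| < 14 ->
  forall g x, act g x = x.
Proof.
move=> hX; have hn : 2 < 6 by [].
have no2 y J : occ act y J -> #|J| <> 2.
  move=> yJ J2; have := occ_size_card hn yJ; rewrite J2 => /(_ isT) h.
  by have := leq_ltn_trans h hX.
have no4 y J : occ act y J -> #|J| <> 4.
  by move=> yJ J4; apply: (no2 _ _ (occC yJ)); rewrite card_setC_ord J4.
have no3 y J : occ act y J -> #|J| <> 3.
  move=> yJ J3; have i0 : 'I_6 by exact: ord0.
  suff : 20 <= #|X| by rewrite leqNgt (leq_trans hX).
  (* Two distinct such sets occurring at one point would differ by an occurring set of size 2 or 4,
     already excluded; so the ten sets count double. *)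
  have <- : #|[set S : {set 'I_6} | (i0 \notin S) && (#|S| == 3)]|.*2 = 20.
    by rewrite card_size_sets_avoiding.
  apply: (@double_occ _ _ act) => [K|K|x K L].
  - by rewrite inE => /andP[_ /eqP K3]; apply: (occ_size hn yJ); rewrite J3 K3.
  - rewrite inE => /andP[iK /eqP K3]; split; first by rewrite -card_gt0 K3.
    by apply: contraNneq iK => ->; rewrite inE.
  rewrite !inE => /andP[iK /eqP K3] /andP[iL /eqP L3] xK xL.
  have xS := occ_symd xK xL; have := card_symd K L.
  have := no2 _ _ xS; have := no4 _ _ xS.
  have lt6 : #|symd K L| < 6.
    apply: (@leq_trans #|[set: 'I_6]|); last by rewrite cardsT card_ord.
    apply: proper_card; apply/properP; split; first exact: subsetT.
    by exists i0; rewrite ?in_symd ?(negPf iK) ?(negPf iL).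
  rewrite K3 L3 => h4 h2 cS; apply/eqP; rewrite -symd_eq0 -cards_eq0.
  by apply/eqP; move: h4 h2 cS lt6; lia.
apply: (@light_trivial _ hn _ act 1 1) => //.
- move=> y J yJ; have := no2 _ _ yJ; have := no3 _ _ yJ; have := no4 _ _ yJ.
  by have := card_set_ord J; rewrite card_setC_ord; lia.
- move=> y; apply: (@supp_card _ hn _ act y 1) => K L /lightP[yK wK] /lightP[yL wL].
  have := no2 _ _ (occ_symd yK yL); have := card_symd K L; lia.
- exact: leq_trans hX _.
- exact: leq_trans hX _.
Qed.

(** From [q] to [q + 1] the left side is multiplied by 4 and the right side by
    [(m+3)(m+2)(m+1) / ((q+1)(m-q+1)(m-q+2))], which tends to [27/4] and is at least 4. The
    inequality fails at [q = 4], [t = 2], where [2048 > 1820]. *)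
Lemma bin_third_large q t : 4 < q -> t < 3 ->
  2 ^ (2 * q + 1 + t) <= 'C(3 * q + 2 + t, q).
Proof.
elim: q => // q IH; rewrite ltnS leq_eqVlt => /orP[/eqP <- {IH}|q4] t3.
  by case: t t3 => [|[|[|//]]] _; vm_compute.
have {}IH := IH q4 t3; set m := 3 * q + 2 + t in IH *.
have -> : 3 * q.+1 + 2 + t = m.+3 by rewrite /m; lia.
have -> : 2 * q.+1 + 1 + t = (2 * q + 1 + t).+2 by lia.
rewrite !expnS mulnA -[2 * 2]/4.
have mE : m - q = (2 * q + 2 + t) by rewrite /m; lia.
have E : q.+1 * (m - q).+1 * (m - q).+2 * 'C(m.+3, q.+1) =
         m.+3 * m.+2 * m.+1 * 'C(m, q).
  have qm : q <= m by rewrite /m; lia.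
  have e1 : q.+1 * 'C(m.+3, q.+1) = m.+3 * 'C(m.+2, q) by rewrite mul_bin_diag.
  have e2 k : q <= k -> (k - q).+1 * 'C(k.+1, q) = k.+1 * 'C(k, q).
    by move=> qk; rewrite -subSn // mul_bin_down.
  have e3 := e2 m qm; have e4 := e2 m.+1 (leqW qm); rewrite subSn // in e4.
  rewrite (_ : _ * 'C(m.+3, q.+1) = (m - q).+1 * (m - q).+2 * (q.+1 * 'C(m.+3, q.+1))).
    rewrite e1 (_ : _ * (m.+3 * _) = m.+3 * (m - q).+1 * ((m - q).+2 * 'C(m.+2, q))).
      rewrite e4 (_ : _ * (m.+2 * _) = m.+3 * m.+2 * ((m - q).+1 * 'C(m.+1, q))).
        by rewrite e3 mulnA.
      by ring.
    by ring.
  by ring.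
have h : 4 * (q.+1 * (m - q).+1 * (m - q).+2) <= m.+3 * m.+2 * m.+1.
  rewrite mE -(leq_pmul2l (isT : 0 < 3)).
  have h1 : 3 * q.+1 <= m.+1 by rewrite /m; lia.
  have h2 : 4 * (2 * q + 2 + t).+1 <= 3 * m.+3 by rewrite /m; lia.
  have h3 : (2 * q + 2 + t).+2 <= m.+2 by rewrite /m; lia.
  have L := leq_mul h1 (leq_mul h2 h3).
  have e k l r s : k = l -> r = s -> l <= s -> k <= r by move=> -> ->.
  by apply: e L; ring.
apply: leq_trans (_ : 4 * 'C(m, q) <= _); first by rewrite leq_mul2l.
have K0 : 0 < q.+1 * (m - q).+1 * (m - q).+2 by rewrite !muln_gt0.
by rewrite -(leq_pmul2l K0) E (mulnCA _ 4) mulnA leq_mul2r h orbT.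
Qed.

Lemma trivial_large n (X : finType) (act : leftAction (SAut n) X) r : 6 < n ->
    2 * (r + 3) <= n -> #|X| < 2 ^ (n - r - p_of n) -> #|X| < 'C(n, r) ->
  forall g x, act g x = x.
Proof.
move=> hn rn X2 XC g x; have hn' : 2 < n by lia.
have n4 : 4 < n by lia.
have X0 : 0 < #|X| by apply/card_gt0P; exists x.
have r0 : 0 < r by case: r XC {rn X2} => //; rewrite bin0 ltnNge X0.
have [rn'|nr] := leqP (3 * r + 2) n.
  apply: (few_points_trivial hn' act n4 r0 rn' XC); apply: leq_trans X2 _.
  by rewrite leq_exp2l // leq_subr.
(* [q] is the largest value admissible for [few_points_trivial]; as [q < r], the power of 2 bounding
   [#|X|] lies below both bounds required for [q]. *)
pose q := (n - 2) %/ 3; have nE : n = 3 * q + 2 + (n - 2) %% 3.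
  by have := divn_eq (n - 2) 3; rewrite -/q; lia.
have t3 : (n - 2) %% 3 < 3 by rewrite ltn_mod.
set t := (n - 2) %% 3 in nE t3.
have qr : q < r by lia.
have q0 : 0 < q by lia.
have rn' : 3 * q + 2 <= n by lia.
apply: (few_points_trivial hn' act n4 q0 rn'); last first.
  by apply: leq_trans X2 _; rewrite leq_exp2l //; lia.
apply: leq_trans X2 _; have [q4|q4] := ltnP 4 q.
  rewrite [X in 'C(X, _)]nE; apply: leq_trans (bin_third_large q4 t3).
  by rewrite leq_exp2l //; lia.
(* With [q <= 4], the inequalities [q < r] and [2 * (r + 3) <= n] leave only [n = 16] and [r = 5];
   there [p_of 16 = 1] gives [2 ^ 10 <= C(16, 4) = 1820]. *)
have n16 : n = 16 by lia.
have q4' : q = 4 by lia.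
rewrite q4' n16 /p_of /=; apply: (@leq_trans (2 ^ 10)); last by vm_compute.
by rewrite leq_exp2l //; lia.
Qed.

(** * Rank 4 *)

Section CommutingInvolutions.
Local Open Scope group_scope.
Variable X : finType.

Lemma leq_sqr_exp2 k : k != 3 -> (k * k <= 2 ^ k)%N.
Proof.
have H m : 3 < m -> (m * m <= 2 ^ m)%N.
  elim: m => // m IH; rewrite ltnS leq_eqVlt => /orP[/eqP <- //|m3].
  by rewrite expnS; have := IH m3; nia.
by case: k => [|[|[|[|k]]]] // _; apply: H.
Qed.

(** The stabiliser of [x] in the abelian group [A] fixes the whole orbit, so induction applies to it
    off that orbit. The orbit has 2-power size, which avoids the exception [k = 3] of
    [leq_sqr_exp2]. *)
Lemma abelem_perm_card (S : {set X}) (A : {group {perm X}}) : 2.-abelem A ->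
  (forall s, s \in A -> perm_on S s) -> (#|A| * #|A| <= 2 ^ #|S|)%N.
Proof.
have [m] := ubnP #|S|; elim: m S A => // m IH S A; rewrite ltnS => hm abA onS.
have [A1|] := eqVneq A 1%G; first by rewrite A1 cards1 expn_gt0.
case/trivgPn => s sA s1; have [x sx] : exists x, s x != x.
  apply/existsP; rewrite -negb_forall; apply: contra s1 => /forallP h.
  by apply/eqP/permP => y; rewrite perm1; apply/eqP.
have xS : x \in S by apply: (subsetP (onS s sA)); rewrite inE.
pose O := orbit 'P A x; pose K := ('C_A[x | 'P])%G.
have OK : (#|O| * #|K| = #|A|)%N := card_orbit_stab 'P A x.
have cAA : abelian A by apply: abelem_abelian abA.
have KA : K \subset A by rewrite subsetIl.
have OS : O \subset S.
  apply/subsetP => y /orbitP[g gA <-]; rewrite /= /aperm.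
  by rewrite (perm_closed _ (onS g gA)).
have K_on k : k \in K -> perm_on (S :\: O) k.
  move=> kK; have kA := subsetP KA k kK.
  apply/subsetP => y; rewrite inE => ky.
  have yS : y \in S by apply: (subsetP (onS k kA)); rewrite inE.
  rewrite inE yS andbT; apply: contra ky => /orbitP[g gA <-] /=.
  rewrite /aperm -permM -(centsP cAA _ kA _ gA) permM.
  by move: kK; rewrite inE => /andP[_ /astab1P]; rewrite /= /aperm => ->.
have O3 : #|O| != 3.
  have : 2.-nat #|O| by apply: pnat_dvd (abelem_pgroup abA); rewrite -OK dvdn_mulr.
  by apply: contraTneq => ->.
have cS : (#|O| + #|S :\: O| = #|S|)%N by rewrite -(cardsID O S) (setIidPr OS).
have O0 : (0 < #|O|)%N by apply/card_gt0P; exists x; exact: orbit_refl.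
have IHK : (#|K| * #|K| <= 2 ^ #|S :\: O|)%N.
  apply: IH => //; first by apply: leq_trans hm; move: cS O0; lia.
  exact: abelemS KA abA.
by rewrite -OK mulnACA -cS expnD leq_mul // leq_sqr_exp2.
Qed.

(** Otherwise the [2 ^ d] products would be distinct elements of an elementary abelian group,
    against [abelem_perm_card]. *)
Lemma commuting_involutions d (p : 'I_d -> {perm X}) :
    (forall i j, commute (p i) (p j)) -> (forall i, p i * p i = 1) ->
    (#|X| < d.*2)%N ->
  exists2 c : {ffun 'I_d -> bool}, exists i, c i & \prod_i p i ^+ c i = 1.
Proof.
move=> pC pp Xd; apply: contrapT => H.
pose phi (c : {ffun 'I_d -> bool}) := \prod_i p i ^+ c i.
have phiM c c' : phi c * phi c' = phi [ffun i => c i (+) c' i].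
  rewrite /phi -prodgM_commute; last first.
    by move=> i j *; exact: (commuteX2 _ _ (pC _ _)).
  apply: eq_bigr => i _; rewrite ffunE.
  by case: (c i); case: (c' i); rewrite /= ?expg1 ?expg0 ?mulg1 ?mul1g.
have phiI : injective phi.
  move=> c c' cc'; apply/ffunP => i; apply/eqP; apply: contraT => ci; case: H.
  exists [ffun i => c i (+) c' i].
    by exists i; rewrite ffunE; case: (c i) (c' i) ci => [] [].
  rewrite -/(phi _) -phiM cc' phiM; apply: big1 => j _.
  by rewrite ffunE addbb.
pose A := <<[set p i | i : 'I_d]>>%G.
have abA : 2.-abelem A.
  apply/abelemP => //; split.
    rewrite abelian_gen; apply/centsP => _ /imsetP[i _ ->] _ /imsetP[j _ ->].
    exact: pC.
  have cA : abelian A.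
    by rewrite abelian_gen; apply/centsP => _ /imsetP[i _ ->] _ /imsetP[j _ ->]; exact: pC.
  have g2 : group_set [set t in A | t ^+ 2 == 1].
    apply/group_setP; split; first by rewrite inE group1 expg1n eqxx.
    move=> t t'; rewrite !inE => /andP[tA /eqP t2] /andP[t'A /eqP t'2].
    have tt' : commute t t' := centsP cA _ tA _ t'A.
    by rewrite groupM // expgMn // t2 t'2 mulg1 eqxx.
  have /subsetP As : A \subset Group g2.
    rewrite gen_subG; apply/subsetP => _ /imsetP[i _ ->].
    rewrite inE expg2 pp eqxx andbT.
    by apply: mem_gen; apply/imsetP; exists i.
  by move=> s /As; rewrite inE => /andP[_ /eqP].
have : (#|A| * #|A| <= 2 ^ #|X|)%N.
  rewrite -cardsT; apply: abelem_perm_card => // s _.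
  by apply/subsetP => y; rewrite inE.
apply/negP; rewrite -ltnNge; apply: leq_trans (_ : 2 ^ d.*2 <= _)%N.
  by rewrite ltn_exp2l.
rewrite -addnn expnD; have : (2 ^ d <= #|A|)%N.
  rewrite -[d in (2 ^ d)%N]card_ord -card_bool -card_ffun -(card_imset _ phiI).
  apply: subset_leq_card; apply/subsetP => _ /imsetP[c _ ->].
  apply: group_prod => i _; apply: groupX; apply: mem_gen.
  by apply/imsetP; exists i.
by move=> h; exact: leq_mul.
Qed.

End CommutingInvolutions.

Local Close Scope group_scope.

Section NormalClosure.
Variable n : nat.
Hypothesis hn : 2 < n.
Variables (X : Type) (act : leftAction (SAut n) X).
Notation E := (aE act).
Notation F := (aF act).
Notation W := (aW act).

Lemma aW_surj u v x : u.1 != v.1 -> exists y, W u v y = x.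
Proof.
move=> uv; exists (W u v (F [set u.1; v.1] x)).
by rewrite (aW2 hn) // (aFK _ (odd_set2 uv)).
Qed.

Lemma one_tv_trivial (a c : letter n) : a.1 != c.1 -> (forall x, E a c x = x) ->
  forall a' c' x, a'.1 != c'.1 -> E a' c' x = x.
Proof.
move=> ac Eac a' c' x ac'.
pose P (b d : letter n) := b.1 != d.1 /\ forall x, E b d x = x.
have PW u v b d : u.1 != v.1 -> P b d -> P (wl u v b) (wl u v d).
  move=> uv [bd Pbd]; split; first by rewrite (letter_aut_eq1 (wxE uv)).
  move=> y; have [z <-] := aW_surj y uv.
  by rewrite -(aW_E hn) // Pbd.
have PV b d : P b d -> P b (letter_inv d).
  by move=> [bd Pbd]; split=> // y; rewrite -{1}(Pbd y) (aEK hn).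
have [c1 Pc1] : exists c1, P a' c1.
  (* Passing through a further index [k] also covers the case where [a] and [a'] share their
     index. *)
  have [k] : exists k, k \notin [set a.1; a'.1].
    by apply: ord_notin; rewrite cards2; apply: leq_ltn_trans hn; case: eqP.
  rewrite !inE negb_or => /andP[ka ka']; pose u : letter n := (k, false).
  have au : a.1 != u.1 by rewrite eq_sym.
  have := @PW u a' _ _ ka' (@PW a u a c au (conj ac Eac)).
  by rewrite wl_u wl_u; exists (wl u a' (wl a u c)).
suff [_ h] : P a' c' by exact: h.
have [/eqP|cc] := eqVneq c1.1 c'.1.
  rewrite eq_letter1 => /orP[] /eqP e; rewrite e in Pc1; first by [].
  by rewrite -[c']letter_invK; exact: PV.
have := PW c1 c' a' c1 cc Pc1; rewrite wl_u wl_out //.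
by case: Pc1.
Qed.

(* If left and right transvections agree, [E b c] commutes with every
   transvection from [b] to [a]. *)
Lemma swapped_tv_trivial (a b c u v : letter n) :
    a.1 != b.1 -> a.1 != c.1 -> b.1 != c.1 -> u.1 = b.1 -> v.1 = a.1 ->
    (forall d e x, d.1 != e.1 -> E (letter_inv d) (letter_inv e) x = E d e x) ->
    (forall x, E a b x = E u v x) ->
  forall x, E a c x = x.
Proof.
move=> ab ac bc ub va EV Euv x.
have ba : b.1 != a.1 by rewrite eq_sym.
have cb : c.1 != b.1 by rewrite eq_sym.
have uc : u.1 != c.1 by rewrite ub.
have uv : u.1 != v.1 by rewrite ub va.
have bv : b.1 != v.1 by rewrite va.
have comm y : E b c (E u v y) = E u v (E b c y).
  have [e|ne] := eqVneq b u; last exact: aE_comm.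
  rewrite -!(EV u v) //; apply: aE_comm => //.
  by rewrite e eq_sym letter_inv_neq.
have [y <-] : exists y, E b c y = x by exists (E b (letter_inv c) x); rewrite (aEVK hn).
apply: (@aE_inj _ _ act a b).
by rewrite -(aE_rel hn) // Euv comm.
Qed.

End NormalClosure.

Section Four.
Variables (X : finType) (act : leftAction (SAut 4) X).
Hypothesis hX : #|X| < 8.
Notation E := (aE act).
Notation F := (aF act).
Notation W := (aW act).
Notation occ := (occ act).

Let hn : 2 < 4 := isT.

(** If sizes 1 and 2 both occurred, all eight characters would. If only size 1 does, no point
    carries two singletons, as they differ by a set of size 2, and [double_occ] yields [2 * 4]
    points. *)
Lemma four_even y J : occ y J -> #|J| <> 1 /\ #|J| <> 3.
Proof.
suff no1 z K : occ z K -> #|K| <> 1.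
  move=> yJ; split; first exact: no1 yJ.
  by move=> J3; apply: (no1 _ _ (occC yJ)); rewrite card_setC_ord J3.
move=> zK K1.
have Cc t (S S' : {set 'I_4}) : occ t S -> #|~: S| = #|S'| -> exists z, occ z S'.
  by move=> tS; apply: occ_size => //; exact: (occC tS).
have no2 t L : occ t L -> #|L| <> 2.
  move=> tL L2; suff : 8 <= #|X| by rewrite leqNgt hX.
  apply: (@all_occ_card 4 _ act hn) => M; have := card_set_ord M.
  case EM : #|M| => [|[|[|[|[|//]]]]] _.
  - by apply: (occ_size hn (occ0 act z)); rewrite cards0 EM.
  - by apply: (occ_size hn zK); rewrite K1 EM.
  - by apply: (occ_size hn tL); rewrite L2 EM.
  - by apply: (Cc _ _ _ zK); rewrite card_setC_ord K1 EM.
  - by apply: (Cc _ _ _ (occ0 act z)); rewrite card_setC_ord cards0 EM.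
suff : 8 <= #|X| by rewrite leqNgt hX.
have <- : #|[set S : {set 'I_4} | #|S| == 1]|.*2 = 8 by rewrite card_size_sets.
apply: (@double_occ _ _ act) => [L|L|x L M].
- by rewrite inE => /eqP L1; apply: (occ_size hn zK); rewrite K1 L1.
- rewrite inE => /eqP L1; split; first by rewrite -card_gt0 L1.
  by apply: contra_eq_neq L1 => ->; rewrite cardsT card_ord.
rewrite !inE => /eqP L1 /eqP M1 xL xM.
have := no2 _ _ (occ_symd xL xM); have := card_symd L M; rewrite L1 M1 => cS n2.
by apply/eqP; rewrite -symd_eq0 -cards_eq0; apply/eqP; move: cS n2; lia.
Qed.

Lemma four_flipT y : F setT y = y.
Proof.
have oT : ~~ odd #|[set: 'I_4]| by rewrite cardsT card_ord.
apply/eqP; apply: contraT => /(occ_sep hn oT)[J [yJ]]; rewrite setTI.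
have [n1 n3] := four_even yJ; have := card_set_ord J.
by move: n1 n3; case: #|J| => [|[|[|[|[|//]]]]].
Qed.

Lemma four_tvV (a b : letter 4) y : a.1 != b.1 ->
  E (letter_inv a) (letter_inv b) y = E a b y.
Proof.
move=> ab; have oT : ~~ odd #|[set: 'I_4]| by rewrite cardsT card_ord.
have := aF_E hn act y oT ab; rewrite !four_flipT !flip_letter_in ?inE //.
Qed.

Let o0 : 'I_4 := @Ordinal 4 0 isT.
Let o1 : 'I_4 := @Ordinal 4 1 isT.
Let o2 : 'I_4 := @Ordinal 4 2 isT.
Let o3 : 'I_4 := @Ordinal 4 3 isT.
Let l i : letter 4 := (i, false).

Lemma four_flips : (exists i j, i != j /\ forall x, F [set i; j] x = x) ->
  forall i j x, i != j -> F [set i; j] x = x.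
Proof.
move=> [i0 [j0 [ij0 F0]]] i j x ij.
pose P (S : {set 'I_4}) := ~~ odd #|S| /\ forall x, F S x = x.
suff [_ h] : P [set i; j] by exact: h.
apply: (@swap_ind _ hn P _ [set i0; j0]); last by split=> //; exact: odd_set2.
  move=> k m S km [eS PS]; split=> [|y]; first by rewrite odd_tperm.
  have [z <-] := @aW_surj _ hn _ act (l k) (l m) y km.
  by rewrite -(aW_F hn act z (u := l k) (v := l m) km eS) PS.
by rewrite !cards2 ij ij0.
Qed.

Lemma four_letter_eq (g h : SAut 4) f f' :
    letter_aut (val g) f -> letter_aut (val h) f' ->
    (forall a, f a = f' a) \/ (forall a, f a = letter_inv (f' a)) ->
  forall x, act g x = act h x.
Proof.
move=> gf hf [e|e] x.
  congr (act _ x); apply: val_inj; apply: aut_letter_eq => a.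
  by rewrite gf hf e.
have oT : ~~ odd #|[set: 'I_4]| by rewrite cardsT card_ord.
rewrite -[RHS]four_flipT aFE -lactM; congr (act _ x).
apply: val_inj; apply: aut_letter_eq => a.
rewrite gf e -[LHS](_ : flip setT (fg_letter (f' a)) = _); last first.
  by rewrite flip_letterE flip_letter_in ?inE.
by rewrite -hf -(sflipE oT).
Qed.

(** Two sign changes and two double quarter turns. The double quarter turns square to [flip setT],
    so the four elements are commuting involutions only modulo the inversion of all letters, which
    acts trivially by [four_flipT]. *)
Definition four_elt (i : nat) : SAut 4 :=
  match i with
  | 0 => sflip [set o0; o1]
  | 1 => sflip [set o0; o2]
  | 2 => (swx (l o0) (l o1) * swx (l o2) (l o3))%g
  | _ => (swx (l o0) (l o2) * swx (l o1) (l o3))%g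
  end.

Definition four_letter (i : nat) (a : letter 4) : letter 4 :=
  match i with
  | 0 => (a.1, a.2 (+) ((a.1 == o0) || (a.1 == o1)))
  | 1 => (a.1, a.2 (+) ((a.1 == o0) || (a.1 == o2)))
  | 2 => wl (l o0) (l o1) (wl (l o2) (l o3) a)
  | _ => wl (l o0) (l o2) (wl (l o1) (l o3) a)
  end.

Lemma four_eltE i : letter_aut (val (four_elt i)) (four_letter i).
Proof.
have W2 i1 j1 i2 j2 : i1 != j1 -> i2 != j2 ->
    letter_aut (val (swx (l i1) (l j1) * swx (l i2) (l j2))%g)
      (fun a => wl (l i1) (l j1) (wl (l i2) (l j2) a)).
  move=> h1 h2; have H1 := @wxE _ (l i1) (l j1) h1; have H2 := @wxE _ (l i2) (l j2) h2.
  have := letter_aut_comp H1 H2.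
  by rewrite SAut_valM (swxE hn (h1 : (l i1).1 != (l j1).1)) (swxE hn (h2 : (l i2).1 != (l j2).1)).
have F2 i1 j1 : i1 != j1 -> letter_aut (val (sflip [set i1; j1]))
      (fun a : letter 4 => (a.1, a.2 (+) ((a.1 == i1) || (a.1 == j1)))).
  move=> ij a; rewrite (sflipE (odd_set2 ij)) flip_letterE /flip_letter !inE.
  by [].
by case: i => [|[|[|i]]]; [exact: F2|exact: F2|exact: W2|exact: W2].
Qed.

Lemma letter_aut_valM (g h : SAut 4) f f' : letter_aut (val g) f ->
  letter_aut (val h) f' -> letter_aut (val (g * h)%g) (f \o f').
Proof. exact: letter_aut_comp. Qed.

Lemma four_elt_exp i (b : bool) :
  letter_aut (val (four_elt i ^+ b)%g) (if b then four_letter i else id).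
Proof. by case: b; [exact: four_eltE|]. Qed.

Definition letters4 : seq (letter 4) :=
  [seq (i, s) | i <- [:: o0; o1; o2; o3], s <- [:: false; true]].

Lemma letters4P a : a \in letters4.
Proof. by case: a => -[[|[|[|[|//]]]] h] []. Qed.

Definition eq_letters4 (f f' : letter 4 -> letter 4) :=
  all (fun a => f a == f' a) letters4
  || all (fun a => f a == letter_inv (f' a)) letters4.

Lemma eq_letters4P f f' : eq_letters4 f f' ->
  (forall a, f a = f' a) \/ (forall a, f a = letter_inv (f' a)).
Proof.
by case/orP => /allP H; [left|right] => a; apply/eqP/H/letters4P.
Qed.

Lemma trivial4 g x : act g x = x.
Proof.
suff : forall a b x, a.1 != b.1 -> E a b x = x by move=> H; exact: (act_trivial hn).
(* Once one pair of sign changes acts trivially all do, and [linear_trivial] applies to the whole of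
   [X] because [8 = 2 ^ 3]. *)
have triv_flips : (exists i j, i != j /\ forall x, F [set i; j] x = x) ->
    forall a b x, a.1 != b.1 -> E a b x = x.
  move=> /four_flips H a b y ab.
  apply: (@linear_trivial _ hn _ act setT setT); rewrite ?inE ?cardsT ?card_ord //.
  by move=> i j z ij _ _ _; exact: H.
pose p (i : 'I_4) := perm (@act_inj _ _ act (four_elt i)).
have pE i y : p i y = act (four_elt i) y by rewrite permE.
have comm i j : commute (p i) (p j).
  apply/permP => y; rewrite !permM !pE -!lactM.
  apply: (four_letter_eq (letter_aut_valM (four_eltE j) (four_eltE i))
                         (letter_aut_valM (four_eltE i) (four_eltE j))).
  apply: eq_letters4P; case: i j => -[|[|[|[|//]]]] hi [[|[|[|[|//]]]] hj];
    by vm_compute.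
have invol i : (p i * p i = 1)%g.
  apply/permP => y; rewrite permM perm1 !pE -[RHS](lact1 act) -lactM.
  apply: (four_letter_eq (f' := id) (letter_aut_valM (four_eltE i) (four_eltE i))) => //.
  by apply: eq_letters4P; case: i => -[|[|[|[|//]]]] hi; vm_compute.
have [c [i0 ci0] /permP c1] := commuting_involutions comm invol hX.
(* The factors are in reverse order because a product of permutations applies its left factor
   first. *)
pose h4 : SAut 4 := (four_elt 3%N ^+ c o3 * (four_elt 2%N ^+ c o2 *
    (four_elt 1%N ^+ c o1 * four_elt 0%N ^+ c o0)))%g.
have gx y : act h4 y = y.
  have pX i (b : bool) z : ((p i) ^+ b)%g z = act (four_elt i ^+ b)%g z.
    by case: b; rewrite ?expg1 ?pE // expg0 perm1 lact1.
  have L0 : ord0 = o0 by apply: val_inj.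
  have L1 : lift ord0 ord0 = o1 by apply: val_inj.
  have L2 : lift ord0 (lift ord0 ord0) = o2 by apply: val_inj.
  have L3 : lift ord0 (lift ord0 (lift ord0 ord0)) = o3 by apply: val_inj.
  have := c1 y; rewrite !big_ord_recl big_ord0 mulg1 L1 L2 L3 L0 !permM perm1 !pX.
  by move=> H; rewrite /h4 !lactM; exact: H.
have gE := letter_aut_valM (four_elt_exp 3 (c o3)) (letter_aut_valM (four_elt_exp 2 (c o2))
  (letter_aut_valM (four_elt_exp 1 (c o1)) (four_elt_exp 0 (c o0)))).
rewrite -/h4 in gE; set f := _ \o _ in gE.
have conj a b y : a.1 != b.1 -> E a b y = E (f a) (f b) y.
  move=> ab; have ab' : (f a).1 != (f b).1 by rewrite (letter_aut_eq1 gE).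
  rewrite -{1}(gx (E a b y)) -{2}(gx y) !aEE; apply: act_eq2.
  by rewrite (stvE hn ab) (stvE hn ab'); exact: letter_aut_conj.
(* A kernel element exchanging the letters [0] and [j] identifies [E x_0 x_j] with
   a transvection in the opposite direction. *)
have swapped j k : l j != l o0 -> o0 != k -> j != k -> (f (l o0)).1 = j ->
    (f (l j)).1 = o0 -> forall a b x, a.1 != b.1 -> E a b x = x.
  move=> j0 k0 jk f0 fj.
  have oj : (l o0).1 != (l j).1 by rewrite eq_sym; apply: contraNneq j0 => /= ->.
  apply: (@one_tv_trivial _ hn _ act (l o0) (l k)) => //.
  apply: (@swapped_tv_trivial _ hn _ act (l o0) (l j) (l k) (f (l o0)) (f (l j))) => //.
    by move=> d e y; exact: four_tvV.
  by move=> y; exact: conj.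
have flips U f' : letter_aut (val (sflip U)) f' ->
    (forall a, f a = f' a) \/ (forall a, f a = letter_inv (f' a)) ->
    forall y, F U y = y.
  by move=> Uf' ff' y; rewrite aFE -(four_letter_eq gE Uf' ff').
have nz : [|| c o0, c o1, c o2 | c o3].
  case: i0 ci0 => -[|[|[|[|//]]]] h ch; apply/or4P;
    [apply: Or41|apply: Or42|apply: Or43|apply: Or44];
    by apply: (@eq_ind _ (Ordinal h) (fun k => is_true (c k)) ch); apply: val_inj.
move: nz @f gE conj swapped flips; rewrite /h4.
case: (c o3); case: (c o2); case: (c o1); case: (c o0) => // _ gE conj swapped flips.
(* Twelve of the fifteen possible kernel elements involve a double transposition, exchanging 0 with
   3, 2 or 1 in turn; the other three are sign changes. *)
1-4: by apply: (swapped o3 o1) => //; apply: val_inj; vm_compute.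
1-4: by apply: (swapped o2 o1) => //; apply: val_inj; vm_compute.
1-4: by apply: (swapped o1 o2) => //; apply: val_inj; vm_compute.
all: have FL i j : i != j -> letter_aut (val (sflip [set i; j]))
      (fun a : letter 4 => (a.1, a.2 (+) ((a.1 == i) || (a.1 == j)))) by
    move=> ij a; rewrite (sflipE (odd_set2 ij)) flip_letterE /flip_letter !inE.
- apply: triv_flips; exists o1, o2; split=> //; apply: (flips _ _ (FL o1 o2 isT)).
  by apply: eq_letters4P; vm_compute.
- apply: triv_flips; exists o0, o2; split=> //; apply: (flips _ _ (FL o0 o2 isT)).
  by apply: eq_letters4P; vm_compute.
- apply: triv_flips; exists o0, o1; split=> //; apply: (flips _ _ (FL o0 o1 isT)).
  by apply: eq_letters4P; vm_compute.
Qed.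

End Four.

(** * Rank 3 *)

(* Permutations of [{0, ..., 5}] as lists of values. *)
Definition comp6 (s t : seq nat) : seq nat := map (nth 0 s) t.
Definition inv6 (s : seq nat) : seq nat := map (index^~ s) (iota 0 6).

(* Here [c] and [r] stand for the images of the cyclic permutation
   [x_0 -> x_1 -> x_2] of the basis and of the transvection [E_01]. *)
Definition check6 (c r : seq nat) : bool :=
  let conj s := comp6 c (comp6 s (comp6 c c)) in
  let r12 := conj r in
  let r02 := comp6 (inv6 r) (comp6 r12 (comp6 r (inv6 r12))) in
  let r21 := conj (conj r02) in
  if comp6 r r21 == comp6 r21 r then
    if comp6 r21 r02 == comp6 r02 (comp6 r r21) then r == iota 0 6 else true
  else true.

(** Testing [c ^ 3 = 1] first keeps 81 of the 720 permutations [c]. Conditionals rather than boolean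
    conjunctions keep [vm_compute] from evaluating the later tests when an earlier one fails. *)
Lemma check6_all : all (fun c =>
    if comp6 c (comp6 c c) == iota 0 6 then
      all (check6 c) (permutations (iota 0 6)) else true)
  (permutations (iota 0 6)).
Proof. by vm_compute. Qed.

Lemma check6P c r r12 r02 r21 :
    c \in permutations (iota 0 6) -> r \in permutations (iota 0 6) ->
    comp6 c (comp6 c c) = iota 0 6 ->
    r12 = comp6 c (comp6 r (comp6 c c)) ->
    r02 = comp6 (inv6 r) (comp6 r12 (comp6 r (inv6 r12))) ->
    r21 = comp6 c (comp6 (comp6 c (comp6 r02 (comp6 c c))) (comp6 c c)) ->
    comp6 r r21 = comp6 r21 r -> comp6 r21 r02 = comp6 r02 (comp6 r r21) ->
  r = iota 0 6.
Proof.
move=> cP rP c3 e12 e02 e21 comm rel.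
have eqss (s : seq nat) : (s == s) = true by exact: eqxx.
have : check6 c r.
  have := allP check6_all _ cP; move: (iota 0 6) c3 rP => s c3; cbv beta.
  by rewrite c3 eqss => rP /allP/(_ _ rP).
rewrite /check6; cbv zeta; rewrite -e12 -e02 -e21 rel comm !eqss.
by move/eqP.
Qed.

Section SixPoints.
Variables (G : groupType) (X : finType) (act : leftAction G X).
Hypothesis hX : #|X| <= 6.

(** Surplus indices [i >= #|X|] are fixed, so a set of fewer than six points also gives permutations
    of six indices. *)
Definition point6 (i : nat) (g : G) : nat :=
  if insub i is Some k then enum_rank (act g (enum_val (k : 'I_#|X|))) else i.

Definition perm6 g := map (point6^~ g) (iota 0 6).

Lemma point6_lt i g : i < 6 -> point6 i g < 6.
Proof.
rewrite /point6; case: insubP => //= k _ _ _.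
exact: leq_trans (ltn_ord _) hX.
Qed.

Lemma point6M i g h : point6 i (g * h)%g = point6 (point6 i h) g.
Proof.
rewrite /point6; case: (insubP _ i) => [k _ _|ki]; last by rewrite insubN.
by rewrite valK enum_rankK lactM.
Qed.

Lemma nth_perm6 i g : i < 6 -> nth 0 (perm6 g) i = point6 i g.
Proof. by move=> i6; rewrite (nth_map 0) ?size_iota // nth_iota. Qed.

Lemma perm6M g h : perm6 (g * h)%g = comp6 (perm6 g) (perm6 h).
Proof.
rewrite /comp6 [in RHS]/perm6 -map_comp.
apply/eq_in_map => i; rewrite mem_iota => /andP[_ i6].
by rewrite point6M -nth_perm6 ?point6_lt.
Qed.

Lemma perm61 : perm6 1%g = iota 0 6.
Proof.
rewrite -[RHS]map_id; apply: eq_map => i; rewrite /point6.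
by case: insubP => //= k _ <-; rewrite lact1 enum_valK.
Qed.

Lemma perm6_inj g h : (forall i, i < 6 -> point6 i g = point6 i h) -> act g =1 act h.
Proof.
move=> e x; have := e _ (leq_trans (ltn_ord (enum_rank x)) hX); rewrite /point6 !valK !enum_rankK.
by move=> /val_inj/enum_rank_inj.
Qed.

Lemma point6K g : cancel (point6^~ g) (point6^~ g^-1%g).
Proof.
move=> i; rewrite -point6M mulVg /point6.
by case: insubP => //= k _ <-; rewrite lact1 enum_valK.
Qed.

Lemma perm6_uniq g : uniq (perm6 g).
Proof. by rewrite map_inj_uniq ?iota_uniq //; exact: can_inj (point6K g). Qed.

Lemma perm6_permutation g : perm6 g \in permutations (iota 0 6).
Proof.
have s : {subset perm6 g <= iota 0 6}.
  move=> k /mapP[i]; rewrite !mem_iota => /andP[_ i6] ->.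
  exact: point6_lt.
have [|_ h] := uniq_min_size (perm6_uniq g) s; first by rewrite size_map !size_iota.
rewrite mem_permutations; apply: uniq_perm; rewrite ?iota_uniq //.
exact: perm6_uniq.
Qed.

Lemma perm6V g : perm6 g^-1%g = inv6 (perm6 g).
Proof.
apply/eq_in_map => i; rewrite mem_iota => /andP[_ i6].
have i6' := point6_lt g^-1%g i6.
have E : nth 0 (perm6 g) (point6 i g^-1%g) = i.
  by rewrite nth_perm6 // -{2}[i](point6K g^-1%g) invgK.
by rewrite -{2}E index_uniq ?perm6_uniq // size_map size_iota.
Qed.

Lemma six_points_trivial c r r12 r02 r21 :
    (c * (c * c) = 1 -> r12 = c * (r * (c * c)) ->
     r02 = r^-1 * (r12 * (r * r12^-1)) ->
     r21 = c * (c * (r02 * (c * c)) * (c * c)) ->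
     r * r21 = r21 * r -> r21 * r02 = r02 * (r * r21) ->
  forall x, act r x = x)%g.
Proof.
move=> c3 e12 e02 e21 comm rel.
have r1 : perm6 r = perm6 1%g.
  rewrite perm61.
  apply: (@check6P (perm6 c) (perm6 r) (perm6 r12) (perm6 r02) (perm6 r21)).
  - exact: perm6_permutation.
  - exact: perm6_permutation.
  - by rewrite -!perm6M c3 perm61.
  - by rewrite -!perm6M e12.
  - by rewrite -!perm6V -!perm6M -e02.
  - by rewrite -!perm6M -e21.
  - by rewrite -!perm6M comm.
  - by rewrite -!perm6M rel.
move=> x; rewrite -[RHS](lact1 act); apply: perm6_inj => i i6.
by rewrite -!nth_perm6 // r1.
Qed.

End SixPoints.

Section Three.
Variables (X : finType) (act : leftAction (SAut 3) X).
Hypothesis hX : #|X| <= 6.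

Let hn : 2 < 3 := isT.
Let o0 : 'I_3 := @Ordinal 3 0 isT.
Let o1 : 'I_3 := @Ordinal 3 1 isT.
Let o2 : 'I_3 := @Ordinal 3 2 isT.
Let l i : letter 3 := (i, false).

Lemma trivial3 g x : act g x = x.
Proof.
suff : forall a b x, a.1 != b.1 -> aE act a b x = x by move=> H; exact: (act_trivial hn).
(* The signs of the two quarter turns cancel: [c] is the unsigned cycle of the basis, so [c ^ 3 = 1]
   holds exactly. *)
pose c : SAut 3 := (swx (l o0) (l o1) * swx (l o1) (l o2))%g.
pose f := wl (l o0) (l o1) \o wl (l o1) (l o2).
have h01 : (l o0).1 != (l o1).1 by [].
have h12 : (l o1).1 != (l o2).1 by [].
have h02 : (l o0).1 != (l o2).1 by [].
have h21 : (l o2).1 != (l o1).1 by [].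
have cf : letter_aut (val c) f.
  have := letter_aut_comp (wxE h01) (wxE h12).
  by rewrite SAut_valM (swxE hn h01) (swxE hn h12).
have f0 : f (l o0) = l o1 by apply/eqP; vm_compute.
have f1 : f (l o1) = l o2 by apply/eqP; vm_compute.
have f2 : f (l o2) = l o0 by apply/eqP; vm_compute.
have c3 : (c * (c * c) = 1)%g.
  apply: val_inj; apply: aut_gen_eq => i; exists false.
  rewrite !SAut_valM (letter_aut_comp cf (letter_aut_comp cf cf)).
  rewrite [RHS]aut_oneE; congr fg_letter.
  by case: i => -[|[|[|//]]] h; apply/eqP; vm_compute.
have cV : (c^-1 = c * c)%g := mulg1_eq c3.
have conj a b : a.1 != b.1 -> (c * stv a b * (c * c) = stv (f a) (f b))%g.
  move=> ab; rewrite -cV; apply: (mulIg c); rewrite mulgVK.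
  have ab' : (f a).1 != (f b).1 by rewrite (letter_aut_eq1 cf).
  apply: val_inj; rewrite !SAut_valM (stvE hn ab) (stvE hn ab').
  exact: letter_aut_conj.
pose r a b := stv (l a) (l b).
have r12 : (r o1 o2 = c * (r o0 o1 * (c * c)))%g by rewrite mulgA conj // f0 f1.
have r02 : (r o0 o2 = (r o0 o1)^-1 * (r o1 o2 * (r o0 o1 * (r o1 o2)^-1)))%g.
  apply: (mulgI (r o0 o1)); apply: (mulIg (r o1 o2)); rewrite mulVKg mulgA mulgVK.
  apply: val_inj; rewrite !SAut_valM (stvE hn h01) (stvE hn h02) (stvE hn h12).
  exact/esym/(tv_rel h01 h02 h12).
have r21 : (r o2 o1 = c * (c * (r o0 o2 * (c * c)) * (c * c)))%g.
  have r10 : (r o1 o0 = c * (r o0 o2 * (c * c)))%g by rewrite mulgA conj // f0 f2.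
  by rewrite -r10 mulgA conj // f0 f1.
have e1 : (r o0 o1 * r o2 o1 = r o2 o1 * r o0 o1)%g.
  apply: val_inj; rewrite !SAut_valM (stvE hn h01) (stvE hn h21).
  exact: tv_comm.
have e2 : (r o2 o1 * r o0 o2 = r o0 o2 * (r o0 o1 * r o2 o1))%g.
  apply: val_inj; rewrite !SAut_valM (stvE hn h01) (stvE hn h21) (stvE hn h02).
  by rewrite mulgA; exact: (tv_rel h02 h01 h21).
have triv01 := @six_points_trivial _ X act hX _ _ _ _ _ c3 r12 r02 r21 e1 e2.
by apply: (@one_tv_trivial _ hn _ act (l o0) (l o1) h01) => y; rewrite aEE; exact: triv01.
Qed.

End Three.

Theorem theorem3p16 (n : nat) (hn : 3 <= n) (X : finType) (hX : #|X| < k_of n)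
    (act : leftAction (SAut n) X) (g : SAut n) (x : X) :
  act g x = x.
Proof.
case: n hn act g hX => [|[|[|[|[|[|[|m]]]]]]] // hn act g hX.
- exact: (@trivial3 X act hX).
- exact: (@trivial4 X act hX).
- exact: (@trivial5 X act hX).
- exact: (@trivial6 X act hX).
set n := m.+4.+3 in hn act g hX *.
have [r /andP[hr hXr]] : exists r,
    (2 * (r + 3) <= n) && (#|X| < minn (2 ^ (n - r - p_of n)) 'C(n, r)).
  pose P r := (2 * (r + 3) <= n) && (#|X| < minn (2 ^ (n - r - p_of n)) 'C(n, r)).
  have [/existsP[r Pr]|] := boolP [exists r : 'I_n, P r]; first by exists r.
  rewrite negb_exists => /forallP noP.
  move: hX; rewrite ltnNge => /negP[]; apply/bigmax_leqP => r hr.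
  by have := noP r; rewrite /P hr -leqNgt.
move: hXr; rewrite leq_min => /andP[h1 h2].
exact: (@trivial_large n X act r).
Qed.
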